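(* Let $b$ be a prime, $s\ge1$ an integer, $m,n\in\mathbb{N}$ with $m\leq n$, let $p\in\mathbb{F}_b[x]$ be irreducible with $\deg(p)=n$, let $r>0$ be an odd integer, and let $\boldsymbol{q}_1,\ldots,\boldsymbol{q}_r$ be chosen independently and uniformly at random from the set $G_n^s$, where $G_n=\{q\in\mathbb{F}_b[x]\mid q\ne0,\ \deg(q)<n\}$. Then, for any integer $\alpha\geq2$, any $1\le q\le\infty$, any set of positive weights $\boldsymbol{\gamma}=\{\gamma_u\}_{u\subseteq\{1,\ldots,s\}}$ with $\gamma_\emptyset=1$, and any $0<\eta<1$, the worst-case error of the median rule $M_{m,n,s,p,r}$ in the weighted Sobolev space $\mathcal{F}^{\mathrm{sob}}_{s,\alpha,\boldsymbol{\gamma},q}$ satisfies \[ e^{\mathrm{wor}}(M_{m,n,s,p,r}; \mathcal{F}^{\mathrm{sob}}_{s,\alpha,\boldsymbol{\gamma},q}) \leq \inf_{1/\alpha<\lambda<1}\left(\frac{2}{\eta(b^{\min(m,\lambda n)}-1)}\sum_{\emptyset \neq u\subseteq \{1,\ldots,s\}}\gamma_u^{\lambda}C_{\alpha}^{\lambda|u|}A_{\alpha,\lambda}^{|u|}\right)^{1/\lambda} \] with probability (over the random choice of $\boldsymbol{q}_1,\ldots,\boldsymbol{q}_r$) at least \[ 1-\binom{r}{(r+1)/2}\eta^{(r+1)/2},\] where \[ A_{\alpha,\lambda}=\sum_{\tau=1}^{\alpha-1}\prod_{i=1}^{\tau}\frac{b-1}{b^{\lambda i}-1}+\frac{b^{\lambda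 \alpha}-1}{b^{\lambda \alpha}-b}\prod_{i=1}^{\alpha}\frac{b-1}{b^{\lambda i}-1} \] and \[ C_{\alpha}= \left(1+\frac{1}{b}+\frac{1}{b(b+1)} \right)^{\alpha-2}\left(3+\frac{2}{b}+\frac{2b+1}{b-1} \right)\max\left( \frac{2}{(2\sin\frac{\pi}{b})^{\alpha}},\max_{1\leq \tau< \alpha}\frac{1}{(2\sin\frac{\pi}{b})^{\tau}}\right). \]
   Context: For an integrable function $f:[0,1)^s\to\mathbb{R}$ write $I_s(f)=\int_{[0,1)^s}f(\boldsymbol{x})\,d\boldsymbol{x}$, and for a finite point set $P$ of $N$ points (counted with multiplicity) write $Q_P(f)=\frac1N\sum_{\boldsymbol{x}\in P}f(\boldsymbol{x})$. $\mathbb{N}$ is the set of positive integers and $\mathbb{N}_0=\mathbb{N}\cup\{0\}$. $\mathbb{F}_b$ is the finite field of prime order $b$, identified with $\{0,1,\ldots,b-1\}$. An integer $h\in\mathbb{N}_0$ with $b$-adic expansion $h=\eta_0+\eta_1b+\cdots$ is associated with the polynomial $h(x)=\eta_0+\eta_1x+\cdots\in\mathbb{F}_b[x]$. High-order polynomial lattice point set: for $m\le n$, $p\in\mathbb{F}_b[x]$ with $\deg(p)=n$ and $\boldsymbol{q}=(q_1,\ldots,q_s)\in(\mathbb{F}_b[x])^s$ with $\deg(q_j)<n$, it consists of the $N=b^m$ points \[P_{m,n,s,p,\boldsymbol{q}}=\left\{\left(\nu_n\left(\frac{h(x)q_1(x)}{p(x)}\right),\ldots,\nu_n\left(\frac{h(x)q_s(x)}{p(x)}\right)\right)\in[0,1)^s\;\middle|\;h=0,\ldots,b^m-1\right\},\]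 where $\nu_n:\mathbb{F}_b((x^{-1}))\to[0,1)$ is defined on formal Laurent series by $\nu_n\left(\sum_{i=w}^\infty a_ix^{-i}\right)=\sum_{i=\max(1,w)}^n a_ib^{-i}$. Weighted Sobolev space: for an integer $\alpha\ge2$, $1\le q\le\infty$ and positive weights $\boldsymbol{\gamma}=\{\gamma_u\}_{u\subseteq\{1,\ldots,s\}}$ with $\gamma_\emptyset=1$, $\mathcal{F}^{\mathrm{sob}}_{s,\alpha,\boldsymbol{\gamma},q}$ is the Banach space of (not necessarily periodic) smooth functions $f:[0,1)^s\to\mathbb{R}$ with the norm \[\|f\|^{\mathrm{sob}}_{s,\alpha,\boldsymbol{\gamma},q}=\sup_{u\subseteq\{1,\ldots,s\}}\gamma_u^{-1}\left(\sum_{v\subseteq u}\sum_{\boldsymbol{\tau}_{u\setminus v}\in\{1,\ldots,\alpha\}^{|u\setminus v|}}\int_{[0,1)^{|v|}}\left|\int_{[0,1)^{s-|v|}}f^{(\boldsymbol{\tau}_{u\setminus v},\boldsymbol{\alpha}_v,\boldsymbol{0})}(\boldsymbol{x})\,d\boldsymbol{x}_{-v}\right|^q d\boldsymbol{x}_v\right)^{1/q}\] (with the usual modification for $q=\infty$). Here $(\boldsymbol{\tau}_{u\setminus v},\boldsymbol{\alpha}_v,\boldsymbol{0})$ is the vector $\boldsymbol{h}\in\mathbb{N}_0^s$ with $h_j=\tau_j$ if $j\in u\setminus v$, $h_j=\alpha$ if $j\in v$ and $h_j=0$ otherwise; $f^{(\boldsymbol{h})}$ is the mixed partial derivative of order $\boldsymbol{h}$;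 $\boldsymbol{x}_v=(x_j)_{j\in v}$ and $\boldsymbol{x}_{-v}=(x_j)_{j\in\{1,\ldots,s\}\setminus v}$. (The scalar $q$ is an integrability exponent, unrelated to the polynomial vectors $\boldsymbol{q}_\ell$.) Median rule: given $\boldsymbol{q}_1,\ldots,\boldsymbol{q}_r$, \[M_{m,n,s,p,r}(f)=\operatorname{median}\left(Q_{P_{m,n,s,p,\boldsymbol{q}_1}}(f),\ldots,Q_{P_{m,n,s,p,\boldsymbol{q}_r}}(f)\right).\] Its worst-case error is the random variable (a function of $\boldsymbol{q}_1,\ldots,\boldsymbol{q}_r$) \[e^{\mathrm{wor}}(M_{m,n,s,p,r};\mathcal{F}^{\mathrm{sob}}_{s,\alpha,\boldsymbol{\gamma},q})=\sup_{f\in\mathcal{F}^{\mathrm{sob}}_{s,\alpha,\boldsymbol{\gamma},q},\ \|f\|^{\mathrm{sob}}_{s,\alpha,\boldsymbol{\gamma},q}\le1}|M_{m,n,s,p,r}(f)-I_s(f)|,\] i.e. the vectors are drawn first and then the supremum over $f$ is taken. *)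

(* Defs.v *)
From HB Require Import structures.
From mathcomp Require Import all_boot all_order all_algebra.
From mathcomp Require Export qpoly.
From mathcomp Require Import all_classical all_reals all_analysis.
From mathcomp Require Import ess_sup_inf.

Set Implicit Arguments.
Unset Strict Implicit.
Unset Printing Implicit Defensive.

Import Order.TTheory GRing.Theory Num.Theory.
Import numFieldNormedType.Exports.

Local Open Scope classical_set_scope.
Local Open Scope ring_scope.

(* A formal Laurent series over F in x^-1 is represented by its coefficients
   L : int -> F, where L i is the coefficient of x^(-i).  For the series f / p
   they are read off from polynomial division: for k >= 0 the coefficient of
   x^(-k) is the constant coefficient of the polynomial part of x^k f / p, and
   the coefficient of x^k is that of the polynomial part of f / p.  That this
   is the quotient in the field of Laurent series is [laurent_frac_lbound] and
   [laurent_fracP]: it has finitely many positive powers and p L = f. *)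
Definition laurent_frac (F : fieldType) (f p : {poly F}) (i : int) : F :=
  match i with
  | Posz k => ((f * 'X^k) %/ p)`_0
  | Negz k => (f %/ p)`_k.+1
  end.

Section LaurentFrac.
Variables (F : fieldType) (f p : {poly F}).
Hypothesis p0 : p != 0.

Lemma laurent_frac_shift (k l : nat) :
  laurent_frac f p (k%:Z - l%:Z) = ((f * 'X^k) %/ p)`_l.
Proof.
have key (g : {poly F}) j : ((g * 'X) %/ p)`_j.+1 = (g %/ p)`_j.
  rewrite [in LHS](divp_eq g p) mulrDl mulrAC divpD mulpK// coefD coefMX /=.
  suff -> : ((g %% p * 'X) %/ p)`_j.+1 = 0 by rewrite addr0.
  apply: nth_default; rewrite size_divp//.
  have := ltn_modpN0 g p0; set r := g %% p => rp.
  have [->|r0] := eqVneq r 0; first by rewrite mul0r size_poly0.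
  rewrite size_mulX// leq_subLR; apply: leq_trans rp _.
  by case: (size p) => [//|k']; rewrite addnS ltnS leq_addr.
elim: k l => [|k IH] [|l].
- by rewrite subrr.
- by rewrite sub0r -NegzE /= expr0 mulr1.
- by rewrite subr0.
- have -> : k.+1%:Z - l.+1%:Z = k%:Z - l%:Z by rewrite !intS opprD addrACA subrr add0r.
  by rewrite IH exprSr mulrA key.
Qed.

Lemma laurent_fracP (i : int) :
  \sum_(k < size p) p`_k * laurent_frac f p (k%:Z + i) =
  if 0 < i then 0 else f`_`|i|%N.
Proof.
have E (g : {poly F}) l :
    \sum_(k < size p) p`_k * ((g * 'X^k) %/ p)`_l = g`_l.
  rewrite -[in RHS](mulpK g p0) -[in X in X %/ _](coefK p) poly_def mulr_sumr.
  rewrite (big_morph (fun q => q %/ p) (id1 := 0) (op1 := +%R)) ?div0p//; last first.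
    by move=> *; exact: divpD.
  rewrite coef_sum; apply: eq_bigr => k _.
  by rewrite -scalerAr divpZl coefZ.
case: i => [[|i]|i].
- rewrite ltxx -[RHS](E f); apply: eq_bigr => k _.
  by rewrite -(laurent_frac_shift k 0).
- rewrite ltz_nat /= -[RHS](_ : (f * 'X^(i.+1))`_0 = 0); last by rewrite coefMXn.
  rewrite -(E (f * 'X^(i.+1))); apply: eq_bigr => k _.
  by rewrite -mulrA -exprD addnC.
- rewrite -[RHS](E f); apply: eq_bigr => k _.
  by rewrite NegzE laurent_frac_shift.
Qed.

Lemma laurent_frac_lbound (i : int) :
  i <= - (size f)%:Z -> laurent_frac f p i = 0.
Proof.
case: i => [k|k].
- case: (posnP (size f)) => [/eqP|f0].
    by rewrite size_poly_eq0 => /eqP -> _ /=; rewrite mul0r div0p coef0.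
  move=> /le_lt_trans/(_ (_ : - (size f)%:Z < 0)).
  by rewrite oppr_lt0 ltz_nat f0 => /(_ isT).
rewrite NegzE lerN2 lez_nat /= => fk; apply: nth_default.
rewrite size_divp// leq_subLR; apply: leq_trans fk _; exact: leq_addl.
Qed.
End LaurentFrac.

Section PolynomialLattice.
Variable R : realType.

Definition nu (b n : nat) (L : int -> 'F_b) : R :=
  \sum_(1 <= i < n.+1) (nat_of_ord (L i%:Z))%:R * b%:R ^- i.

(* The digits of h of index at least h vanish, since h < b ^ h. *)
Definition poly_of_nat (b h : nat) : {poly 'F_b} :=
  \poly_(i < h) ((h %/ b ^ i) %% b)%:R.

Definition lattice_point (b n s : nat) (p : {poly 'F_b})
    (qs : 'I_s -> {poly 'F_b}) (h : nat) : s.-tuple R :=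
  [tuple nu n (laurent_frac (poly_of_nat b h * qs j) p) | j < s].

(* A sequence, so that points are counted with multiplicity. *)
Definition lattice (b m n s : nat) (p : {poly 'F_b})
    (qs : 'I_s -> {poly 'F_b}) : seq (s.-tuple R) :=
  [seq lattice_point n p qs h | h <- iota 0 (b ^ m)].

Definition qmc (s : nat) (P : seq (s.-tuple R)) (f : s.-tuple R -> R) : R :=
  (size P)%:R^-1 * \sum_(x <- P) f x.

(* The middle value of a list of odd length. *)
Definition median (l : seq R) : R := nth 0 (sort <=%R l) (size l)./2.

Definition median_rule (b m n s : nat) (p : {poly 'F_b}) (r : nat)
    (qs : 'I_r -> 'I_s -> {poly 'F_b}) (f : s.-tuple R -> R) : R :=
  median [seq qmc (lattice m n p (qs l)) f | l <- enum 'I_r].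

End PolynomialLattice.

(* {poly_n F} consists of the polynomials of degree < n. *)
Definition Gset (b n : nat) : {set {poly_n 'F_b}} := [set q | q != 0]%SET.

Definition Gvec (b n s : nat) : {set {ffun 'I_s -> {poly_n 'F_b}}} :=
  [set w : {ffun 'I_s -> {poly_n 'F_b}} | [forall j, w j \in Gset b n]]%SET.

(* Probability that E holds for r independent draws, each uniform on A. *)
Definition iid_uniform_pr (R : realType) (T : finType) (A : {set T}) (r : nat)
    (E : {ffun 'I_r -> T} -> Prop) : R :=
  \sum_(w : {ffun 'I_r -> T} | [forall l, w l \in A] && `[< E w >])
    \prod_(l < r) #|A|%:R^-1.

(* Lebesgue measure on R^n: the iterated product of the one-dimensional one,
   transported along (t, x) |-> t :: x. *)
Section LebesgueTuple.
Variable R : realType.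
Local Open Scope ereal_scope.

Definition tcons n (z : R * n.-tuple R) : n.+1.-tuple R := [tuple of z.1 :: z.2].

Definition tuncons n (x : n.+1.-tuple R) : R * n.-tuple R :=
  (thead x, [tuple of behead x]).

Lemma tunconsK n : cancel (@tuncons n) (@tcons n).
Proof. by move=> x; rewrite /tcons /= -tuple_eta. Qed.

Lemma measurable_tcons n : measurable_fun [set: _] (@tcons n).
Proof. exact: (measurable_cons measurable_fst measurable_snd). Qed.

Lemma measurable_tuncons n : measurable_fun [set: _] (@tuncons n).
Proof.
apply/measurable_fun_pairP; split.
  exact: measurable_tnth.
exact: measurable_behead.
Qed.

Section Step.
Variables (n : nat) (mu : {sigma_finite_measure set (n.-tuple R) -> \bar R}).

Definition leb_step : set (n.+1.-tuple R) -> \bar R :=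
  pushforward (@lebesgue_measure R \x mu) (@tcons n).

Let m : {measure set (n.+1.-tuple R) -> \bar R} :=
  measure_function_pushforward__canonical__measure_function_Measure
    (@lebesgue_measure R \x mu) (@measurable_tcons n).

HB.instance Definition _ := isMeasure.Build _ _ _ leb_step
  (measure0 m) (measure_ge0 m) (@measure_semi_sigma_additive _ _ _ m).

Let leb_step_sigma_finite : sigma_finite setT leb_step.
Proof.
have /sigma_finiteP[F [TF ndF mF]] := sigma_finiteT (@lebesgue_measure R).
have /sigma_finiteP[G [TG ndG mG]] := sigma_finiteT mu.
exists (fun i => @tuncons n @^-1` (F i `*` G i)).
  rewrite -preimage_bigcup; apply/seteqP; split=> // x _.
  have : [set: R] (tuncons x).1 by []; rewrite TF => -[i _ Fi].
  have : [set: n.-tuple R] (tuncons x).2 by []; rewrite TG => -[j _ Gj].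
  exists (maxn i j) => //; split.
    by move: Fi; exact/subsetPset/ndF/leq_maxl.
  by move: Gj; exact/subsetPset/ndG/leq_maxr.
move=> i; have [mFi Foo] := mF i; have [mGi Goo] := mG i; split.
  rewrite -[X in measurable X]setTI; apply: measurable_tuncons => //.
  exact: measurableX.
rewrite /leb_step /pushforward -comp_preimage.
rewrite (_ : _ \o _ = id) ?preimage_id; last first.
  by apply/funext => -[t x]; congr pair; exact/val_inj.
by rewrite product_measure1E// lte_mul_pinfty// ge0_fin_numE.
Qed.

HB.instance Definition _ := Measure_isSigmaFinite.Build _ _ _ leb_step
  leb_step_sigma_finite.
End Step.

Definition leb0 : set (0.-tuple R) -> \bar R := \d_ [tuple].

HB.instance Definition _ := Measure.on leb0.

Let leb0_sigma_finite : sigma_finite setT leb0.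
Proof.
apply: fin_num_fun_sigma_finite => [|U _]; first by rewrite measure0.
by rewrite /leb0 diracE.
Qed.

HB.instance Definition _ := Measure_isSigmaFinite.Build _ _ _ leb0
  leb0_sigma_finite.

Fixpoint leb (n : nat) : {sigma_finite_measure set (n.-tuple R) -> \bar R} :=
  match n with
  | 0 => leb0
  | k.+1 => leb_step (leb k)
  end.

Arguments leb n : clear implicits.

Lemma leb_box n (A : 'I_n -> set R) : (forall i, measurable (A i)) ->
  leb n [set x | forall i, A i (tnth x i)] = \prod_i lebesgue_measure (A i).
Proof.
elim: n A => [|n IH] A mA.
  rewrite big_ord0 /= /leb0 diracE mem_set//= => -[]//.
have := IH (fun i => A (lift ord0 i)) (fun i => mA _).
rewrite big_ord_recl /= => <-.
have mS : measurable [set x : n.-tuple R | forall i, A (lift ord0 i) (tnth x i)].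
  rewrite (_ : mkset _ =
      \bigcap_(i in [set: 'I_n]) ((@tnth n R)^~ i @^-1` A (lift ord0 i))).
    apply: fin_bigcap_measurable => // i _.
    by rewrite -[X in measurable X]setTI; exact: measurable_tnth.
  by apply/seteqP; split=> x /= Ax i => [_|]; exact: Ax.
rewrite -product_measure1E //; last exact: mA.
rewrite /leb_step /pushforward; congr (product_measure1 _ _ _).
apply/seteqP; split=> -[t x] /=.
  move=> Ax; split; first exact: (Ax ord0).
  by move=> i; have := Ax (lift ord0 i); rewrite tnthS.
move=> [At Ax] i; have [j ->|->] := unliftP ord0 i; last exact: At.
by rewrite tnthS; have := Ax j.
Qed.

End LebesgueTuple.

Arguments leb R n : clear implicits.

Section SobolevSpace.
Variables (R : realType) (s alpha : nat).

Definition cube (n : nat) : set (n.-tuple R) :=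
  [set x | forall i, 0 <= tnth x i < 1].
Arguments cube n : clear implicits.

Definition upd (x : s.-tuple R) (j : 'I_s) (t : R) : s.-tuple R :=
  [tuple if i == j then t else tnth x i | i < s].

Definition integral_cube (f : s.-tuple R -> R) : R :=
  \int[leb R s]_(x in cube s) f x.


Definition diff_order : Type := {ffun 'I_s -> 'I_alpha.+1}.

(* D h is the mixed partial derivative of f of order h on [0,1)^s.  The
   functions D h are integrable and, when h_j < alpha, D h is locally absolutely
   continuous in x_j with derivative D (h + e_j), expressed through the
   fundamental theorem of calculus.  So derivatives of order alpha in some
   variable are determined almost everywhere only, which is what makes the
   space complete; smooth functions with integrable derivatives are covered,
   see [is_mixed_derivs_classical]. *)
Definition is_mixed_derivs (f : s.-tuple R -> R)
    (D : diff_order -> s.-tuple R -> R) : Prop :=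
  [/\ forall x, cube s x -> D [ffun=> ord0] x = f x,
      forall h, (leb R s).-integrable (cube s) (EFin \o D h)
    & forall (h h' : diff_order) (j : 'I_s),
        h' j = (h j).+1 :> nat -> (forall i, i != j -> h' i = h i) ->
        forall x, cube s x -> forall t, 0 <= t < 1 ->
          lebesgue_measure.-integrable `[0, t] (fun u => (D h' (upd x j u))%:E) /\
          D h (upd x j t) =
            D h (upd x j 0) + \int[lebesgue_measure]_(u in `[0, t]) D h' (upd x j u)].

Lemma is_mixed_derivs_classical (f : s.-tuple R -> R)
    (D : diff_order -> s.-tuple R -> R) :
  (forall x, cube s x -> D [ffun=> ord0] x = f x) ->
  (forall h, (leb R s).-integrable (cube s) (EFin \o D h)) ->
  (forall (h : diff_order) (j : 'I_s) x, cube s x ->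
     {within `[0, 1[, continuous (fun t => D h (upd x j t))}) ->
  (forall (h h' : diff_order) (j : 'I_s),
     h' j = (h j).+1 :> nat -> (forall i, i != j -> h' i = h i) ->
     forall x, cube s x -> forall t : R, 0 < t < 1 ->
       is_derive t 1 (fun u => D h (upd x j u)) (D h' (upd x j t))) ->
  is_mixed_derivs f D.
Proof.
move=> D0 iD cD dD; split=> // h h' j h'j h'i x cx t /andP[t0 t1].
have sub : (`[0, t] : set R) `<=` `[0, 1[.
  by move=> u /=; rewrite !in_itv /= => /andP[-> /le_lt_trans ->].
have c' k := continuous_subspaceW sub (cD k j x cx).
split.
  by apply: continuous_compact_integrable; [exact: segment_compact|exact: c'].
move: t0; rewrite le_eqVlt => /predU1P[<-|t0].
  by rewrite set_itv1 Rintegral_set1 addr0.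
rewrite /Rintegral (continuous_FTC2 t0 (c' h') (F := fun u => D h (upd x j u))).
- by rewrite -EFinB /= addrC subrK.
- have /(continuous_within_itvP _ t0)[_ c0 ct] := c' h.
  split=> // u; rewrite in_itv /= => /andP[u0 ut].
  have u01 : 0 < u < 1 by rewrite u0 (lt_trans ut).
  by have [] := dD h h' j h'j h'i x cx u u01.
- move=> u; rewrite in_itv /= => /andP[u0 ut].
  rewrite derive1E; apply: derive_val.
  by apply: dD => //; rewrite u0 (lt_trans ut).
Qed.

(* The point (x_v, y_{-v}) with coordinates listed in increasing order. *)
Definition merge (v : {set 'I_s}) (x : #|v|.-tuple R) (y : #|~: v|.-tuple R) :
  s.-tuple R :=
  [tuple if j \in v then nth 0 x (index j (enum v))
         else nth 0 y (index j (enum (~: v)%SET)) | j < s].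

(* |int f^(h)(x) dx_{-v}| as a function of x_v *)
Definition abs_mean (g : s.-tuple R -> R) (v : {set 'I_s})
    (x : #|v|.-tuple R) : \bar R :=
  `| \int[leb R #|~: v|]_(y in cube #|~: v|) (g (merge x y))%:E |%E.

(* h is of the form (tau_{u \ v}, alpha_v, 0) with entries of tau in
   {1, .., alpha}; the sum over tau is a sum over such h. *)
Definition order_of (u v : {set 'I_s}) (h : diff_order) : bool :=
  [forall j, if j \in v then h j == alpha :> nat
             else if j \in u then (0 < h j)%N else h j == 0%N :> nat].

(* The inner norm for u; for q = +oo sums become maxima and integrals
   essential suprema. *)
Definition sob_norm_on (q : \bar R) (D : diff_order -> s.-tuple R -> R)
    (u : {set 'I_s}) : \bar R :=
  match q with
  | r%:E =>
    ((\sum_(v : {set 'I_s} | v \subset u) \sum_(h : diff_order | order_of u v h)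
       \int[leb R #|v|]_(x in cube #|v|) (abs_mean (D h) x `^ r)) `^ r^-1)%E
  | _ =>
    \big[maxe/0%E]_(v : {set 'I_s} | v \subset u)
      \big[maxe/0%E]_(h : diff_order | order_of u v h)
        ess_sup (leb R #|v|) (abs_mean (D h) (v := v) \_ (cube #|v|))
  end.

Definition sob_norm (q : \bar R) (gamma : {set 'I_s} -> R)
    (D : diff_order -> s.-tuple R -> R) : \bar R :=
  \big[maxe/0%E]_(u : {set 'I_s}) ((gamma u)^-1%:E * sob_norm_on q D u)%E.

Definition sob_ball (q : \bar R) (gamma : {set 'I_s} -> R) :
  set (s.-tuple R -> R) :=
  [set f | exists2 D, is_mixed_derivs f D & (sob_norm q gamma D <= 1)%E].

Definition e_wor (q : \bar R) (gamma : {set 'I_s} -> R)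
    (M : (s.-tuple R -> R) -> R) : \bar R :=
  ereal_sup [set (`|M f - integral_cube f|)%:E | f in sob_ball q gamma].

End SobolevSpace.

Section Constants.
Variable R : realType.

Definition Aconst (b alpha : nat) (lambda : R) : R :=
  let B i := b%:R `^ (lambda * i%:R) in
  \sum_(1 <= tau < alpha) \prod_(1 <= i < tau.+1) ((b%:R - 1) / (B i - 1))
  + (B alpha - 1) / (B alpha - b%:R)
    * \prod_(1 <= i < alpha.+1) ((b%:R - 1) / (B i - 1)).

Definition Cconst (b alpha : nat) : R :=
  let B := b%:R in
  let S := 2 * sin (pi / B) in
  (1 + B^-1 + (B * (B + 1))^-1) ^+ (alpha - 2)
  * (3 + 2 / B + (2 * B + 1) / (B - 1))
  * Num.max (2 / S ^+ alpha) (\big[Num.max/0]_(1 <= tau < alpha) (S ^+ tau)^-1).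

Definition error_bound (b m n s alpha : nat) (gamma : {set 'I_s} -> R)
    (eta lambda : R) : R :=
  (2 / (eta * (b%:R `^ Num.min m%:R (lambda * n%:R) - 1))
   * \sum_(u : {set 'I_s} | u != finset.set0)
       gamma u `^ lambda * Cconst b alpha `^ (lambda * #|u|%:R)
       * Aconst b alpha lambda ^+ #|u|) `^ lambda^-1.

End Constants.

(* Main.v *)
Require Import Defs.
From HB Require Import structures.
From mathcomp Require Import all_boot all_order all_algebra.
From mathcomp Require Import all_classical all_reals all_analysis.
From mathcomp Require Import measurable_realfun ess_sup_inf complex.
From mathcomp Require Import ring lra zify.

Set Implicit Arguments.
Unset Strict Implicit.
Unset Printing Implicit Defensive.

Import Order.TTheory GRing.Theory Num.Theory.
Import numFieldNormedType.Exports.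

Local Open Scope classical_set_scope.
Local Open Scope ring_scope.

(** Why the theorem holds.  For one generating vector w the error of the rule
    is at most a number X(w), the figure of merit, which does not depend on the
    integrand.  The mean of X(w)^lambda over all w is small, so by Markov's
    inequality few w are bad, and the median of r rules can only be bad when at
    least (r+1)/2 of the drawn vectors are.  As badness is a property of the
    vectors alone, one exceptional event serves all integrands at once.

    The bound X(w).  In one variable, repeated integration by parts writes g(x)
    as the mean of g, plus Bernoulli polynomials at x times the means of the
    derivatives of g of order below alpha, plus the integral of the derivative
    of order alpha against a kernel ([sobolev_expansion]).  Coordinate by
    coordinate this expresses f(x) as a sum, over the orders h, of integrals of
    D h against products of kernels ([sobolev_representation]).  The term h = 0
    is the integral of f; hence the error of the rule is the sum over h <> 0 of
    the integrals of D h(y) times the value of the rule on the product of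
    kernels with second arguments y.  That value depends only on the
    coordinates y_j with h_j = alpha, so integrating over the others first, the
    term is at most its maximum times the corresponding absolute mean in the
    Sobolev norm, which is at most gamma_u with u the support of h
    ([le_integral_abs_mean], [le_integral_abs_mean_gamma]).

    The value of the rule on a product of kernels is a finite sum.  All nodes
    lie on the grid of multiples of b^-n, where every function is a linear
    combination of b^n Walsh functions, so no convergence has to be discussed;
    summing over the nodes keeps exactly the frequencies of the dual net
    ([lattice_prod_le]).  The Walsh coefficients on the grid of all the kernels
    of orders 1 to alpha together are at most C_alpha b^-mu(k), where mu(k) is
    the sum of the positions of the alpha leading nonzero digits of k
    ([walsh_coef_le]).  Summing over h gives [single_rule_error].

    The Walsh coefficients are estimated by recursion on the number of digits.
    The grid consists of b scaled copies of the grid with one digit less, whose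
    weights differ by a character value; a zero digit merely rescales the
    kernel sums, and a nonzero digit makes one more moment vanish because the
    values of a nontrivial character sum to zero ([rkersum_block],
    [walsh_boundsP]).

    The mean.  Since lambda < 1, X^lambda is at most the sum of the powers of
    its terms, and the powers of b^-mu(k) sum to at most A_(alpha,lambda)
    ([sum_wgt_powR]).  A frequency vector with a nonzero digit is in the dual
    net for a proportion at most 1 / (b^m - 1) of the generating vectors
    ([count_dual_Gvec]).  The zero vector is always in the dual net; on the
    grid it represents all multiples of b^n and carries the weight b^-n in each
    coordinate of u.  The two contributions make up the factor
    2 / (b^min(m, lambda n) - 1) ([mean_figure_of_merit]). *)

(** * Bounded measurable weights and a weighted Fubini theorem *)

Section BoundedMeasurable.
Context d (T : measurableType d) (R : realType).
Variables (mu : {measure set T -> \bar R}) (D : set T).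
Hypothesis mD : measurable D.
Implicit Types (f g w : T -> R).

(** The multipliers used throughout: closed under sums and products, and
    integrable functions stay integrable when multiplied by them. *)
Definition bdd_meas w :=
  measurable_fun D w /\ exists M, forall x, D x -> `|w x| <= M.

Lemma bdd_meas_cst c : bdd_meas (fun=> c).
Proof. by split; [exact: measurable_cst | exists `|c|]. Qed.

Lemma bdd_measD f g : bdd_meas f -> bdd_meas g -> bdd_meas (fun x => f x + g x).
Proof.
move=> [mf [A fA]] [mg [B gB]]; split; first exact: measurable_funD.
exists (A + B) => x Dx; apply: le_trans (ler_normD _ _) _.
by rewrite lerD ?fA ?gB.
Qed.

Lemma bdd_measM f g : bdd_meas f -> bdd_meas g -> bdd_meas (fun x => f x * g x).
Proof.
move=> [mf [A fA]] [mg [B gB]]; split; first exact: measurable_funM.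
by exists (A * B) => x Dx; rewrite normrM ler_pM ?fA ?gB.
Qed.

Lemma bdd_measB f g : bdd_meas f -> bdd_meas g -> bdd_meas (fun x => f x - g x).
Proof.
move=> bf bg; have := bdd_measD bf (bdd_measM (bdd_meas_cst (-1)) bg).
by under eq_fun do rewrite mulN1r.
Qed.

Lemma bdd_meas_sum (I : Type) (r : seq I) (P : pred I) (F : I -> T -> R) :
  (forall i, P i -> bdd_meas (F i)) ->
  bdd_meas (fun x => \sum_(i <- r | P i) F i x).
Proof.
move=> bF; elim: r => [|i r IH].
  by under eq_fun do rewrite big_nil; exact: bdd_meas_cst.
under eq_fun do rewrite big_cons.
case: (boolP (P i)) => Pi; last by [].
by apply: bdd_measD => //; exact: bF.
Qed.

Lemma bdd_meas_prod (I : Type) (r : seq I) (P : pred I) (F : I -> T -> R) :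
  (forall i, P i -> bdd_meas (F i)) ->
  bdd_meas (fun x => \prod_(i <- r | P i) F i x).
Proof.
move=> bF; elim: r => [|i r IH].
  by under eq_fun do rewrite big_nil; exact: bdd_meas_cst.
under eq_fun do rewrite big_cons.
case: (boolP (P i)) => Pi; last by [].
by apply: bdd_measM => //; exact: bF.
Qed.

Lemma bdd_meas_integrableM w g : bdd_meas w ->
  mu.-integrable D (EFin \o g) -> mu.-integrable D (EFin \o (fun x => w x * g x)).
Proof.
move=> [mw [M wM]] ig; apply: (@integrableMr _ _ _ mu D mD w (EFin \o g)) => //.
exists M; split; first by rewrite num_real.
by move=> t Mt x Dx; exact: le_trans (wM x Dx) (ltW Mt).
Qed.

Hypothesis fD : (mu D < +oo)%E.

Lemma bdd_meas_integrable w : bdd_meas w -> mu.-integrable D (EFin \o w).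
Proof.
move=> [mw [M wM]]; apply: measurable_bounded_integrable => //.
exists M; split; first by rewrite num_real.
by move=> t Mt x Dx; exact: le_trans (wM x Dx) (ltW Mt).
Qed.

Lemma le_Rintegral_bound w M : mu.-integrable D (EFin \o w) -> (forall x, D x -> `|w x| <= M) ->
  `|\int[mu]_(x in D) w x| <= M * fine (mu D).
Proof.
move=> iw wM; apply: le_trans (le_normr_Rintegral mD iw) _.
rewrite -(@Rintegral_cst _ _ _ mu D mD M); apply: le_Rintegral => //.
- exact: integrable_norm.
- by apply: bdd_meas_integrable; exact: bdd_meas_cst.
Qed.

End BoundedMeasurable.

Lemma Rintegral_sum d (T : measurableType d) (R : realType)
    (mu : {measure set T -> \bar R}) (D : set T) (I : Type) (r : seq I)
    (F : I -> T -> R) : measurable D ->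
  (forall i, mu.-integrable D (EFin \o F i)) ->
  \int[mu]_(x in D) (\sum_(i <- r) F i x) = \sum_(i <- r) \int[mu]_(x in D) F i x.
Proof.
move=> mD iF; elim: r => [|i r IH].
  rewrite big_nil -[RHS](@Rintegral_set0 _ _ _ mu (fun=> 0)).
  by rewrite [LHS]Rintegral_mkcond [RHS]Rintegral_mkcond; apply: eq_Rintegral => x _;
    rewrite /patch big_nil; do 2 case: ifP.
rewrite big_cons -IH -RintegralD//.
  by apply: eq_Rintegral => x _; rewrite big_cons.
have -> : EFin \o (fun x => \sum_(i <- r) F i x) =
    fun x => (\sum_(i <- r) (EFin \o F i) x)%E by apply/funext => x /=; rewrite sumEFin.
exact: integrable_sum.
Qed.

Lemma integrable_sumR d (T : measurableType d) (R : realType)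
    (mu : {measure set T -> \bar R}) (D : set T) (I : Type) (r : seq I)
    (F : I -> T -> R) : measurable D ->
  (forall i, mu.-integrable D (EFin \o F i)) ->
  mu.-integrable D (EFin \o (fun x => \sum_(i <- r) F i x)).
Proof.
move=> mD iF.
have -> : EFin \o (fun x => \sum_(i <- r) F i x) =
    fun x => (\sum_(i <- r) (EFin \o F i) x)%E by apply/funext => x /=; rewrite sumEFin.
exact: integrable_sum.
Qed.

Section WeightedFubini.
Context d1 d2 (T1 : measurableType d1) (T2 : measurableType d2) (R : realType).
Variables (m1 : {sigma_finite_measure set T1 -> \bar R})
  (m2 : {sigma_finite_measure set T2 -> \bar R}) (D1 : set T1) (D2 : set T2).
Hypotheses (mD1 : measurable D1) (mD2 : measurable D2).
Variables (a : T1 -> R) (b : T2 -> R) (k : T1 -> T2 -> R).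
Hypotheses (ia : m1.-integrable D1 (EFin \o a)) (ib : m2.-integrable D2 (EFin \o b)).
Hypotheses (mk : measurable_fun setT (fun z : T1 * T2 => k z.1 z.2)) (M : R)
  (kM : forall x y, D1 x -> D2 y -> `|k x y| <= M).

Let a' := a \_ D1.
Let b' := b \_ D2.
Let F (z : T1 * T2) := a' z.1 * k z.1 z.2 * b' z.2.

Let ma' : measurable_fun setT a'.
Proof. by apply/(measurable_restrictT _ _).1 => //; apply/measurable_EFinP; exact: measurable_int ia. Qed.
Let mb' : measurable_fun setT b'.
Proof. by apply/(measurable_restrictT _ _).1 => //; apply/measurable_EFinP; exact: measurable_int ib. Qed.

Let mF : measurable_fun setT F.
Proof.
apply: measurable_funM; last exact: measurableT_comp.
by apply: measurable_funM => //; exact: measurableT_comp.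
Qed.

Let iF : (m1 \x m2)%E.-integrable setT (EFin \o F).
Proof.
have mFE : measurable_fun setT (EFin \o F) by exact/measurable_EFinP.
apply/(integrable12ltyP m1 m2 mFE).
have ia' : m1.-integrable setT (EFin \o a').
  by rewrite /a' -restrict_EFin; apply/(integrable_mkcond _ mD1).1.
have ib' : m2.-integrable setT (EFin \o b').
  by rewrite /b' -restrict_EFin; apply/(integrable_mkcond _ mD2).1.
pose B := (\int[m2]_y `|(b' y)%:E|)%E.
have Bfin : B \is a fin_num.
  rewrite ge0_fin_numE; first by case/integrableP: ib'.
  exact: integral_ge0.
have M0 : 0 <= `|M| by [].
apply: (@le_lt_trans _ _ (\int[m1]_x (`|(a' x)%:E| * (`|M|%:E * B)))%E).
  apply: ge0_le_integral => //.
  - by move=> x _; apply: integral_ge0.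
  - apply: (measurable_fun_fubini_tonelli_F (fun z => `|(EFin \o F) z|)%E) => //.
    by apply: measurableT_comp => //; exact/measurable_EFinP.
  - apply: emeasurable_funM => //; apply: measurableT_comp => //.
    exact/measurable_EFinP.
  - move=> x _ /=.
    have -> : (`|(a' x)%:E| * (`|M|%:E * B) = \int[m2]_y (`|a' x * M|%:E * `|(b' y)%:E|))%E.
      have mb : measurable_fun setT (fun y => `|(b' y)%:E|%E).
        by apply: measurableT_comp => //; exact/measurable_EFinP.
      by rewrite ge0_integralZl// muleA -/B -EFinM normrM.
    apply: ge0_le_integral => //.
    + apply/measurable_EFinP; apply: measurableT_comp => //.
      exact: measurableT_comp mF (pair1_measurable x).
    + by apply: emeasurable_funM => //; apply: measurableT_comp => //; exact/measurable_EFinP.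
    + move=> y _; rewrite -EFinM lee_fin /F /= !normrM /a' /b' /patch.
      case: ifPn => [/set_mem xD1|]; last by rewrite !normr0 !mul0r.
      case: ifPn => [/set_mem yD2|]; last by rewrite normr0 !mulr0.
      rewrite ler_wpM2r// ler_wpM2l//.
      exact: le_trans (kM _ _) (ler_norm _).
have cfin : (`|M|%:E * B)%E \is a fin_num by rewrite fin_numM.
rewrite -(fineK cfin) ge0_integralZr//; first last.
- by rewrite lee_fin fine_ge0// mule_ge0// ?lee_fin//; exact: integral_ge0.
- by apply: measurableT_comp => //; exact/measurable_EFinP.
rewrite muleC lte_mul_pinfty//; last by case/integrableP: ia'.
by rewrite lee_fin fine_ge0// mule_ge0// ?lee_fin//; exact: integral_ge0.
Qed.

Let slice x : D1 x ->
  (\int[m2]_y (F (x, y))%:E)%E = (a x * \int[m2]_(y in D2) (k x y * b y))%:E.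
Proof.
move=> xD1; transitivity ((a x)%:E * \int[m2]_(y in D2) (k x y * b y)%:E)%E; last first.
  rewrite EFinM fineK//; apply: integrable_fin_num => //.
  apply: bdd_meas_integrableM => //; split.
    exact: measurable_funTS (measurableT_comp mk (pair1_measurable _)).
  by exists M => y; exact: kM.
rewrite -integralZl//; last first.
  apply: bdd_meas_integrableM => //; split.
    exact: measurable_funTS (measurableT_comp mk (pair1_measurable _)).
  by exists M => y; exact: kM.
rewrite [RHS]integral_mkcond; apply: eq_integral => y _.
rewrite /F /= /a' /b' /patch mem_set//; case: ifPn => yD2; last by rewrite mulr0.
by rewrite -EFinM mulrA.
Qed.

Lemma integrable_weighted_slice :
  m1.-integrable D1 (EFin \o (fun x => a x * \int[m2]_(y in D2) (k x y * b y))).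
Proof.
have H := integrableS measurableT mD1 (@subsetT _ _) (integrable_fubini_F iF).
by apply: eq_integrable H => // x /set_mem Dx; exact: slice.
Qed.

(** Only [a] and [b] are integrable; the kernel linking them is merely bounded,
    which suffices for absolute convergence of the double integral. *)
Lemma weighted_Fubini :
  \int[m1]_(x in D1) (a x * \int[m2]_(y in D2) (k x y * b y)) =
  \int[m2]_(y in D2) ((\int[m1]_(x in D1) (a x * k x y)) * b y).
Proof.
have H := Fubini iF; rewrite /Rintegral.
transitivity (fine (\int[m1]_x \int[m2]_y (F (x, y))%:E)%E).
  congr fine; rewrite [LHS]integral_mkcond; apply: eq_integral => x _.
  rewrite /patch; case: ifPn => [/set_mem xD1|xD1]; first by rewrite slice.
  rewrite -[LHS](integral0 m2 setT); apply: eq_integral => y _.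
  by rewrite /F /= /a' /patch (negbTE xD1) !mul0r.
rewrite H; congr fine; rewrite [RHS]integral_mkcond; apply: eq_integral => y _.
rewrite /patch; case: ifPn => [yD2|yD2]; last first.
  rewrite -[RHS](integral0 m1 setT); apply: eq_integral => x _.
  by rewrite /F /= /b' /patch (negbTE yD2) !mulr0.
have ik : m1.-integrable D1 (EFin \o (fun x => a x * k x y)).
  under eq_fun do rewrite mulrC.
  apply: bdd_meas_integrableM => //; split.
    exact: measurable_funTS (measurableT_comp mk (pair2_measurable _)).
  by exists M => x Dx; apply: kM; rewrite // -inE.
transitivity ((b y)%:E * \int[m1]_(x in D1) (a x * k x y)%:E)%E; last first.
  by rewrite EFinM fineK 1?muleC//; apply: integrable_fin_num.
rewrite -integralZl//.
rewrite [RHS]integral_mkcond; apply: eq_integral => x _.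
rewrite /F /= /a' /b' /patch yD2; case: ifPn => xD1; last by rewrite !mul0r.
by rewrite -EFinM mulrC.
Qed.

End WeightedFubini.

(** * One-dimensional kernels: Taylor expansion with averaged coefficients *)

Section Kernels.
Variable R : realType.
Local Notation mu := (@lebesgue_measure R).
Implicit Types (w g : R -> R) (x y z : R).

Definition unit_itv : set R := `[0, 1[%classic.
Local Notation U := unit_itv.

Definition mean w : R := \int[mu]_(x in U) w x.
Definition prim w y : R := \int[mu]_(x in `[0, y]) w x.
(** The transpose of the operator which maps a derivative g' to g - mean g;
    see [ftc_parts]. *)
Definition tprim w y : R := y * mean w - prim w y.

(** [ker 0] represents g x - mean g as an integral of g' against it, and each
    further order is one integration by parts. *)
Fixpoint ker (t : nat) x : R -> R :=
  if t is t'.+1 then tprim (ker t' x) else fun y => y - (x < y)%R%:R.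

(** The Bernoulli polynomial B_t divided by t!. *)
Definition bern (t : nat) x : R := if t is t'.+1 then mean (ker t' x) else 1.

Lemma unit_itvE x : U x = (0 <= x < 1).
Proof. by rewrite /U /= in_itv. Qed.

Lemma measurable_unit_itv : measurable (U : set (measurableTypeR R)). Proof. exact: measurable_itv. Qed.

Lemma mu_unit_itv : mu U = 1%E.
Proof. by rewrite /U lebesgue_measure_itv /= lte_fin ltr01 sube0. Qed.

Lemma mu_unit_itv_fin : (mu U < +oo)%E. Proof. by rewrite mu_unit_itv ltry. Qed.
Hint Resolve measurable_unit_itv mu_unit_itv_fin : core.

Local Notation int g := (mu.-integrable U (EFin \o g)).

Lemma bdd_int w : bdd_meas U w -> int w.
Proof. move=> bw. apply: (@bdd_meas_integrable _ _ _ mu U measurable_unit_itv mu_unit_itv_fin w). exact: bw. Qed.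

Lemma le_mean w M : int w -> (forall x, U x -> `|w x| <= M) -> `|mean w| <= M.
Proof.
move=> iw wM; have := @le_Rintegral_bound _ _ _ mu U measurable_unit_itv mu_unit_itv_fin w M iw wM.
by rewrite /= mu_unit_itv mulr1.
Qed.

Lemma eq_mean w g : (forall x, U x -> w x = g x) -> mean w = mean g.
Proof. by move=> wg; apply: eq_Rintegral => x /set_mem; exact: wg. Qed.

Lemma mean_cst c : mean (fun=> c) = c.
Proof. by rewrite /mean Rintegral_cst//= mu_unit_itv mulr1. Qed.

Lemma intD w g : int w -> int g -> int (fun x => w x + g x).
Proof.
by move=> iw ig; have := integrableD measurable_unit_itv iw ig; apply: eq_integrable.
Qed.

Lemma meanD w g : int w -> int g -> mean (fun x => w x + g x) = mean w + mean g.
Proof. exact: RintegralD. Qed.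

Lemma meanB w g : int w -> int g -> mean (fun x => w x - g x) = mean w - mean g.
Proof. exact: RintegralB. Qed.

Lemma meanZ c w : int w -> mean (fun x => c * w x) = c * mean w.
Proof. exact: RintegralZl. Qed.

Lemma subitv_unit y : U y -> (`[0, y] : set R) `<=` U.
Proof.
rewrite unit_itvE => /andP[_ y1] x; rewrite /= in_itv /= => /andP[x0 xy].
by rewrite unit_itvE x0 (le_lt_trans xy).
Qed.

Lemma subitvo_unit y : U y -> (`[0, y[ : set R) `<=` U.
Proof.
rewrite unit_itvE => /andP[_ y1] x; rewrite /= in_itv /= => /andP[x0 xy].
by rewrite unit_itvE x0 (lt_trans xy).
Qed.

Lemma int_subitv w y : int w -> U y -> mu.-integrable `[0, y] (EFin \o w).
Proof.
move=> iw Uy; apply: integrableS iw => //; last exact: subitv_unit.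
Qed.

Lemma prim_indic w y : U y -> prim w y = mean (fun x => (x <= y)%R%:R * w x).
Proof.
move=> Uy; rewrite /prim /mean Rintegral_mkcond [RHS]Rintegral_mkcond.
apply: eq_Rintegral => x _; rewrite /patch.
case: ifPn => [/set_mem xy|xy]; case: ifPn => [xU|xU] //.
- by move: xy; rewrite /= in_itv /= => /andP[_ ->]; rewrite mul1r.
- by move: xU; rewrite mem_set//; exact: subitv_unit xy.
- move: xU xy => /set_mem; rewrite unit_itvE => /andP[x0 x1].
  case: leP => xy; rewrite ?mul0r// => /negP[].
  by rewrite mem_set//= in_itv /= x0.
Qed.

Lemma measurable_indic_le : measurable_fun setT (fun z : R * R => ((z.2 <= z.1)%R%:R : R)).
Proof.
apply: (@measurableT_comp _ _ _ _ _ _ (fun b : bool => b%:R : R)) => //.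
by apply: measurable_fun_ler.
Qed.

Lemma measurable_indic_lt : measurable_fun setT (fun z : R * R => ((z.1 < z.2)%R%:R : R)).
Proof.
apply: (@measurableT_comp _ _ _ _ _ _ (fun b : bool => b%:R : R)) => //.
by apply: measurable_fun_ltr.
Qed.

Lemma norm_bool (b : bool) : `|b%:R : R| <= 1.
Proof. by case: b; rewrite ?normr1 ?normr0. Qed.

Lemma int_prim w : int w -> int (prim w).
Proof.
move=> iw.
have := @integrable_weighted_slice _ _ _ _ _ mu mu U U measurable_unit_itv measurable_unit_itv
  (fun=> 1) w (fun y x => (x <= y)%R%:R) (bdd_int (bdd_meas_cst _ _)) iw
  measurable_indic_le 1 (fun x y _ _ => norm_bool _).
apply: eq_integrable => // y /set_mem Uy /=.
by rewrite mul1r prim_indic.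
Qed.

Lemma le_prim w M y : int w -> (forall x, U x -> `|w x| <= M) -> U y -> `|prim w y| <= M * y.
Proof.
move=> iw wM Uy; have := Uy; rewrite unit_itvE => /andP[y0 y1].
have mU : (mu `[0%R, y] = y%:E)%E.
  rewrite lebesgue_measure_itv /= lte_fin; case: ltgtP y0 => // [_ _|<- _].
    by rewrite sube0.
  by [].
have := @le_Rintegral_bound _ _ _ mu `[0, y] _ _ w M.
rewrite /= mU ltry => /(_ (measurable_itv _) isT (int_subitv iw Uy)); apply.
by move=> x xy; apply/wM/(subitv_unit Uy).
Qed.

Lemma bdd_tprim w : bdd_meas U w -> bdd_meas U (tprim w).
Proof.
move=> bw; have iw := bdd_int bw; case: (bw) => mw [M wM].
apply: bdd_measB; last first.
  split; first by have /measurable_int/measurable_EFinP := int_prim iw.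
  exists M => y Uy; have := Uy; rewrite unit_itvE => /andP[y0 y1].
  apply: le_trans (le_prim iw wM Uy) _.
  rewrite ler_piMr// ?(ltW y1)//; apply: le_trans (wM y Uy); exact: normr_ge0.
apply: bdd_measM; last exact: bdd_meas_cst.
split; first exact: measurable_id.
by exists 1 => y; rewrite unit_itvE => /andP[y0 /ltW y1]; rewrite ger0_norm.
Qed.

Lemma bdd_ker t x : bdd_meas U (ker t x).
Proof.
elim: t => [|t IH] /=; last exact: bdd_tprim.
apply: bdd_measB.
  split; first exact: measurable_id.
  by exists 1 => y; rewrite unit_itvE => /andP[y0 /ltW y1]; rewrite ger0_norm.
split; last by exists 1 => y _; exact: norm_bool.
exact: measurable_funTS (measurableT_comp measurable_indic_lt (pair1_measurable x)).
Qed.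

Lemma int_ker t x : int (ker t x).
Proof. exact/bdd_int/bdd_ker. Qed.

Lemma primB w g y : int w -> int g -> U y ->
  prim (fun x => w x - g x) y = prim w y - prim g y.
Proof. by move=> iw ig Uy; apply: RintegralB => //; exact: int_subitv. Qed.

Lemma prim_cst c y : U y -> prim (fun=> c) y = c * y.
Proof.
rewrite unit_itvE => /andP[y0 _].
rewrite /prim Rintegral_cst//= lebesgue_measure_itv /= lte_fin.
by case: ltgtP y0 => // [_ _|<- _]; rewrite ?sube0//= !mulr0.
Qed.

Lemma eq_prim w g y : U y -> (forall x, U x -> w x = g x) -> prim w y = prim g y.
Proof. by move=> Uy wg; apply: eq_Rintegral => x /set_mem xy; apply/wg/(subitv_unit Uy). Qed.

(** A function may thus be centred before [le_tprim] is applied to it. *)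
Lemma tprim_shift w c y : int w -> U y -> tprim (fun x => w x - c) y = tprim w y.
Proof.
move=> iw Uy; have ic : int (fun=> c) by apply/bdd_int/bdd_meas_cst.
rewrite /tprim meanB// primB// mean_cst prim_cst//; ring.
Qed.

Lemma mean_split w y : int w -> U y -> mean w = prim w y + \int[mu]_(x in `]y, 1[) w x.
Proof.
move=> iw Uy; have := Uy; rewrite unit_itvE => /andP[y0 y1].
rewrite -(Rintegral_itvB (b := BLeft 1) (x := y) (f := w) (a := BLeft 0))//; last first.
rewrite -/U -/(mean w) -/(prim w y); ring.
Qed.

(** [tprim w y] equals y times the integral of w over ]y, 1[ minus (1 - y)
    times the integral over [0, y], and 2 y (1 - y) <= 1 / 2. *)
Lemma le_tprim w M y : int w -> (forall x, U x -> `|w x| <= M) -> U y -> `|tprim w y| <= M / 2.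
Proof.
move=> iw wM Uy; have := Uy; rewrite unit_itvE => /andP[y0 y1].
have sub : (`]y, 1[ : set R) `<=` U.
  move=> x; rewrite unit_itvE /= in_itv /= => /andP[yx ->].
  by rewrite (le_trans y0 (ltW yx)).
have mU : mu `]y, 1[ = (1 - y)%:E by rewrite lebesgue_measure_itv /= lte_fin y1.
have H2 : `|\int[mu]_(x in `]y, 1[) w x| <= M * (1 - y).
  have := @le_Rintegral_bound _ _ _ mu `]y, 1[ _ _ w M.
  rewrite /= mU ltry => /(_ (measurable_itv _) isT (@integrableS _ _ _ mu U `]y, 1[ (EFin \o w) measurable_unit_itv (measurable_itv _) sub iw)); apply => //.
  by move=> x xy; apply/wM/sub.
have H1 := le_prim iw wM Uy.
have -> : tprim w y = y * \int[mu]_(x in `]y, 1[) w x - (1 - y) * prim w y.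
  by rewrite /tprim (mean_split iw Uy); ring.
have M0 : 0 <= M by apply: le_trans (wM y Uy).
apply: le_trans (ler_normB _ _) _; rewrite !normrM (ger0_norm y0).
rewrite (@ger0_norm _ (1 - y)) ?subr_ge0 ?(ltW y1)//.
apply: (@le_trans _ _ (y * (M * (1 - y)) + (1 - y) * (M * y))).
  by rewrite lerD// ler_wpM2l// subr_ge0 ltW.
have -> : y * (M * (1 - y)) + (1 - y) * (M * y) = M * (2 * y * (1 - y)) by ring.
rewrite ler_wpM2l//.
have : 0 <= (1 - 2 * y) ^+ 2 by rewrite sqr_ge0.
nra.
Qed.

(** Absolute continuity in integral form, as in the definition of the Sobolev
    space. *)
Definition ftc g g' :=
  forall t, 0 <= t < 1 -> mu.-integrable `[0, t] (EFin \o g') /\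
    g t = g 0 + \int[mu]_(u in `[0, t]) g' u.

Lemma mean_indic z : U z -> mean (fun x => (z <= x)%R%:R) = 1 - z.
Proof.
move=> Uz; have := Uz; rewrite unit_itvE => /andP[z0 z1].
rewrite /mean -[LHS]/(\int[mu]_(x in U) _).
have -> : \int[mu]_(x in U) ((z <= x)%R%:R : R) = \int[mu]_(x in `[z, 1[) 1.
  rewrite [LHS]Rintegral_mkcond [RHS]Rintegral_mkcond; apply: eq_Rintegral => x _.
  rewrite /patch; case: ifPn => [/set_mem|] xU; case: ifPn => [/set_mem|] xz //.
  - by move: xz; rewrite /= in_itv /= => /andP[->].
  - move: xU; rewrite unit_itvE => /andP[x0 x1]; case: leP => zx //; move/negP: xz => [].
    by rewrite mem_set//= in_itv /= zx.
  - move: xz; rewrite /= in_itv /= => /andP[zx x1]; move/negP: xU => [].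
    by rewrite mem_set// unit_itvE x1 (le_trans z0 zx).
rewrite Rintegral_cst//= lebesgue_measure_itv /= lte_fin z1 /= mul1r //.
Qed.

(** The two arguments of [ker 0] play transposed roles: integration over the
    second recovers g - mean g from the derivative of g, integration over the
    first is [tprim]. *)
Lemma mean_ker0 w y : int w -> U y -> mean (fun x => w x * ker 0 x y) = tprim w y.
Proof.
move=> iw Uy; have := Uy; rewrite unit_itvE => /andP[y0 y1].
rewrite /tprim.
have -> : prim w y = mean (fun x => (x < y)%R%:R * w x).
  rewrite /prim /mean -Rintegral_itv_bndo_bndc; last first.
    by apply: integrableS iw => //; exact: subitvo_unit.
  rewrite Rintegral_mkcond [RHS]Rintegral_mkcond.
  apply: eq_Rintegral => x _; rewrite /patch.
  case: ifPn => [/set_mem xy|xy]; case: ifPn => [xU|xU] //.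
  - by move: xy; rewrite /= in_itv /= => /andP[_ ->]; rewrite mul1r.
  - by move: xU; rewrite mem_set//; exact: subitvo_unit xy.
  - move: xU xy => /set_mem; rewrite unit_itvE => /andP[x0 x1].
    case: ltP => xy; rewrite ?mul0r// => /negP[].
    by rewrite mem_set//= in_itv /= x0.
rewrite -meanZ// -meanB//; last 2 first.
- by apply: bdd_meas_integrableM => //; exact: bdd_meas_cst.
- apply: bdd_meas_integrableM => //; split; last by exists 1 => x _; exact: norm_bool.
  exact: measurable_funTS (measurableT_comp measurable_indic_lt (pair2_measurable y)).
by apply: eq_mean => x _ /=; ring.
Qed.

(** Average g x - g t over t and exchange the two integrals. *)
Lemma ftc_point g g' x : int g' -> ftc g g' -> U x ->
  int g /\ g x = mean g + mean (fun y => ker 0 x y * g' y).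
Proof.
move=> ig' gg' Ux.
have ig0 : int (fun t => g 0 + prim g' t).
  by apply: intD; [exact/bdd_int/bdd_meas_cst | exact: int_prim].
have ig : int g.
  apply: eq_integrable ig0 => // t /set_mem; rewrite unit_itvE => t01 /=.
  by have [_ ->] := gg' t t01.
split=> //.
have Fub := @weighted_Fubini _ _ _ _ _ mu mu U U measurable_unit_itv measurable_unit_itv
  (fun=> 1) g' (fun y x => (x <= y)%R%:R) (bdd_int (bdd_meas_cst _ _)) ig'
  measurable_indic_le 1 (fun x y _ _ => norm_bool _).
have mg : mean g = g 0 + mean (fun z => (1 - z) * g' z).
  have -> : mean g = mean (fun t => g 0 + prim g' t).
    by apply: eq_mean => t; rewrite unit_itvE => t01; have [_ ->] := gg' t t01.
  rewrite meanD//; [|exact/bdd_int/bdd_meas_cst|exact: int_prim].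
  rewrite mean_cst; congr (_ + _).
  transitivity (\int[mu]_(x0 in U) (1 * \int[mu]_(y in U) ((y <= x0)%R%:R * g' y))).
    by apply: eq_mean => t Ut; rewrite mul1r prim_indic.
  rewrite Fub; apply: eq_mean => z Uz; congr (_ * _).
  by rewrite -mean_indic//; apply: eq_mean => t _; rewrite mul1r.
have := Ux; rewrite unit_itvE => x01; have [_ ->] := gg' x x01.
rewrite mg -addrA; congr (_ + _).
rewrite -/(prim g' x) prim_indic// -meanD//; last 2 first.
- apply: bdd_meas_integrableM => //; apply: bdd_measB; first exact: bdd_meas_cst.
  split; first exact: measurable_id.
  by exists 1 => y; rewrite unit_itvE => /andP[y0 /ltW y1]; rewrite ger0_norm.
- by apply: bdd_meas_integrableM => //; exact: (bdd_ker 0 x).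
apply: eq_mean => z _ /=.
by rewrite ltNge; case: (z <= x) => /=; ring.
Qed.

(** Insert [ftc_point] for [g x] and exchange the integrals. *)
Lemma ftc_parts w g g' : bdd_meas U w -> int g' -> ftc g g' ->
  mean (fun x => w x * g x) = mean w * mean g + mean (fun y => tprim w y * g' y).
Proof.
move=> bw ig' gg'; have iw := bdd_int bw.
have U0 : U 0 by rewrite unit_itvE lexx ltr01.
have [ig _] := ftc_point ig' gg' U0.
have mk : measurable_fun setT (fun z : R * R => ker 0 z.1 z.2).
  by apply: measurable_funB; [exact: measurable_snd|exact: measurable_indic_lt].
have kM x y : U x -> U y -> `|ker 0 x y| <= 2.
  rewrite !unit_itvE => _ /andP[y0 y1] /=.
  apply: le_trans (ler_normB _ _) _; have := norm_bool (x < y).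
  by rewrite (ger0_norm y0); move: (`|_|) => c; lra.
have Fub := @weighted_Fubini _ _ _ _ _ mu mu U U measurable_unit_itv measurable_unit_itv
  w g' (ker 0) iw ig' mk 2 kM.
have isl := @integrable_weighted_slice _ _ _ _ _ mu mu U U measurable_unit_itv measurable_unit_itv
  w g' (ker 0) iw ig' mk 2 kM.
transitivity (mean (fun x => mean g * w x + w x * mean (fun y => ker 0 x y * g' y))).
  apply: eq_mean => x Ux; have [_ ->] := ftc_point ig' gg' Ux; ring.
rewrite meanD//; last by apply: bdd_meas_integrableM => //; exact: bdd_meas_cst.
rewrite meanZ// mulrC; congr (_ + _); rewrite /mean Fub.
by apply: eq_mean => y Uy; congr (_ * _); exact: mean_ker0.
Qed.

(** Integrating the remainder by parts splits off the mean of the next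
    derivative and raises the order of the kernel by one. *)
Lemma sobolev_expansion n (g : nat -> R -> R) x : U x ->
  (forall a, (a <= n.+1)%N -> int (g a)) ->
  (forall a, (a <= n)%N -> ftc (g a) (g a.+1)) ->
  g 0%N x = \sum_(a < n.+1) bern a x * mean (g a) + mean (fun y => ker n x y * g n.+1 y).
Proof.
move=> Ux; elim: n => [|n IH] ig fg.
  rewrite big_ord_recl big_ord0 addr0 mul1r.
  by have [_ ->] := ftc_point (ig 1%N isT) (fg 0%N isT) Ux.
rewrite IH; last 2 first.
- by move=> a an; apply: ig; exact: leqW.
- by move=> a an; apply: fg; exact: leqW.
rewrite [in RHS]big_ord_recr /= -addrA; congr (_ + _).
by rewrite (ftc_parts (bdd_ker n x) (ig _ (leqnn _)) (fg _ (leqnn _))).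
Qed.

End Kernels.

(** * Slices of the unit cube *)

Section CubeSlices.
Variable R : realType.
Local Notation U := (@unit_itv R).
Local Notation mu := (@lebesgue_measure R).
Local Notation cubes s := (@cube R s).

Lemma cube_cons s t (y : s.-tuple R) : cubes s.+1 (tcons (t, y)) <-> U t /\ cubes s y.
Proof.
split=> [h|[Ut hy] i].
  split; first by have := h ord0; rewrite unit_itvE /tnth.
  by move=> i; have := h (lift ord0 i); rewrite tnthS.
have [j ->|->] := unliftP ord0 i; first by rewrite tnthS; exact: hy.
by move: Ut; rewrite unit_itvE.
Qed.

Lemma measurable_cube s : measurable (cubes s).
Proof.
have -> : cubes s = \bigcap_(i in [set: 'I_s]) ((@tnth s R)^~ i @^-1` U).
  apply/seteqP; split=> x /= h i => [_|]; first by rewrite /= unit_itvE h.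
  by have := h i I; rewrite /= unit_itvE.
apply: fin_bigcap_measurable => // i _.
rewrite -[X in measurable X]setTI; apply: measurable_tnth => //.
exact: measurable_unit_itv.
Qed.

Lemma leb_cube s : leb R s (cubes s) = 1%E.
Proof.
have -> : cubes s = [set x | forall i, (fun=> U) i (tnth x i)].
  by apply/seteqP; split=> x h i; have := h i; rewrite unit_itvE.
have := @leb_box R s (fun=> U) (fun=> @measurable_unit_itv R).
by rewrite big1// => i _; exact: mu_unit_itv.
Qed.

Lemma leb_cube_fin s : (leb R s (cubes s) < +oo)%E.
Proof. by rewrite leb_cube ltry. Qed.

Hint Resolve measurable_cube leb_cube_fin measurable_unit_itv : core.

Section Cons.
Variables (s : nat) (f : s.+1.-tuple R -> R).
Hypothesis intf : (leb R s.+1).-integrable (cubes s.+1) (EFin \o f).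

Let F (z : R * s.-tuple R) : R := (f \_ (cubes s.+1)) (tcons z).

Let FE t y : cubes s y -> F (t, y) = ((fun t => f (tcons (t, y))) \_ U) t.
Proof.
move=> cy; rewrite /F /patch; case: ifPn => [/set_mem /cube_cons[Ut _]|h].
  by rewrite mem_set.
by case: ifPn => // /set_mem Ut; move/negP: h => []; rewrite mem_set//; apply/cube_cons.
Qed.

Let FE0 t y : ~ cubes s y -> F (t, y) = 0.
Proof.
by move=> cy; rewrite /F /patch; case: ifPn => // /set_mem /cube_cons[_].
Qed.

Let mfC : measurable_fun setT (f \_ (cubes s.+1)).
Proof.
apply/(measurable_restrictT _ _).1; first exact: measurable_cube.
by apply/measurable_EFinP; exact: measurable_int intf.
Qed.

Let mF : measurable_fun setT F.
Proof. by apply: (measurableT_comp mfC); exact: measurable_tcons. Qed.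

Let iF : (mu \x leb R s)%E.-integrable setT (EFin \o F).
Proof.
apply/integrableP; split; first exact/measurable_EFinP.
have /integrable_mkcond := intf => /(_ (@measurable_cube _)) /integrableP[_].
apply: le_lt_trans.
rewrite [leRHS](_ : _ = \int[pushforward (mu \x leb R s)%E (@tcons R s)]_y `|(f \_ (cubes s.+1)) y|%:E)%E; last first.
  by apply: eq_integral => y _; rewrite restrict_EFin.
rewrite ge0_integral_pushforward ?preimage_setT//; first exact: measurable_tcons.
by apply/measurable_EFinP; exact: measurableT_comp.
Qed.

Let iFy y : cubes s y -> mu.-integrable setT (fun t => (F (t, y))%:E) ->
  mu.-integrable U (EFin \o (fun t => f (tcons (t, y)))).
Proof.
move=> cy h; apply/integrable_mkcond => //.
apply: eq_integrable h => // t _ /=; rewrite FE// restrict_EFin//.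
Qed.

(** Fubini's theorem, transported along [tcons]. *)
Lemma leb_cons_ae : {ae leb R s, forall y, cubes s y ->
  mu.-integrable U (EFin \o (fun t => f (tcons (t, y))))}.
Proof.
apply: filterS (ae_integrable2 iF) => y h cy; exact: iFy.
Qed.

Let G y : \bar R := (\int[mu]_t (F (t, y))%:E)%E.

Let GE y : cubes s y -> mean (fun t => f (tcons (t, y))) = fine (G y).
Proof.
move=> cy; rewrite /G /mean /Rintegral; congr fine.
rewrite [LHS]integral_mkcond; apply: eq_integral => t _.
by rewrite FE// restrict_EFin.
Qed.

Let G0 y : ~ cubes s y -> G y = 0%E.
Proof.
move=> cy; rewrite /G -[RHS](integral0 mu setT); apply: eq_integral => t _.
by rewrite FE0.
Qed.

Let iG : (leb R s).-integrable setT G.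
Proof.
have mFE : measurable_fun setT (EFin \o F) by exact/measurable_EFinP.
apply/integrableP; split; first exact: (measurable_fubini_G iF).
apply: le_lt_trans ((integrable21ltyP mu (leb R s) mFE).1 iF).
apply: ge0_le_integral => //.
- by apply: measurableT_comp => //; exact: (measurable_fubini_G iF).
- have := @measurable_fun_fubini_tonelli_G _ _ _ _ R mu (fun z => `|(EFin \o F) z|)%E.
  by apply => //; exact: measurableT_comp.
- move=> y _; apply: le_abse_integral => //.
  exact: (measurableT_comp mFE (pair2_measurable y)).
Qed.

Let iGf : (leb R s).-integrable (cubes s) (EFin \o (fun y => fine (G y))).
Proof.
apply: (@le_integrable _ _ _ (leb R s) (cubes s) (@measurable_cube s) _ G).
- apply/measurable_EFinP; apply: measurable_funTS; apply: measurableT_comp => //.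
  exact: measurable_int iG.
- by move=> y _ /=; case: (G y) => [r||] /=; rewrite ?normr0 ?leey.
- exact: integrableS (@measurable_cube s) _ iG.
Qed.

Lemma leb_cons_integrable :
  (leb R s).-integrable (cubes s) (EFin \o (fun y => mean (fun t => f (tcons (t, y))))).
Proof.
apply: (@eq_integrable _ _ _ (leb R s) (cubes s) (@measurable_cube s) _ _ _ iGf).
by move=> y /set_mem cy /=; rewrite GE.
Qed.

Lemma leb_cons_integral : \int[leb R s.+1]_(x in cubes s.+1) f x =
  \int[leb R s]_(y in cubes s) mean (fun t => f (tcons (t, y))).
Proof.
rewrite /Rintegral; congr fine.
transitivity (\int[leb R s]_y G y)%E.
  rewrite (integral21_prod_meas1 iF) [LHS]integral_mkcond.
  transitivity (\int[leb R s.+1]_y ((f \_ (cubes s.+1)) y)%:E)%E.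
    by apply: eq_integral => y _; rewrite restrict_EFin.
  have mfCE : measurable_fun setT (EFin \o (f \_ (cubes s.+1))) by exact/measurable_EFinP.
  rewrite [LHS](_ : _ = \int[pushforward (mu \x leb R s)%E (@tcons R s)]_y ((f \_ (cubes s.+1)) y)%:E)%E//.
  by rewrite integral_pushforward//; exact: (@measurable_tcons R s).
have -> : (\int[leb R s]_(y in cubes s) (mean (fun t => f (tcons (t, y))))%:E =
    \int[leb R s]_(y in cubes s) (fine (G y))%:E)%E.
  by apply: eq_integral => y /set_mem cy; rewrite GE.
transitivity (\int[leb R s]_(y in cubes s) G y)%E.
  rewrite [RHS]integral_mkcond; apply: eq_integral => y _; rewrite /patch.
  by case: ifPn => // /negP h; rewrite G0// => cy; apply: h; rewrite mem_set.
apply: ae_eq_integral.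
- exact: measurable_cube.
- exact: measurable_funTS (measurable_int _ iG).
- exact: measurable_int iGf.
have := integrable_ae measurableT iG; apply: filterS => y /(_ I) h cy.
by rewrite fineK.
Qed.

End Cons.

Section Slice.
Variables (s : nat) (f f' : s.+1.-tuple R -> R).
Hypotheses (intf : (leb R s.+1).-integrable (cubes s.+1) (EFin \o f))
  (intf' : (leb R s.+1).-integrable (cubes s.+1) (EFin \o f')).
Hypothesis ff' : forall y, cubes s y -> ftc (fun t => f (tcons (t, y))) (fun t => f' (tcons (t, y))).

Lemma measurable_tcons_l (t : R) : measurable_fun setT (fun y : s.-tuple R => tcons (t, y)).
Proof. exact: (measurableT_comp (@measurable_tcons R s) (pair1_measurable t)). Qed.

(** The kernel in [ftc_point] is bounded by 1. *)
Lemma ftc_le (g g' : R -> R) x : mu.-integrable U (EFin \o g') -> ftc g g' -> U x ->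
  `|g x| <= mean (fun t => `|g t|) + mean (fun t => `|g' t|).
Proof.
move=> ig' gg' Ux; have [ig ->] := ftc_point ig' gg' Ux.
have ik : mu.-integrable U (EFin \o (fun y => ker 0 x y * g' y)).
  by apply: bdd_meas_integrableM => //; exact: bdd_ker.
apply: le_trans (ler_normD _ _) _; rewrite lerD//; first exact: le_normr_Rintegral.
apply: le_trans (le_normr_Rintegral _ ik) _ => //.
apply: le_Rintegral => // [||y]; [exact: integrable_norm|exact: integrable_norm|].
rewrite unit_itvE => /andP[y0 y1]; rewrite normrM ler_piMl//=.
rewrite ler_norml; case: (x < y) => /=; lra.
Qed.

(** An integrable function need not have integrable slices, except on almost
    all of them.  Here every slice is dominated through [ftc_le] by integrals
    over the first variable, which are integrable in the others. *)
Lemma slice_integrable t : U t ->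
  (leb R s).-integrable (cubes s) (EFin \o (fun y => f (tcons (t, y)))).
Proof.
move=> Ut.
have i1 := leb_cons_integrable (integrable_norm intf).
have i2 := leb_cons_integrable (integrable_norm intf').
have mft : measurable_fun (cubes s) (fun y => f (tcons (t, y))).
  have := @measurable_comp _ _ _ _ _ _ (cubes s.+1) f (cubes s) (fun y => tcons (t, y)).
  apply.
  - exact: measurable_cube.
  - by move=> _ [y cy <-]; apply/cube_cons.
  - by apply/measurable_EFinP; exact: measurable_int intf.
  - exact: measurable_funTS (measurable_tcons_l t).
apply/integrableP; split; first exact/measurable_EFinP.
have /integrableP[m3 h3] := integrableD (@measurable_cube s) i1 i2.
apply: le_lt_trans h3; apply: ae_ge0_le_integral => //.
- exact: measurable_cube.
- by apply: measurableT_comp => //; exact/measurable_EFinP.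
- exact: measurableT_comp.
apply: filterS (leb_cons_ae intf') => y iy cy.
have h := ftc_le (iy cy) (ff' cy) Ut.
by rewrite /= lee_fin; apply: le_trans h _; exact: ler_norm.
Qed.
End Slice.

End CubeSlices.

(** * Integral representation of smooth functions on the cube *)

Section Representation.
Variables (R : realType) (alpha : nat).
Hypothesis a0 : (0 < alpha)%N.
Local Notation U := (@unit_itv R).
Local Notation mu := (@lebesgue_measure R).
Local Notation cubes s := (@cube R s).
Local Notation ord := 'I_alpha.+1.

(** The factor carried by a derivative of order [a] in one variable.  It
    depends on its second argument only for the top order. *)
Definition kfun (a : nat) (x : R) : R -> R :=
  if (a < alpha)%N then fun=> bern a x else ker alpha.-1 x.

Lemma bdd_kfun a x : bdd_meas U (kfun a x).
Proof. by rewrite /kfun; case: ifP => _; [exact: bdd_meas_cst|exact: bdd_ker]. Qed.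

Definition ffcons s (a : ord) (h : {ffun 'I_s -> ord}) : {ffun 'I_s.+1 -> ord} :=
  [ffun j => oapp h a (unlift ord0 j)].

Lemma ffcons0 s a (h : {ffun 'I_s -> ord}) : ffcons a h ord0 = a.
Proof. by rewrite ffunE unlift_none. Qed.

Lemma ffconsS s a (h : {ffun 'I_s -> ord}) j : ffcons a h (lift ord0 j) = h j.
Proof. by rewrite ffunE liftK. Qed.

Lemma sum_ffcons s (V : nmodType) (F : {ffun 'I_s.+1 -> ord} -> V) :
  \sum_H F H = \sum_(h : {ffun 'I_s -> ord}) \sum_a F (ffcons a h).
Proof.
rewrite exchange_big pair_big /= (reindex (fun p : ord * {ffun 'I_s -> ord} => ffcons p.1 p.2))//=.
exists (fun H : {ffun 'I_s.+1 -> ord} => (H ord0, [ffun j => H (lift ord0 j)])) => [[a h] _|H _] /=.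
  by rewrite ffcons0; congr pair; apply/ffunP => j; rewrite ffunE ffconsS.
apply/ffunP => j; have [i ->|->] := unliftP ord0 j; first by rewrite ffconsS ffunE.
by rewrite ffcons0.
Qed.

Definition smooth_family s (D : {ffun 'I_s -> ord} -> s.-tuple R -> R) : Prop :=
  (forall h, (leb R s).-integrable (cubes s) (EFin \o D h)) /\
  (forall (h h' : {ffun 'I_s -> ord}) (j : 'I_s),
    h' j = (h j).+1 :> nat -> (forall i, i != j -> h' i = h i) ->
    forall x, cubes s x -> ftc (fun t => D h (upd x j t)) (fun t => D h' (upd x j t))).

Lemma upd_cons0 s (z t : R) (y : s.-tuple R) : upd (tcons (t, y)) ord0 z = tcons (z, y).
Proof.
apply: eq_from_tnth => i; rewrite tnth_mktuple.
by have [j ->|->] := unliftP ord0 i; rewrite ?eqxx// eq_sym (negbTE (neq_lift _ _)) !tnthS.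
Qed.

Lemma upd_consS s (z t : R) (y : s.-tuple R) j :
  upd (tcons (t, y)) (lift ord0 j) z = tcons (t, upd y j z).
Proof.
apply: eq_from_tnth => i; rewrite tnth_mktuple.
have [k ->|->] := unliftP ord0 i; last by rewrite (negbTE (neq_lift _ _)).
by rewrite !tnthS tnth_mktuple (inj_eq (@lift_inj _ _)).
Qed.

Lemma bdd_prod_kfun s (h : 'I_s -> nat) (x : 'I_s -> R) :
  bdd_meas (cubes s) (fun y => \prod_j kfun (h j) (x j) (tnth y j)).
Proof.
apply: bdd_meas_prod => j _; have [mk [M kM]] := bdd_kfun (h j) (x j); split.
  have := @measurable_comp _ _ _ _ _ _ U (kfun (h j) (x j)) (cubes s) (fun y => tnth y j).
  apply => //.
  - exact: measurable_unit_itv.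
  - by move=> _ [y cy <-]; rewrite unit_itvE.
  - by apply: measurable_funTS; exact: measurable_tnth.
by exists M => y cy; apply: kM; rewrite unit_itvE.
Qed.

Lemma ae_eq_Rintegral d (T : measurableType d) (m : {measure set T -> \bar R}) (A : set T) (f g : T -> R) :
  measurable A -> m.-integrable A (EFin \o f) -> m.-integrable A (EFin \o g) ->
  {ae m, forall x, A x -> f x = g x} -> \int[m]_(x in A) f x = \int[m]_(x in A) g x.
Proof.
move=> mA iF ig fg; rewrite /Rintegral; congr fine; apply: ae_eq_integral => //.
- exact: measurable_int iF.
- exact: measurable_int ig.
by apply: filterS fg => x h Ax; rewrite h.
Qed.

(** [sobolev_expansion] along the first variable, on a line on which all the
    derivatives are integrable. *)
Lemma sobolev_line s D (y : s.-tuple R) (h : {ffun 'I_s -> ord}) t :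
  smooth_family D -> cubes s y -> U t ->
  (forall a : ord, mu.-integrable U (EFin \o (fun z => D (ffcons a h) (tcons (z, y))))) ->
  D (ffcons ord0 h) (tcons (t, y)) =
  \sum_(a : ord) mean (fun z => D (ffcons a h) (tcons (z, y)) * kfun a t z).
Proof.
move=> [_ fD] cy Ut ia.
pose g (a : nat) z := D (ffcons (inord a) h) (tcons (z, y)).
have -> : D (ffcons ord0 h) (tcons (t, y)) = g 0%N t.
  by rewrite /g; congr (D (ffcons _ _) _); apply/val_inj; rewrite /= inordK.
rewrite (@sobolev_expansion _ alpha.-1 g t Ut); last 2 first.
- by move=> a _; exact: ia.
- move=> a; rewrite -ltnS prednK// => aa.
  have U0 : U 0 by rewrite unit_itvE lexx ltr01.
  have := fD (ffcons (inord a) h) (ffcons (inord a.+1) h) ord0 _ _ (tcons (0, y)) _.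
  rewrite !ffcons0 !inordK ?ltnS ?(ltnW aa)// => /(_ erefl) H.
  have {}H : ftc (fun t0 => D (ffcons (inord a) h) (upd (tcons (0, y)) ord0 t0))
      (fun t0 => D (ffcons (inord a.+1) h) (upd (tcons (0, y)) ord0 t0)).
    apply: H; last exact/cube_cons.
    by move=> i; have [j ->|->] := unliftP ord0 i; rewrite ?eqxx// !ffconsS.
  have E b : (fun t0 => D (ffcons (inord b) h) (upd (tcons (0, y)) ord0 t0)) = g b.
    by apply/funext => z; rewrite upd_cons0.
  by rewrite !E in H.
rewrite prednK// big_ord_recr /=; congr (_ + _).
  apply: eq_bigr => a _; rewrite -(meanZ (bern a t)); last exact: ia.
  apply: eq_mean => z _; rewrite /kfun /= ltn_ord mulrC; congr (D (ffcons _ _) _ * _).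
  by apply/val_inj; rewrite /= inordK// ltnW// ltnS.
apply: eq_mean => z _; rewrite /kfun /= ltnn mulrC; congr (D (ffcons _ _) _ * _).
by apply/val_inj; rewrite /= inordK.
Qed.

(** Induction on the dimension.  Freezing the first coordinate of the point
    leaves a family with the same properties in one variable less, by
    [slice_integrable]; its members are then expanded along almost every line
    in the first variable. *)
Theorem sobolev_representation s (D : {ffun 'I_s -> ord} -> s.-tuple R -> R) x :
  smooth_family D -> cubes s x ->
  D [ffun=> ord0] x = \sum_(h : {ffun 'I_s -> ord})
    \int[leb R s]_(y in cubes s) (D h y * \prod_j kfun (h j) (tnth x j) (tnth y j)).
Proof.
elim: s D x => [|s IH] D x.
  move=> [iD _] _; rewrite (bigD1 [ffun=> ord0])//= big1 ?addr0; last first.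
    by move=> h /eqP[]; apply/ffunP => -[].
  under eq_Rintegral => y _ do rewrite big_ord0 mulr1.
  rewrite /Rintegral integral_dirac; first last.
  - exact: measurable_int (iD _).
  - exact: measurable_cube.
  by rewrite diracE mem_set ?mul1e /= ?(tuple0 x)//; case.
move=> sD cx.
have xE : x = tcons (thead x, [tuple of behead x]) by rewrite /tcons /= -tuple_eta.
move: (thead x) ([tuple of behead x]) xE => t x' xE; subst x.
have [Ut cx'] := (cube_cons t x').1 cx.
have [iD fD] := sD.
pose E (h : {ffun 'I_s -> ord}) y := D (ffcons ord0 h) (tcons (t, y)).
have sE : smooth_family E.
  split=> [h|h h' j h'j h'i y cy].
    apply: (@slice_integrable _ _ _ (D (ffcons (inord 1) h))) => // y cy.
    have U0 : U 0 by rewrite unit_itvE lexx ltr01.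
    have H := fD (ffcons ord0 h) (ffcons (inord 1) h) ord0 _ _ (tcons (0, y)) _.
    have {}H : ftc (fun t0 => D (ffcons ord0 h) (upd (tcons (0, y)) ord0 t0))
        (fun t0 => D (ffcons (inord 1) h) (upd (tcons (0, y)) ord0 t0)).
      apply: H; last exact/cube_cons.
        by rewrite !ffcons0 inordK.
      by move=> i; have [j ->|->] := unliftP ord0 i; rewrite ?eqxx// !ffconsS.
    have E' a : (fun t0 => D (ffcons a h) (upd (tcons (0, y)) ord0 t0)) =
       (fun z => D (ffcons a h) (tcons (z, y))).
      by apply/funext => z; rewrite upd_cons0.
    by rewrite !E' in H.
  have H := fD (ffcons ord0 h) (ffcons ord0 h') (lift ord0 j) _ _ (tcons (t, y)) _.
  have {}H : ftc (fun t0 => D (ffcons ord0 h) (upd (tcons (t, y)) (lift ord0 j) t0))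
        (fun t0 => D (ffcons ord0 h') (upd (tcons (t, y)) (lift ord0 j) t0)).
    apply: H; last exact/cube_cons.
      by rewrite !ffconsS.
    move=> i; have [k ->|->] := unliftP ord0 i; rewrite ?ffcons0// !ffconsS => kj.
    by apply: h'i; apply: contra kj => /eqP ->.
  have E' h0 : (fun t0 => D (ffcons ord0 h0) (upd (tcons (t, y)) (lift ord0 j) t0)) =
       (fun z => E h0 (upd y j z)).
    by apply/funext => z; rewrite upd_consS.
  by rewrite !E' in H.
have -> : D [ffun=> ord0] (tcons (t, x')) = E [ffun=> ord0] x'.
  rewrite /E; congr (D _ _); apply/ffunP => i; rewrite !ffunE.
  by case: unliftP => [j|] _ //=; rewrite ffunE.
rewrite (IH _ _ sE cx') sum_ffcons; apply: eq_bigr => h _.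
pose w (y : s.-tuple R) := \prod_j kfun (h j) (tnth x' j) (tnth y j).
pose f (a : ord) (Y : s.+1.-tuple R) := D (ffcons a h) Y *
  \prod_j kfun (ffcons a h j) (tnth (tcons (t, x')) j) (tnth Y j).
have bw : bdd_meas (cubes s) w by exact: bdd_prod_kfun.
have bW a : bdd_meas (cubes s.+1) (fun Y => \prod_j kfun (ffcons a h j) (tnth (tcons (t, x')) j) (tnth Y j)).
  exact: bdd_prod_kfun.
have if_ a : (leb R s.+1).-integrable (cubes s.+1) (EFin \o f a).
  have := bdd_meas_integrableM (@measurable_cube R _) (bW a) (iD (ffcons a h)).
  apply: eq_integrable; first exact: measurable_cube.
  by move=> Y _ /=; rewrite /f mulrC.
have fE a z y : f a (tcons (z, y)) = D (ffcons a h) (tcons (z, y)) * kfun a t z * w y.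
  rewrite /f big_ord_recl ffcons0 -mulrA; congr (_ * (_ * _)).
  by apply: eq_bigr => j _; rewrite ffconsS !tnthS.
transitivity (\sum_a \int[leb R s]_(y in cubes s) mean (fun z => f a (tcons (z, y)))); last first.
  by apply: eq_bigr => a _; rewrite -leb_cons_integral.
rewrite -Rintegral_sum; [|exact: measurable_cube|by move=> a; exact: leb_cons_integrable].
apply: ae_eq_Rintegral.
- exact: measurable_cube.
- have := bdd_meas_integrableM (@measurable_cube R _) bw (sE.1 h).
  apply: eq_integrable; first exact: measurable_cube.
  by move=> y _ /=; rewrite mulrC.
- apply: integrable_sumR; first exact: measurable_cube.
  by move=> a; exact: leb_cons_integrable.
have all_int : {ae leb R s, forall y, forall a : ord, cubes s y ->
    mu.-integrable U (EFin \o (fun z => D (ffcons a h) (tcons (z, y))))}.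
  by apply: filter_forall => a; exact: leb_cons_ae.
apply: filterS all_int => y hy cy.
rewrite /E (sobolev_line sD cy Ut (fun a => hy a cy)) mulr_suml.
apply: eq_bigr => a _; rewrite mulrC -meanZ; last first.
  have := bdd_meas_integrableM (@measurable_unit_itv R) (bdd_kfun a t) (hy a cy).
  apply: eq_integrable; first exact: measurable_unit_itv.
  by move=> z _ /=; rewrite mulrC.
by apply: eq_mean => z _; rewrite fE mulrC.
Qed.

End Representation.

(** * Splitting the coordinates of the cube into two groups *)

Section Boxes.
Variables (R : realType) (s : nat).
Local Notation T := (s.-tuple R).

Definition box (A : 'I_s -> set R) : set T := [set x | forall i, A i (tnth x i)].

Definition boxes : set (set T) :=
  [set B | exists2 A : 'I_s -> set R, (forall i, measurable (A i)) & B = box A].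

Lemma measurable_box (A : 'I_s -> set R) : (forall i, measurable (A i)) -> measurable (box A).
Proof.
move=> mA; have -> : box A = \bigcap_(i in [set: 'I_s]) ((@tnth s R)^~ i @^-1` A i).
  by apply/seteqP; split=> x /= h i => [_|]; [exact: h|exact: h i I].
apply: fin_bigcap_measurable => // i _.
by rewrite -[X in measurable X]setTI; exact: measurable_tnth.
Qed.

Lemma leb_boxE (A : 'I_s -> set R) : (forall i, measurable (A i)) ->
  leb R s (box A) = (\prod_i lebesgue_measure (A i))%E.
Proof. by move=> mA; exact: leb_box. Qed.

Lemma measurable_boxesE : measurable = <<s boxes >>.
Proof.
apply/seteqP; split => [A mA|].
  rewrite /measurable /= in mA.
  apply: (smallest_sub (smallest_sigma_algebra _ _) _ mA) => B.
  rewrite -bigcup_seq /= => -[i _ [C mC <-]].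
  apply: sub_sigma_algebra; exists (fun j => if j == i then C else setT).
    by move=> j; case: ifP.
  rewrite setTI; apply/seteqP; split => x /=.
    by move=> Cx j; case: eqP => [->|].
  by move=> /(_ i); rewrite eqxx.
apply: smallest_sub; first exact: sigma_algebra_measurable.
by move=> _ [A mA ->]; exact: measurable_box.
Qed.

Lemma boxes_setI : setI_closed boxes.
Proof.
move=> _ _ [A mA ->] [B mB ->]; exists (fun i => A i `&` B i) => [i|].
  exact: measurableI.
by apply/seteqP; split => x; [move=> [h1 h2] i; split|move=> h; split=> i; have [] := h i].
Qed.

(** Boxes generate the sigma-algebra and are closed under intersection, so a
    measure is determined by its values on them. *)
Lemma leb_unique (m : {measure set T -> \bar R}) :
  (forall A, (forall i, measurable (A i)) -> m (box A) = (\prod_i lebesgue_measure (A i))%E) ->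
  forall B, measurable B -> leb R s B = m B.
Proof.
move=> mE B mB.
pose g (k : nat) := box (fun=> `[- k%:R, k%:R]%classic : set R).
apply: (measure_unique boxes g) => //.
- exact: measurable_boxesE.
- exact: boxes_setI.
- by move=> k; exists (fun=> `[- k%:R, k%:R]%classic).
- apply/seteqP; split => // x _.
  pose M := \sum_i `|tnth x i|.
  exists (Num.truncn M).+1 => // i.
  have h : `|tnth x i| <= M.
    by rewrite /M (bigD1 i)//= lerDl sumr_ge0.
  have M0 : 0 <= M by exact: le_trans (normr_ge0 _) h.
  have /andP[_ h2] := truncn_itv M0.
  by rewrite /= in_itv /= -ler_norml (le_trans h)// ltW.
- by move=> _ [A mA ->]; rewrite mE//; exact: leb_boxE.
- move=> k; have E : leb R s (g k) = (\prod_(i < s) lebesgue_measure (`[- k%:R, k%:R]%classic%R : set R))%E.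
    exact: leb_boxE.
  rewrite [ltLHS]E.
  suff : (\prod_(i < s) lebesgue_measure (`[- k%:R, k%:R]%classic%R : set R))%E \is a fin_num.
    by rewrite fin_numE => /andP[_]; rewrite ltey.
  elim/big_ind: _ => // [x y|i _]; first exact: fin_numM.
  by rewrite lebesgue_measure_itv /=; case: ifP.
Qed.
End Boxes.


Section Merge.
Local Notation merge := Defs.merge.
Variables (R : realType) (s : nat) (v : {set 'I_s}).
Local Notation cubes s := (@cube R s).
Local Notation nv := #|v|.
Local Notation nc := #|(~: v)%SET|.
Local Notation lv := (leb R nv).
Local Notation lc := (leb R nc).

Lemma index_enum_val (w : {set 'I_s}) (i : 'I_#|w|) : index (enum_val i) (enum w) = i.
Proof. by rewrite /enum_val index_uniq ?enum_uniq// -cardE. Qed.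

Lemma merge_in (x : nv.-tuple R) (y : nc.-tuple R) i :
  tnth (merge x y) (enum_val i) = tnth x i.
Proof. by rewrite tnth_mktuple enum_valP index_enum_val -tnth_nth. Qed.

Lemma merge_out (x : nv.-tuple R) (y : nc.-tuple R) i :
  tnth (merge x y) (enum_val i) = tnth y i.
Proof.
have := enum_valP i; rewrite finset.in_setC => /negbTE h.
by rewrite tnth_mktuple h index_enum_val -tnth_nth.
Qed.

Lemma merge_cases (j : 'I_s) :
  (exists i : 'I_nv, j = enum_val i) \/ (exists i : 'I_nc, j = enum_val i).
Proof.
have [jv|jv] := boolP (j \in v).
  by left; exists (enum_rank_in jv j); rewrite enum_rankK_in.
have jc : j \in (~: v)%SET by rewrite finset.in_setC.
by right; exists (enum_rank_in jc j); rewrite enum_rankK_in.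
Qed.

Definition merge_pair (z : nv.-tuple R * nc.-tuple R) : s.-tuple R := merge z.1 z.2.

Lemma measurable_merge_pair : measurable_fun setT merge_pair.
Proof.
apply/measurable_fun_tnthP => j; have [[i ->]|[i ->]] := merge_cases j.
  have -> : (@tnth s R)^~ (enum_val i) \o merge_pair = (@tnth nv R)^~ i \o fst.
    by apply/funext => z /=; exact: merge_in.
  by apply: measurableT_comp; [exact: measurable_tnth|exact: measurable_fst].
have -> : (@tnth s R)^~ (enum_val i) \o merge_pair = (@tnth nc R)^~ i \o snd.
  by apply/funext => z /=; exact: merge_out.
by apply: measurableT_comp; [exact: measurable_tnth|exact: measurable_snd].
Qed.

Lemma merge_pair_box (A : 'I_s -> set R) :
  merge_pair @^-1` box A = box (fun i : 'I_nv => A (enum_val i)) `*` box (fun i : 'I_nc => A (enum_val i)).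
Proof.
apply/seteqP; split => -[x y] /=.
  move=> h; split => i.
    by have := h (enum_val i); rewrite merge_in.
  by have := h (enum_val i); rewrite merge_out.
move=> [hx hy] j; have [[i ->]|[i ->]] := merge_cases j.
  by rewrite merge_in; exact: hx.
by rewrite merge_out; exact: hy.
Qed.

Lemma merge_pair_cube x y : cubes s (merge_pair (x, y)) <-> cubes nv x /\ cubes nc y.
Proof.
split=> [h|[hx hy] j].
  split=> i; first by have := h (enum_val i); rewrite merge_in.
  by have := h (enum_val i); rewrite merge_out.
have [[i ->]|[i ->]] := merge_cases j; first by rewrite merge_in.
by rewrite merge_out.
Qed.

(** The preimage of a box under [merge_pair] is a product of two boxes. *)
Lemma leb_merge (B : set (s.-tuple R)) : measurable B ->
  leb R s B = pushforward (lv \x lc)%E merge_pair B.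
Proof.
pose pf : {measure set (s.-tuple R) -> \bar R} :=
  measure_function_pushforward__canonical__measure_function_Measure (lv \x lc)%E measurable_merge_pair.
move=> mB; apply: (leb_unique (m := pf)) => // A mA.
rewrite /pf /= /pushforward merge_pair_box product_measure1E; last 2 first.
- exact: measurable_box.
- exact: measurable_box.
have E (w : {set 'I_s}) : (leb R #|w| (box (fun i : 'I_#|w| => A (enum_val i))) =
    \prod_(j in w) lebesgue_measure (A j))%E.
  by rewrite leb_boxE// [RHS]big_enum_val.
rewrite !E [RHS](bigID (mem v)) /=; congr (_ * _)%E; first exact: E.
by apply: eq_bigl => j; rewrite finset.in_setC.
Qed.

Let pf : {measure set (s.-tuple R) -> \bar R} :=
  measure_function_pushforward__canonical__measure_function_Measure (lv \x lc)%E measurable_merge_pair.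

Let integral_pf (f : s.-tuple R -> \bar R) :
  (\int[leb R s]_x f x = \int[pf]_x f x)%E.
Proof. by apply: eq_measure_integral => A mA _; exact: leb_merge. Qed.

Lemma ge0_integral_merge (f : s.-tuple R -> \bar R) : measurable_fun setT f ->
  (forall x, (0 <= f x)%E) ->
  (\int[leb R s]_x f x = \int[(lv \x lc)%E]_z f (merge_pair z))%E.
Proof.
move=> mf f0; rewrite integral_pf ge0_integral_pushforward ?preimage_setT//.
exact: measurable_merge_pair.
Qed.

Lemma integrable_merge (f : s.-tuple R -> \bar R) : (leb R s).-integrable setT f ->
  (lv \x lc)%E.-integrable setT (fun z => f (merge_pair z)).
Proof.
move=> /integrableP[mf f_lt]; apply/integrableP; split.
  exact: measurableT_comp mf measurable_merge_pair.
rewrite -(ge0_integral_merge (f := fun x => `|f x|%E))//.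
exact: measurableT_comp.
Qed.

Lemma integral_merge (f : s.-tuple R -> \bar R) : (leb R s).-integrable setT f ->
  (\int[leb R s]_x f x = \int[(lv \x lc)%E]_z f (merge_pair z))%E.
Proof.
move=> intf; rewrite integral_pf (integral_pushforward measurable_merge_pair) ?preimage_setT//.
  exact: measurable_int intf.
exact: integrable_merge.
Qed.

Variables (g w : s.-tuple R -> R) (M : R).
Hypothesis ig : (leb R s).-integrable (cubes s) (EFin \o g).
Hypothesis bw : bdd_meas (cubes s) w.
Hypothesis wM : forall x, cubes s x -> `|w x| <= M.
Hypothesis w_dep : forall x y y', w (merge_pair (x, y)) = w (merge_pair (x, y')).

Let gC := g \_ (cubes s).
Let G (z : nv.-tuple R * nc.-tuple R) : R := gC (merge_pair z).
Let y0 : nc.-tuple R := [tuple 0 | _ < nc].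

Let igC : (leb R s).-integrable setT (EFin \o gC).
Proof.
have := (integrable_mkcond (EFin \o g) (@measurable_cube R s)).1 ig.
by apply: eq_integrable => // x _; rewrite restrict_EFin.
Qed.

Let iG : (lv \x lc)%E.-integrable setT (EFin \o G).
Proof. exact: integrable_merge igC. Qed.

Let GE x : cubes nv x -> forall y, G (x, y) = (fun y => g (merge_pair (x, y))) \_ (cubes nc) y.
Proof.
move=> cx y; rewrite /G /gC /patch; case: ifPn => [/set_mem/merge_pair_cube[_ cy]|h].
  by rewrite mem_set.
by case: ifPn => // /set_mem cy; move: h; rewrite mem_set//; exact/merge_pair_cube.
Qed.

Let G_out x y : ~ cubes nv x -> G (x, y) = 0.
Proof.
by move=> cx; rewrite /G /gC /patch; case: ifPn => // /set_mem/merge_pair_cube[/cx].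
Qed.

Let fubini_abs x :
  (`|\int[lc]_y (G (x, y))%:E| = (abs_mean g (v := v) \_ (cubes nv)) x)%E.
Proof.
rewrite [RHS]/patch; case: ifPn => [/set_mem cx|/negP cx].
  rewrite /abs_mean [X in (_ = `|X|)%E]integral_mkcond; congr (`| _ |)%E.
  by apply: eq_integral => y _; rewrite restrict_EFin /= GE.
rewrite (_ : (fun y => _) = cst 0%E) ?integral0 ?abse0//.
by apply/funext => y; rewrite G_out//; move=> h; apply: cx; rewrite inE.
Qed.

Lemma measurable_abs_mean : measurable_fun (cubes nv) (abs_mean g (v := v)).
Proof.
apply/(measurable_restrictT _ _).2; first exact: measurable_cube.
rewrite (_ : _ \_ _ = fun x => `|\int[lc]_y (G (x, y))%:E|%E); last first.
  by apply/funext => x; rewrite fubini_abs.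
by apply: measurableT_comp => //; exact: measurable_fubini_F iG.
Qed.

(** For almost every point of the first group of coordinates the integral over
    the other group is absolutely convergent; the weight does not depend on that
    group and comes out of the integral. *)
Lemma le_integral_abs_mean :
  ((`|\int[leb R s]_(x in cubes s) (g x * w x)|)%:E <=
   M%:E * \int[lv]_(x in cubes nv) abs_mean g x)%E.
Proof.
have M0 : 0 <= M.
  apply: le_trans (normr_ge0 _) (wM (x := [tuple 0 | _ < s]) _) => i.
  by rewrite tnth_mktuple lexx ltr01.
have igw : (leb R s).-integrable (cubes s) (EFin \o (fun x => g x * w x)).
  under eq_fun do rewrite mulrC.
  by apply: bdd_meas_integrableM => //; exact: measurable_cube.
have igwC : (leb R s).-integrable setT (fun x => (gC x * w x)%:E).
  have := (integrable_mkcond _ (@measurable_cube R s)).1 igw.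
  apply: eq_integrable => // x _; rewrite restrict_EFin /= /gC /patch.
  by case: ifP => //; rewrite mul0r.
have iGw := integrable_merge igwC.
have E : (\int[leb R s]_(x in cubes s) (g x * w x)%:E =
          \int[lv]_x \int[lc]_y (G (x, y) * w (merge_pair (x, y)))%:E)%E.
  rewrite [RHS](integral12_prod_meas1 iGw) -(integral_merge igwC) integral_mkcond.
  apply: eq_integral => x _; rewrite restrict_EFin /= /gC /patch.
  by case: ifP => //; rewrite mul0r.
rewrite /Rintegral -[X in (X <= _)%E]abse_EFin fineK; last first.
  by apply: integrable_fin_num => //; exact: measurable_cube.
rewrite E; apply: le_trans (le_abse_integral _ _ _) _ => //.
  exact: measurable_fubini_F iGw.
rewrite -ge0_integralZl//; last 3 first.
- exact: measurable_cube.
- exact: measurable_abs_mean.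
- by move=> x _; exact: abse_ge0.
rewrite [leRHS]integral_mkcond; apply: ae_ge0_le_integral => //.
- by apply: measurableT_comp => //; exact: measurable_fubini_F iGw.
- by move=> x _; rewrite /patch; case: ifP => // _; rewrite mule_ge0 ?lee_fin// abse_ge0.
- apply/(measurable_restrictT _ _).1; first exact: measurable_cube.
  by apply: emeasurable_funM => //; exact: measurable_abs_mean.
apply: filterS (ae_integrable1 iG) => x ix _.
have -> : ((fun x => M%:E * abs_mean g x)%E \_ (cubes nv)) x =
    (M%:E * `|\int[lc]_y (G (x, y))%:E|)%E.
  by rewrite fubini_abs /patch; case: ifP => //; rewrite mule0.
have [cx|cx] := pselect (cubes nv x); last first.
  rewrite (_ : (fun y => _) = cst 0%E); last first.
    by apply/funext => y; rewrite G_out// mul0r.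
  by rewrite integral0 abse0 mule_ge0 ?abse_ge0.
rewrite (_ : (fun y => _) = fun y => ((w (merge_pair (x, y0)))%:E * (G (x, y))%:E)%E); last first.
  by apply/funext => y; rewrite (w_dep _ _ y0) mulrC.
rewrite integralZl// abseM lee_wpmul2r ?abse_ge0// abse_EFin lee_fin.
apply: wM; apply/merge_pair_cube; split=> // i.
by rewrite tnth_mktuple lexx ltr01.
Qed.
End Merge.

(** * What the Sobolev norm controls *)

Section Jensen.
Context d (T : measurableType d) (R : realType).
Variables (mu : {measure set T -> \bar R}) (D : set T).
Hypotheses (mD : measurable D) (D1 : mu D = 1%E).
Local Open Scope ereal_scope.

(** Young's inequality for x and c^(r-1), the second factor being chosen so
    that there is equality at x = c. *)
Lemma young_bound (r c : R) (x : \bar R) : (1 < r)%R -> (0 < c)%R -> 0 <= x ->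
  (c `^ (r - 1))%:E * x <= (r^-1)%:E * (x `^ r) + ((1 - r^-1) * c `^ r)%:E.
Proof.
move=> r1 c0; have r0 : (0 < r)%R := lt_trans ltr01 r1.
have rB : (0 < r - 1)%R by rewrite subr_gt0.
have cB : (0 < c `^ (r - 1))%R by exact: powR_gt0.
case: x => [x| |//] x0; last first.
  by rewrite poweRyr ?gt_eqF// !gt0_muley ?lte_fin ?invr_gt0// addye.
rewrite poweR_EFin -!EFinM -EFinD lee_fin.
have q0 : (0 < r / (r - 1))%R by exact: divr_gt0.
have := @conjugate_powR R x (c `^ (r - 1))%R r (r / (r - 1))%R.
rewrite -powRrM (_ : ((r - 1) * (r / (r - 1)) = r)%R); last by field; rewrite gt_eqF.
move=> /(_ _ (ltW cB) r0 q0 _) h.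
have {}h := h x0; rewrite [leLHS]mulrC; apply: le_trans (h _) _.
  by field; rewrite !gt_eqF.
rewrite le_eqVlt; apply/orP; left; apply/eqP.
by field; rewrite !gt_eqF.
Qed.

(** On a probability space the L^1 norm is at most the L^r norm.  Integrating
    [young_bound] proves it without assuming [f] finite. *)
Lemma le_integral_of_poweR (f : T -> \bar R) (r c : R) : measurable_fun D f ->
  (forall x, D x -> 0 <= f x) -> (1 <= r)%R -> (0 < c)%R ->
  \int[mu]_(x in D) (f x `^ r) <= (c `^ r)%:E -> \int[mu]_(x in D) f x <= c%:E.
Proof.
move=> mf f0; rewrite le_eqVlt => /predU1P[<-|r1] c0.
  rewrite (powRr1 (ltW c0)) => H; apply: le_trans H; rewrite le_eqVlt; apply/orP; left; apply/eqP.
  by apply: eq_integral => x /set_mem Dx; rewrite poweRe1// f0.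
move=> H; have r0 : (0 < r)%R := lt_trans ltr01 r1.
have cB : (0 < c `^ (r - 1))%R by exact: powR_gt0.
have mfr : measurable_fun D (fun x => f x `^ r).
  exact: measurableT_comp (measurable_poweR r) mf.
have k0 : (0 <= (1 - r^-1) * c `^ r)%R.
  by rewrite mulr_ge0 ?powR_ge0// subr_ge0 invf_le1// ltW.
have : (c `^ (r - 1))%:E * \int[mu]_(x in D) f x <= (c `^ r)%:E.
  rewrite -ge0_integralZl//; last by rewrite lee_fin; exact: ltW.
  apply: (@le_trans _ _ (\int[mu]_(x in D) ((r^-1)%:E * (f x `^ r) + ((1 - r^-1) * c `^ r)%:E))).
    apply: ge0_le_integral => //.
    - by move=> x Dx; rewrite mule_ge0 ?f0// lee_fin ltW.
    - exact: measurable_funeM.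
    - by apply: emeasurable_funD => //; exact: measurable_funeM.
    - by move=> x Dx; apply: young_bound => //; exact: f0.
  rewrite ge0_integralD//; last 2 first.
  - by move=> x Dx; apply: mule_ge0; [rewrite lee_fin invr_ge0; exact: ltW|exact: poweR_ge0].
  - exact: measurable_funeM.
  rewrite ge0_integralZl//; last 2 first.
  - by move=> x _; exact: poweR_ge0.
  - by rewrite lee_fin invr_ge0; exact: ltW.
  rewrite integral_cst// D1 mule1.
  apply: (@le_trans _ _ ((r^-1)%:E * (c `^ r)%:E + ((1 - r^-1) * c `^ r)%:E)).
    by rewrite leeD2r// lee_pmul2l// lte_fin invr_gt0.
  by rewrite -EFinM -EFinD lee_fin -mulrDl addrC subrK mul1r.
have -> : (c `^ r)%:E = (c `^ (r - 1))%:E * c%:E.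
  by rewrite -EFinM mulrC mulr_powRB1// ltW.
by rewrite lee_pmul2l// lte_fin.
Qed.

Lemma le_integral_of_ess_sup (f : T -> \bar R) (c : R) : measurable_fun D f ->
  (forall x, D x -> 0 <= f x) -> (0 <= c)%R ->
  ess_sup mu (f \_ D) <= c%:E -> \int[mu]_(x in D) f x <= c%:E.
Proof.
move=> mf f0 c0 /ess_supP H; apply: (@le_trans _ _ (\int[mu]_(x in D) (cst c%:E) x)).
  apply: ae_ge0_le_integral => //.
  by apply: filterS H => x Hx Dx; move: Hx; rewrite /patch mem_set.
by rewrite integral_cst// D1 mule1.
Qed.
End Jensen.

Section SobNorm.
Variables (R : realType) (s alpha : nat).
Variables (q : \bar R) (gamma : {set 'I_s} -> R) (D : diff_order s alpha -> s.-tuple R -> R).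
Hypotheses (q1 : (1 <= q)%E) (gamma0 : forall u, 0 < gamma u).
Hypothesis iD : forall h, (leb R s).-integrable (@cube R s) (EFin \o D h).
Hypothesis normD : (sob_norm q gamma D <= 1)%E.

(** A single term is at most the norm, and the cube has measure one. *)
Lemma le_integral_abs_mean_gamma (u v : {set 'I_s}) (h : diff_order s alpha) : v \subset u -> order_of u v h ->
  (\int[leb R #|v|]_(x in @cube R #|v|) abs_mean (D h) x <= (gamma u)%:E)%E.
Proof.
move=> vu huv; have mv := measurable_abs_mean (v := v) (iD h).
have v0 x : @cube R #|v| x -> (0 <= abs_mean (D h) x)%E by move=> _; exact: abse_ge0.
have : (sob_norm_on q D u <= (gamma u)%:E)%E.
  rewrite -[leLHS]mul1e -[in leLHS](mulfV (lt0r_neq0 (gamma0 u))) EFinM -muleA.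
  rewrite -[leRHS]mule1 lee_pmul2l ?lte_fin//.
  apply: le_trans normD; rewrite /sob_norm.
  exact: (le_bigmax _ (fun u => ((gamma u)^-1%:E * sob_norm_on q D u)%E) u).
rewrite /sob_norm_on; case: q q1 => [r| |] //; last first.
  move=> _ H; apply: le_integral_of_ess_sup (ltW (gamma0 u)) _ => //.
  - exact: measurable_cube.
  - exact: leb_cube.
  apply: le_trans H; apply: le_trans (le_bigmax_cond _ _ vu).
  exact: (le_bigmax_cond _ (fun h => ess_sup (leb R #|v|) (abs_mean (D h) (v := v) \_ (@cube R #|v|)))).
rewrite lee_fin => r1; set S := (\sum_(_ | _) _)%E => H.
have r0 : 0 < r := lt_le_trans ltr01 r1.
have I0 (w : {set 'I_s}) (k : diff_order s alpha) : (0 <= \int[leb R #|w|]_(x in @cube R #|w|) (abs_mean (D k) x `^ r))%E.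
  by apply: integral_ge0 => x _; exact: poweR_ge0.
have S0 : (0 <= S)%E by apply: sume_ge0 => w _; apply: sume_ge0 => k _.
have {H} : (S <= (gamma u `^ r)%:E)%E.
  rewrite -poweR_EFin -[leLHS]poweRe1// -(mulVf (lt0r_neq0 r0)) poweRrM.
  apply: gt0_ler_poweR => //; first exact: ltW.
    by rewrite in_itv /= poweR_ge0 leey.
  by rewrite in_itv /= lee_fin (ltW (gamma0 u)) leey.
move=> H; apply: (le_integral_of_poweR _ _ mv v0 r1) => //.
- exact: measurable_cube.
- exact: leb_cube.
apply: le_trans H; rewrite /S (bigD1 v)//= (bigD1 h)//= -addeA leeDl// adde_ge0//.
  by apply: sume_ge0 => k _.
by apply: sume_ge0 => w _; apply: sume_ge0 => k _.
Qed.
End SobNorm.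

(** * Restriction of the operators to b-adic blocks *)

Section AffineChange.
Variable R : realType.
Local Notation mu := (@lebesgue_measure R).
Local Notation T := (measurableTypeR R).

Definition affine (b c : R) : T -> T := fun z => (c + z) / b.

Lemma measurable_affine b c : measurable_fun setT (affine b c).
Proof. by apply: measurable_funM => //; apply: measurable_funD. Qed.

Lemma affine_pushforward (b c : R) (A : set T) : 0 < b -> measurable A ->
  mu (affine b c @^-1` A) = (b%:E * mu A)%E.
Proof.
move=> b0 mA.
pose pf : {measure set T -> \bar R} :=
  measure_function_pushforward__canonical__measure_function_Measure mu (measurable_affine b c).
have bi0 : 0 <= b^-1 by rewrite invr_ge0 ltW.
pose ms : {measure set T -> \bar R} := mscale (NngNum bi0) pf.
suff -> : mu A = ms A.
  by rewrite /ms /= /mscale /= /pushforward muleA -EFinM divff ?mul1e ?gt_eqF.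
apply: lebesgue_measure_unique => // _ [[x y]] _ <-.
rewrite /ms /= /mscale /= /pushforward.
have -> : affine b c @^-1` `]x, y] = `](b * x - c), (b * y - c)]%classic.
  apply/seteqP; split => z; rewrite /= !in_itv /= /affine ltr_pdivlMr// ler_pdivrMr//.
    by move=> /andP[? ?]; rewrite ltrBlDl lerBrDl mulrC [b * y]mulrC; apply/andP.
  by rewrite ltrBlDl lerBrDl mulrC [b * y]mulrC.
rewrite !lebesgue_measure_itv /= !lte_fin ltrD2r ltr_pM2l//.
case: ifP => _; last by rewrite mule0.
rewrite -!EFinD -EFinM; congr EFin; field; exact: lt0r_neq0.
Qed.

Lemma affine_Rintegral (b c : R) (D : set T) (f : T -> R) : 0 < b -> measurable D ->
  mu.-integrable D (EFin \o f) ->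
  \int[mu]_(z in affine b c @^-1` D) f (affine b c z) = b * \int[mu]_(z in D) f z.
Proof.
move=> b0 mD intf; rewrite /Rintegral.
have ge0 (g : T -> \bar R) : measurable_fun D g -> (forall x, 0 <= g x)%E ->
    (\int[mu]_(z in affine b c @^-1` D) g (affine b c z) = b%:E * \int[mu]_(z in D) g z)%E.
  move=> mg g0.
  pose pf : {measure set T -> \bar R} :=
    measure_function_pushforward__canonical__measure_function_Measure mu (measurable_affine b c).
  have b0' : 0 <= b by exact: ltW.
  pose ms : {measure set T -> \bar R} := mscale (NngNum b0') mu.
  transitivity (\int[pf]_(z in D) g z)%E.
    by rewrite /pf /= ge0_integral_pushforward//; exact: measurable_affine.
  rewrite (eq_measure_integral ms); last first.
    by move=> A mA _; rewrite /pf /= /pushforward affine_pushforward.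
  by rewrite ge0_integral_mscale.
have mf := measurable_int _ intf.
have eqp : (\int[mu]_(z in affine b c @^-1` D) ((EFin \o f) \o affine b c)^\+ z =
    b%:E * \int[mu]_(z in D) (EFin \o f)^\+ z)%E.
  by rewrite funepos_comp ge0//; exact: measurable_funepos.
have eqn : (\int[mu]_(z in affine b c @^-1` D) ((EFin \o f) \o affine b c)^\- z =
    b%:E * \int[mu]_(z in D) (EFin \o f)^\- z)%E.
  by rewrite funeneg_comp ge0//; exact: measurable_funeneg.
have -> : (\int[mu]_(z in affine b c @^-1` D) (f (affine b c z))%:E =
    b%:E * \int[mu]_(z in D) (f z)%:E)%E.
  rewrite [LHS]integralE eqp eqn -muleBr//.
    by congr (_ * _)%E; rewrite [RHS]integralE.
  apply: fin_num_adde_defr; exact: integrable_pos_fin_num.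
by rewrite fineM//; exact: integrable_fin_num.
Qed.

Local Notation U := (@unit_itv R).
Hint Resolve measurable_unit_itv : core.

Lemma affine_unit_itv (b k : nat) : (k < b)%N ->
  forall z, U z -> U (affine b%:R k%:R z) .
Proof.
move=> kb z; have b0 : 0 < b%:R :> R by rewrite ltr0n (leq_trans _ kb).
rewrite !unit_itvE /affine => /andP[z0 z1].
rewrite divr_ge0 ?addr_ge0 ?ler0n//= ltr_pdivrMr// mul1r.
have : k.+1%:R <= b%:R :> R by rewrite ler_nat.
by rewrite -natr1 => ?; lra.
Qed.

Lemma Rintegral_block (w : R -> R) (b k : nat) : (k < b)%N ->
  mu.-integrable U (EFin \o w) ->
  \int[mu]_(x in `[k%:R / b%:R, k.+1%:R / b%:R[) w x =
  b%:R^-1 * mean (fun z => w ((k%:R + z) / b%:R)).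
Proof.
move=> kb iw; have b0 : 0 < b%:R :> R by rewrite ltr0n (leq_trans _ kb).
have := @affine_Rintegral b%:R k%:R `[k%:R / b%:R, k.+1%:R / b%:R[%classic w b0.
have -> : affine b%:R k%:R @^-1` `[k%:R / b%:R, k.+1%:R / b%:R[ = U.
  apply/seteqP; split => z; rewrite /= unit_itvE !in_itv /= /affine ler_pM2r ?invr_gt0// ltr_pM2r ?invr_gt0//.
    by rewrite lerDl -natr1 ltrD2l.
  by rewrite lerDl -natr1 ltrD2l.
move=> H; rewrite -[LHS](mulKf (lt0r_neq0 b0)); congr (_ * _); apply/esym/H => //.
apply: integrableS iw => // z; rewrite unit_itvE /= in_itv /= => /andP[z0 z1].
rewrite (le_trans _ z0) ?divr_ge0 ?ler0n//= (lt_le_trans z1)// ler_pdivrMr// mul1r ler_nat//.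
Qed.

Lemma prim_partial_block (w : R -> R) (b k : nat) (y : R) : (k < b)%N ->
  mu.-integrable U (EFin \o w) -> U y ->
  \int[mu]_(x in `[k%:R / b%:R, (k%:R + y) / b%:R]) w x =
  b%:R^-1 * prim (fun z => w ((k%:R + z) / b%:R)) y.
Proof.
move=> kb iw Uy; have b0 : 0 < b%:R :> R by rewrite ltr0n (leq_trans _ kb).
have := @affine_Rintegral b%:R k%:R `[k%:R / b%:R, (k%:R + y) / b%:R]%classic w b0.
have -> : affine b%:R k%:R @^-1` `[k%:R / b%:R, (k%:R + y) / b%:R] = `[0, y]%classic.
  apply/seteqP; split => z; rewrite /= !in_itv /= /affine !ler_pM2r ?invr_gt0//.
    by rewrite lerDl lerD2l.
  by rewrite lerDl lerD2l.
move=> H; rewrite -[LHS](mulKf (lt0r_neq0 b0)); congr (_ * _); apply/esym/H => //.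
have Uk := affine_unit_itv kb Uy.
apply: integrableS iw => // z; rewrite /= in_itv /= => /andP[z0 z1].
move: Uk; rewrite !unit_itvE /affine => /andP[_ h].
by rewrite (le_trans _ z0) ?divr_ge0 ?ler0n//= (le_lt_trans z1).
Qed.

Lemma Rintegral_blocks (w : R -> R) (b k : nat) : (k <= b)%N -> (0 < b)%N ->
  mu.-integrable U (EFin \o w) ->
  \int[mu]_(x in `[0, k%:R / b%:R[) w x =
  b%:R^-1 * \sum_(j < k) mean (fun z => w ((j%:R + z) / b%:R)).
Proof.
move=> kb b0' iw; have b0 : 0 < b%:R :> R by rewrite ltr0n.
elim: k kb => [|k IH] kb.
  by rewrite big_ord0 mulr0 mul0r set_itv_ge ?Rintegral_set0// bnd_simp ltxx.
rewrite big_ord_recr mulrDr -IH ?(ltnW kb)// -Rintegral_block//.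
have le01 : 0 <= k%:R / b%:R :> R by rewrite divr_ge0.
have le12 : k%:R / b%:R <= k.+1%:R / b%:R :> R by rewrite ler_pM2r ?invr_gt0// ler_nat.
rewrite (@itv_bndbnd_setU _ _ (BLeft 0) (BLeft (k%:R / b%:R)) (BLeft (k.+1%:R / b%:R))) ?bnd_simp//.
rewrite Rintegral_setU//; last 2 first.
- apply: (integrableS (@measurable_unit_itv R) _ _ iw); first exact: measurableU.
  move=> z; rewrite unit_itvE => -[]; rewrite /= in_itv /= => /andP[z0 z1].
    rewrite z0 (lt_le_trans z1)// ler_pdivrMr// mul1r ler_nat ltnW//.
  rewrite (le_trans le01 z0) (lt_le_trans z1)// ler_pdivrMr// mul1r ler_nat//.
- apply/disj_setPS => z [] /=; rewrite !in_itv /= => /andP[_ z1] /andP[z2 _].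
  by move: z1; rewrite ltNge z2.
Qed.

(** The integral up to (k + y) / b consists of k whole blocks and a part of the
    next one. *)
Lemma prim_block (w : R -> R) (b k : nat) (y : R) : (k < b)%N ->
  mu.-integrable U (EFin \o w) -> U y ->
  prim w ((k%:R + y) / b%:R) =
  b%:R^-1 * (\sum_(j < k) mean (fun z => w ((j%:R + z) / b%:R))
            + prim (fun z => w ((k%:R + z) / b%:R)) y).
Proof.
move=> kb iw Uy; have b0 : 0 < b%:R :> R by rewrite ltr0n (leq_trans _ kb).
rewrite mulrDr -prim_partial_block// -Rintegral_blocks// ?(ltnW kb)// ?(leq_trans _ kb)//.
have Uk := affine_unit_itv kb Uy; move: (Uy); rewrite unit_itvE => /andP[y0 y1].
have le01 : 0 <= k%:R / b%:R :> R by rewrite divr_ge0.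
have le12 : k%:R / b%:R <= (k%:R + y) / b%:R :> R by rewrite ler_pM2r ?invr_gt0// lerDl.
rewrite /prim (@itv_bndbnd_setU _ _ (BLeft 0) (BLeft (k%:R / b%:R)) (BRight ((k%:R + y) / b%:R))) ?bnd_simp//.
rewrite Rintegral_setU//; last 2 first.
- move: (Uk); rewrite unit_itvE /affine => /andP[_ h].
  apply: (integrableS (@measurable_unit_itv R) _ _ iw); first exact: measurableU.
  move=> z; rewrite unit_itvE => -[]; rewrite /= in_itv /= => /andP[z0 z1].
    by rewrite z0 (lt_le_trans z1)// (le_trans le12)// ltW.
  by rewrite (le_trans le01 z0) (le_lt_trans z1).
- apply/disj_setPS => z [] /=; rewrite !in_itv /= => /andP[_ z1] /andP[z2 _].
  by move: z1; rewrite ltNge z2.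
Qed.

Lemma mean_block (w : R -> R) (b : nat) : (0 < b)%N -> mu.-integrable U (EFin \o w) ->
  mean w = b%:R^-1 * \sum_(j < b) mean (fun z => w ((j%:R + z) / b%:R)).
Proof.
move=> b0 iw; rewrite -Rintegral_blocks// divff ?pnatr_eq0 -?lt0n//.
Qed.
End AffineChange.

(** * Complex-weighted sums of kernels over a point set *)

Import Normc.
Local Open Scope complex_scope.
Local Notation re := (@complex.Re _).
Local Notation im := (@complex.Im _).

Section ComplexNorm.
Variable R : rcfType.
Implicit Types (u z : R[i]).

Lemma normcD z u : normc (z + u) <= normc z + normc u.
Proof. exact: (@le_normcD R). Qed.

Lemma normc_N z : normc (- z) = normc z.
Proof. exact: (@normcN R). Qed.

Lemma normc_ge0 z : 0 <= normc z.
Proof. by case: z => a c; exact: sqrtr_ge0. Qed.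

Lemma normc_real (r : R) : normc r%:C = `|r|.
Proof. by rewrite /normc /= expr0n addr0 sqrtr_sqr. Qed.

Lemma normc_sum (I : Type) (r : seq I) (P : pred I) (F : I -> R[i]) :
  normc (\sum_(i <- r | P i) F i) <= \sum_(i <- r | P i) normc (F i).
Proof.
elim/big_rec2: _ => [|i x y _ h]; first by rewrite normc0.
by apply: le_trans (normcD _ _) _; rewrite lerD2l.
Qed.

Lemma normc_prod (I : Type) (r : seq I) (P : pred I) (F : I -> R[i]) :
  normc (\prod_(i <- r | P i) F i) = \prod_(i <- r | P i) normc (F i).
Proof. by apply: (big_morph _ (@normcM R)); rewrite normc1. Qed.

Lemma normr_Re_le z : `|re z| <= normc z.
Proof.
case: z => a c /=; rewrite -sqrtr_sqr ler_wsqrtr// lerDl sqr_ge0//.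
Qed.

(** Reduces bounds for complex weights to bounds for real ones, as rotations can
    be absorbed in the weights. *)
Lemma normc_le_rot z (B : R) :
  (forall u, normc u = 1 -> re (u * z) <= B) -> normc z <= B.
Proof.
move=> h; have [e|z0] := eqVneq z 0.
  by have := h 1 (normc1 _); rewrite e mulr0 normc0.
have n0 : normc z != 0 by apply: contra z0 => /eqP/eq0_normc ->.
have n0' : 0 < normc z by rewrite lt_def n0 normc_ge0.
pose u := (normc z)^-1%:C * z^*.
have nJ : normc z^* = normc z by case: (z) => a c /=; rewrite sqrrN.
have := h u; rewrite normcM normc_real ger0_norm ?invr_ge0 ?normc_ge0// nJ mulVf// => /(_ erefl).
apply: le_trans; rewrite /u; case: z {h u nJ z0} n0 n0' => a c /=.
set n := Num.sqrt _ => n0 n0'.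
have nn : n * n = a ^+ 2 + c ^+ 2 by rewrite -expr2 sqr_sqrtr// addr_ge0 ?sqr_ge0.
have -> : (n^-1 * a - 0 * - c) * a - (n^-1 * - c + 0 * a) * c = n^-1 * (a ^+ 2 + c ^+ 2).
  by ring.
by rewrite -nn mulrA mulVf// mul1r.
Qed.

End ComplexNorm.

Section WeightedKernelSums.
Variable R : realType.
Local Notation U := (@unit_itv R).
Local Notation mu := (@lebesgue_measure R).
Local Notation int g := (mu.-integrable U (EFin \o g)).

(** For the weights of a Walsh function, [kersum] and [moment] are the Walsh
    coefficients of the kernels and of the Bernoulli polynomials on a grid. *)
Definition kersum (I : finType) (x : I -> R) (c : I -> R[i]) t (y : R) : R[i] :=
  \sum_i c i * (ker t (x i) y)%:C.

Definition moment (I : finType) (x : I -> R) (c : I -> R[i]) t : R[i] :=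
  \sum_i c i * (bern t (x i))%:C.

Local Notation rkersum x d t y := (\sum_i d i * ker t (x i) y).
Local Notation rmoment x d t := (\sum_i d i * bern t (x i)).

Section Real.
Variables (I : finType) (x : I -> R).
Implicit Types d : I -> R.

Lemma int_rkersum d t : int (fun y => rkersum x d t y).
Proof.
apply: integrable_sumR => [|i]; first exact: measurable_unit_itv.
apply: bdd_meas_integrableM; [exact: measurable_unit_itv|exact: bdd_meas_cst|exact: int_ker].
Qed.

Lemma mean_rkersum d t : mean (fun y => rkersum x d t y) = rmoment x d t.+1.
Proof.
rewrite /mean Rintegral_sum; [|exact: measurable_unit_itv|move=> i].
  by apply: eq_bigr => i _; rewrite -[LHS]/(mean _) meanZ//; exact: int_ker.
apply: bdd_meas_integrableM; [exact: measurable_unit_itv|exact: bdd_meas_cst|exact: int_ker].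
Qed.

Lemma prim_rkersum d t y : U y ->
  prim (fun z => rkersum x d t z) y = y * rmoment x d t.+1 - rkersum x d t.+1 y.
Proof.
move=> Uy; rewrite /prim Rintegral_sum//; last first.
  move=> i; apply: int_subitv => //.
  apply: bdd_meas_integrableM; [exact: measurable_unit_itv|exact: bdd_meas_cst|exact: int_ker].
rewrite mulr_sumr -sumrB; apply: eq_bigr => i _.
rewrite RintegralZl//; last by apply: int_subitv => //; exact: int_ker.
rewrite /= /tprim -/(prim (ker t (x i)) y); ring.
Qed.

Lemma rkersumS d t y : U y -> rkersum x d t.+1 y = tprim (fun z => rkersum x d t z) y.
Proof. by move=> Uy; rewrite /tprim mean_rkersum prim_rkersum//; ring. Qed.

End Real.

Section RealBlocks.
Variables (I : finType) (x : I -> R) (b : nat).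
Hypotheses (b0 : (0 < b)%N) (xU : forall i, U (x i)).
Variable d : 'I_b -> I -> R.

Let X (p : 'I_b * I) : R := (p.1%:R + x p.2) / b%:R.
Let D (p : 'I_b * I) : R := d p.1 p.2.

(** The points (k + x_i) / b form b scaled copies of one point set, the copy k
    carrying the weights [d k].  When the moments of order below t vanish on each
    copy, a kernel of lower order does not see the other copies and is simply
    rescaled.  Order t is obtained by integrating the identity for the order
    before with [prim_block], and the moments of order t enter as the integrals
    over whole blocks. *)
Lemma rkersum_block t : (forall s k, (s < t)%N -> rmoment x (d k) s = 0) ->
  rmoment X D t = b%:R ^- t * \sum_k rmoment x (d k) t /\
  forall (k : 'I_b) y, U y -> rkersum X D t ((k%:R + y) / b%:R) =
    (k%:R + y) / b%:R * rmoment X D t -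
    b%:R ^- t * (\sum_(z < b | (z < k)%N) rmoment x (d z) t + y * rmoment x (d k) t
                 - rkersum x (d k) t y).
Proof.
have bR : 0 < b%:R :> R by rewrite ltr0n.
elim: t => [|t IH] h.
  split.
    rewrite expr0 invr1 mul1r /= [RHS](pair_big xpredT xpredT (fun k i => d k i * 1)) /=.
    by apply: eq_bigr.
  move=> k y Uy; rewrite expr0 invr1 mul1r /=; move: (Uy); rewrite unit_itvE => /andP[y0 y1].
  set Y := _ / _.
  transitivity (\sum_(p : 'I_b * I) (Y * (D p * 1) - D p * (X p < Y)%R%:R)).
    by apply: eq_bigr => p _; ring.
  rewrite sumrB -mulr_sumr; congr (_ - _).
  transitivity (\sum_(z < b) \sum_i d z i * (((z < k)%N : nat)%:R + (z == k)%:R * (x i < y)%R%:R)).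
    rewrite [RHS](pair_big xpredT xpredT (fun (z : 'I_b) i => d z i * (((z < k)%N : nat)%:R + (z == k)%:R * (x i < y)%R%:R))) /=.
    apply: eq_bigr => -[z i] _; rewrite /D /X /Y /= ltr_pM2r ?invr_gt0//; congr (_ * _).
    move: (xU i); rewrite unit_itvE => /andP[x0 x1].
    have [zk|zk|/val_inj zk] := ltngtP z k.
    - have : (z.+1%:R <= k%:R :> R) by rewrite ler_nat.
      rewrite -natr1 => h1; have -> : z%:R + x i < k%:R + y by lra.
      by rewrite (_ : z == k = false) ?mul0r ?addr0//; apply/eqP => e; rewrite e ltnn in zk.
    - have : (k.+1%:R <= z%:R :> R) by rewrite ler_nat.
      rewrite -natr1 => h1; have -> : (z%:R + x i < k%:R + y) = false by apply/negP; lra.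
      by rewrite (_ : z == k = false) ?mul0r ?addr0//; apply/eqP => e; rewrite e ltnn in zk.
    - by rewrite zk eqxx ltrD2l mul1r add0r.
  transitivity (\sum_(z < b) ((if (z < k)%N then \sum_i d z i * 1 else 0) +
      if z == k then \sum_i d z i * (x i < y)%R%:R else 0)).
    apply: eq_bigr => z _; have [zk|zk] := boolP (z < k)%N.
      have -> : z == k = false by apply/eqP => e; rewrite e ltnn in zk.
      by rewrite addr0; apply: eq_bigr => i _; rewrite mul0r addr0.
    case: eqP => [_|_]; rewrite add0r.
      by apply: eq_bigr => i _; rewrite add0r mul1r.
    by rewrite big1// => i _; rewrite mul0r addr0 mulr0.
  rewrite big_split /= -big_mkcond -big_mkcond big_pred1_eq -addrA; congr (_ + _).
  rewrite mulr_sumr -sumrB; apply: eq_bigr => i _; ring.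
have {IH}[IHm IHk] := IH (fun s k st => h s k (ltn_trans st (ltnSn t))).
have mt k : rmoment x (d k) t = 0 := h t k (ltnSn t).
have MD : rmoment X D t = 0 by rewrite IHm big1 ?mulr0.
have Wt (k : 'I_b) y : U y -> rkersum X D t ((k%:R + y) / b%:R) = b%:R ^- t * rkersum x (d k) t y.
  by move=> Uy; rewrite IHk// MD mt big1 ?mulr0 ?add0r ?sub0r ?mulrN ?opprK.
have bt : b%:R ^- t.+1 = b%:R^-1 * b%:R ^- t :> R by rewrite exprS invfM.
have mb (k : 'I_b) : mean (fun z => rkersum X D t ((k%:R + z) / b%:R)) =
    b%:R ^- t * rmoment x (d k) t.+1.
  by rewrite (eq_mean (Wt k)) meanZ ?mean_rkersum//; exact: int_rkersum.
have Mm : rmoment X D t.+1 = b%:R ^- t.+1 * \sum_k rmoment x (d k) t.+1.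
  rewrite -mean_rkersum (mean_block b0 (int_rkersum _ _ _)) bt -mulrA; congr (_ * _).
  by rewrite mulr_sumr; apply: eq_bigr => k _.
split=> // k y Uy; have UY := affine_unit_itv (ltn_ord k) Uy.
rewrite rkersumS// /tprim mean_rkersum (prim_block (ltn_ord k) (int_rkersum _ _ _) Uy).
congr (_ - _); rewrite bt -[RHS]mulrA; congr (_ * _); rewrite -addrA mulrDr.
rewrite (big_ord_widen b (fun j => mean (fun z => rkersum X D t ((j%:R + z) / b%:R))) (ltnW (ltn_ord k))).
congr (_ + _); first by rewrite mulr_sumr; apply: eq_bigr => z _.
transitivity (prim (fun z => b%:R ^- t * rkersum x (d k) t z) y); first by apply: eq_prim => // z Uz; exact: Wt.
rewrite -prim_rkersum//.
rewrite /prim RintegralZl//; apply: int_subitv => //; exact: int_rkersum.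
Qed.


End RealBlocks.
End WeightedKernelSums.

Section Components.
Variable R : rcfType.
Implicit Types z w : R[i].

Lemma complex_ext z w : re z = re w -> im z = im w -> z = w.
Proof. by case: z w => a c [a' c'] /= -> ->. Qed.

Lemma re_sum (I : Type) (r : seq I) (P : pred I) (F : I -> R[i]) :
  re (\sum_(i <- r | P i) F i) = \sum_(i <- r | P i) re (F i).
Proof. by apply: (big_morph (@complex.Re R)) => // -[a c] [a' c']. Qed.

Lemma im_sum (I : Type) (r : seq I) (P : pred I) (F : I -> R[i]) :
  im (\sum_(i <- r | P i) F i) = \sum_(i <- r | P i) im (F i).
Proof. by apply: (big_morph (@complex.Im R)) => // -[a c] [a' c']. Qed.

Lemma reZ (a : R) z : re (a%:C * z) = a * re z.
Proof. by case: z => c d /=; rewrite mul0r subr0. Qed.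

Lemma imZ (a : R) z : im (a%:C * z) = a * im z.
Proof. by case: z => c d /=; rewrite mul0r addr0. Qed.

Lemma reZr (a : R) z : re (z * a%:C) = re z * a.
Proof. by rewrite mulrC reZ mulrC. Qed.

Lemma imZr (a : R) z : im (z * a%:C) = im z * a.
Proof. by rewrite mulrC imZ mulrC. Qed.

Lemma reD z w : re (z + w) = re z + re w. Proof. by case: z w => ? ? []. Qed.
Lemma imD z w : im (z + w) = im z + im w. Proof. by case: z w => ? ? []. Qed.
Lemma reN z : re (- z) = - re z. Proof. by case: z. Qed.
Lemma imN z : im (- z) = - im z. Proof. by case: z. Qed.
End Components.

Section ComplexKernelSums.
Variable R : realType.
Local Notation U := (@unit_itv R).
Local Notation rkersum x d t y := (\sum_i d i * ker t (x i) y).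
Local Notation rmoment x d t := (\sum_i d i * bern t (x i)).

Section Basic.
Variables (I : finType) (x : I -> R).
Implicit Types c : I -> R[i].

Lemma re_kersum c t y : re (kersum x c t y) = rkersum x (fun i => re (c i)) t y.
Proof. by rewrite re_sum; apply: eq_bigr => i _; rewrite reZr. Qed.

Lemma im_kersum c t y : im (kersum x c t y) = rkersum x (fun i => im (c i)) t y.
Proof. by rewrite im_sum; apply: eq_bigr => i _; rewrite imZr. Qed.

Lemma re_moment c t : re (moment x c t) = rmoment x (fun i => re (c i)) t.
Proof. by rewrite re_sum; apply: eq_bigr => i _; rewrite reZr. Qed.

Lemma im_moment c t : im (moment x c t) = rmoment x (fun i => im (c i)) t.
Proof. by rewrite im_sum; apply: eq_bigr => i _; rewrite imZr. Qed.

Lemma kersumZ a c t y : kersum x (fun i => a * c i) t y = a * kersum x c t y.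
Proof. by rewrite mulr_sumr; apply: eq_bigr => i _; rewrite mulrA. Qed.

Lemma momentZ a c t : moment x (fun i => a * c i) t = a * moment x c t.
Proof. by rewrite mulr_sumr; apply: eq_bigr => i _; rewrite mulrA. Qed.

(** Raising the order applies [tprim], which does not see the mean and halves
    the sup norm. *)
Lemma le_kersumS c t G y :
  (forall z, U z -> normc (kersum x c t z - moment x c t.+1) <= G) -> U y ->
  normc (kersum x c t.+1 y) <= G / 2.
Proof.
move=> h Uy; apply: normc_le_rot => u u1; rewrite -kersumZ re_kersum.
apply: le_trans (ler_norm _) _; rewrite rkersumS//.
rewrite -(tprim_shift (rmoment x (fun i => re (u * c i)) t.+1) (int_rkersum _ _ _) Uy).
apply: le_tprim => // [|z Uz].
  have := int_rkersum x (fun i => re (u * c i)) t => ik.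
  have ic : lebesgue_measure.-integrable U (EFin \o (fun=> - rmoment x (fun i => re (u * c i)) t.+1)).
    by apply: bdd_int; exact: bdd_meas_cst.
  exact: (intD ik ic).
have := normr_Re_le (u * (kersum x c t z - moment x c t.+1)).
rewrite normcM u1 mul1r mulrBr -kersumZ -momentZ reD reN re_kersum re_moment => /le_trans; apply.
exact: h.
Qed.

Lemma le_kersumS_half c t G y :
  (forall z, U z -> normc (kersum x c t z) <= G) -> U y ->
  normc (kersum x c t.+1 y) <= G / 2.
Proof.
move=> h Uy; apply: normc_le_rot => u u1; rewrite -kersumZ re_kersum.
apply: le_trans (ler_norm _) _; rewrite rkersumS//.
apply: le_tprim => // [|z Uz]; first exact: int_rkersum.
rewrite -(re_kersum (fun i => u * c i)) kersumZ.
by apply: le_trans (normr_Re_le _) _; rewrite normcM u1 mul1r h.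
Qed.

Lemma le_moment c t G :
  (forall z, U z -> normc (kersum x c t z) <= G) -> normc (moment x c t.+1) <= G.
Proof.
move=> h; apply: normc_le_rot => u u1; rewrite -momentZ re_moment -mean_rkersum.
apply: le_trans (ler_norm _) _; apply: le_mean => [|z Uz]; first exact: int_rkersum.
rewrite -(re_kersum (fun i => u * c i)) kersumZ.
by apply: le_trans (normr_Re_le _) _; rewrite normcM u1 mul1r h.
Qed.
End Basic.

Lemma unit_itv_block (b : nat) (y : R) : (0 < b)%N -> U y ->
  exists (k : 'I_b) z, U z /\ y = (k%:R + z) / b%:R.
Proof.
move=> b0 Uy; have bR : 0 < b%:R :> R by rewrite ltr0n.
move: Uy; rewrite unit_itvE => /andP[y0 y1].
have yb0 : 0 <= y * b%:R by rewrite mulr_ge0// ltW.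
have /andP[h1 h2] := truncn_itv yb0.
have kb : (Num.truncn (y * b%:R) < b)%N.
  by rewrite -(ltr_nat R) (le_lt_trans h1)// gtr_pMl.
exists (Ordinal kb), (y * b%:R - (Num.truncn (y * b%:R))%:R); split.
  by rewrite unit_itvE subr_ge0 h1 ltrBlDl natr1.
by rewrite addrC subrK mulfK// gt_eqF.
Qed.

Section Blocks.
Variables (I : finType) (x : I -> R) (b : nat).
Hypotheses (b0 : (0 < b)%N) (xU : forall i, U (x i)).
Variable d : 'I_b -> I -> R[i].

Let X (p : 'I_b * I) : R := (p.1%:R + x p.2) / b%:R.
Let D (p : 'I_b * I) : R[i] := d p.1 p.2.

Lemma kersum_block t : (forall s k, (s < t)%N -> moment x (d k) s = 0) ->
  moment X D t = (b%:R ^- t)%:C * \sum_k moment x (d k) t /\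
  forall (k : 'I_b) y, U y -> kersum X D t ((k%:R + y) / b%:R) =
    ((k%:R + y) / b%:R)%:C * moment X D t -
    (b%:R ^- t)%:C * (\sum_(z < b | (z < k)%N) moment x (d z) t + y%:C * moment x (d k) t
                 - kersum x (d k) t y).
Proof.
move=> h.
have [|rm rk] := @rkersum_block R I x b b0 xU (fun k i => re (d k i)) t.
  by move=> s k st; rewrite -re_moment h.
have [|jm jk] := @rkersum_block R I x b b0 xU (fun k i => im (d k i)) t.
  by move=> s k st; rewrite -im_moment h.
split=> [|k y Uy]; apply: complex_ext.
- rewrite re_moment reZ re_sum rm; congr (_ * _).
  by apply: eq_bigr => k _; rewrite re_moment.
- rewrite im_moment imZ im_sum jm; congr (_ * _).
  by apply: eq_bigr => k _; rewrite im_moment.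
- rewrite re_kersum rk// !(reD, reN, reZ) !re_moment re_kersum re_sum.
  by congr (_ - _ * (_ + _ - _)); apply: eq_bigr => z _; rewrite re_moment.
- rewrite im_kersum jk// !(imD, imN, imZ) !im_moment im_kersum im_sum.
  by congr (_ - _ * (_ + _ - _)); apply: eq_bigr => z _; rewrite im_moment.
Qed.

(** A moment is the mean of the kernel sum of the order before, and the mean
    over the unit interval can be taken by averaging over the blocks first. *)
Lemma moment_block_avg t (A : R[i]) :
  (forall y, U y -> \sum_(k < b) kersum X D t ((k%:R + y) / b%:R) = b%:R%:C * A) ->
  moment X D t.+1 = A.
Proof.
move=> h; have bR : b%:R != 0 :> R by rewrite pnatr_eq0 -lt0n.
have key (e : 'I_b * I -> R) (a : R) :
    (forall y, U y -> \sum_(k < b) rkersum X e t ((k%:R + y) / b%:R) = b%:R * a) ->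
    rmoment X e t.+1 = a.
  move=> he; rewrite -mean_rkersum (mean_block b0 (int_rkersum _ _ _)).
  have ie := int_rkersum X e t.
  rewrite -[RHS](mulKf bR) -(mean_cst (b%:R * a)) -(eq_mean he); congr (_ * _).
  rewrite /mean Rintegral_sum//; first exact: measurable_unit_itv.
  move=> k; have bk : bdd_meas U (fun z => rkersum X e t ((k%:R + z) / b%:R)).
    have [mw [M hM]] : bdd_meas U (fun y => rkersum X e t y).
      apply: bdd_meas_sum => i _; apply: bdd_measM; [exact: bdd_meas_cst|exact: bdd_ker].
    split; last by exists M => z Uz; apply: hM; exact: (affine_unit_itv (ltn_ord k) Uz).
    have := @measurable_comp _ _ _ _ _ _ U (fun y => rkersum X e t y) U
      (affine b%:R k%:R) (@measurable_unit_itv R); apply => //.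
    - by move=> _ [z Uz <-]; exact: (affine_unit_itv (ltn_ord k) Uz).
    - exact: measurable_funTS (measurable_affine _ _).
  exact: bdd_int.
apply: complex_ext.
  rewrite re_moment; apply: key => y Uy.
  by rewrite -reZ -(h y Uy) re_sum; apply: eq_bigr => k _; rewrite re_kersum.
rewrite im_moment; apply: key => y Uy.
by rewrite -imZ -(h y Uy) im_sum; apply: eq_bigr => k _; rewrite im_kersum.
Qed.
End Blocks.
End ComplexKernelSums.

(** * Additive characters of the prime field *)

Section RootsOfUnity.
Variables (R : realType) (b : nat).
Hypothesis pb : prime b.

Definition omega : R[i] := cos (2 * pi / b%:R) +i* sin (2 * pi / b%:R).
Definition chi (a : 'F_b) : R[i] := omega ^+ a.
(** The least distance of 1 from another b-th root of unity; see [le_chord]. *)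
Definition chord : R := 2 * sin (pi / b%:R).

Let b_gt0 : 0 < b%:R :> R. Proof. by rewrite ltr0n prime_gt0. Qed.
Let b_neq0 : b%:R != 0 :> R. Proof. by rewrite gt_eqF. Qed.
Let b_ge2 : 2 <= b%:R :> R. Proof. by rewrite ler_nat prime_gt1. Qed.

Lemma omegaX k : omega ^+ k = cos (2 * pi / b%:R *+ k) +i* sin (2 * pi / b%:R *+ k).
Proof.
rewrite /omega; move: (2 * pi / b%:R) => t.
elim: k => [|k IH]; first by rewrite mulr0n cos0 sin0.
rewrite exprSr IH mulrSr cosD sinD.
by apply: complex_ext => /=; ring.
Qed.

Lemma omegaXb : omega ^+ b = 1.
Proof.
rewrite omegaX -mulr_natr -mulrA mulVf// mulr1 mulr_natl cos2pi sin2pi.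
by apply: complex_ext.
Qed.

Lemma omegaXF : omega ^+ (Zp_trunc (pdiv b)).+2 = 1.
Proof. by rewrite Fp_cast// omegaXb. Qed.

Lemma chi0 : chi 0 = 1. Proof. by rewrite /chi expr0. Qed.

Lemma chiD a c : chi (a + c) = chi a * chi c.
Proof.
by rewrite /chi -exprD expr_mod// omegaXF.
Qed.

Lemma chiM a c : chi (a * c) = chi a ^+ c.
Proof.
by rewrite /chi -exprM expr_mod// omegaXF.
Qed.

Lemma normc_chi a : normc (chi a) = 1.
Proof. by rewrite /chi omegaX /= cos2Dsin2 sqrtr1. Qed.

Lemma chord_gt0 : 0 < chord.
Proof.
rewrite mulr_gt0// sin_gt0_pi// divr_gt0 ?pi_gt0//= ltr_pdivrMr// ltr_pMr ?pi_gt0//.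
by move: b_ge2; lra.
Qed.

Lemma chord_le2 : chord <= 2.
Proof. by rewrite /chord ler_piMr// sin_le1. Qed.

(** The sine increases up to pi / 2 and is symmetric about it. *)
Lemma sin_ge_chord (k : nat) : (0 < k < b)%N -> sin (pi / b%:R) <= sin (pi / b%:R * k%:R) :> R.
Proof.
move=> /andP[k0 kb].
have p0 := pi_gt0 R; set t := pi / b%:R.
have t0 : 0 < t by rewrite divr_gt0.
have tb : t * b%:R = pi by rewrite /t divfK.
have t2 : t <= pi / 2 by rewrite /t ler_pM2l// lef_pV2 ?posrE.
have mono x y : 0 <= x -> x <= y -> y <= pi / 2 -> sin x <= sin y.
  move=> x0 xy y2; rewrite le_eqVlt; have [->|nxy] := eqVneq x y; first by rewrite eqxx.
  have -> : (sin x < sin y) = (x < y).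
    by apply: ltr_sin; rewrite in_itv /=; apply/andP; split; lra.
  by rewrite lt_neqAle nxy xy orbT.
have k1 : 1 <= k%:R :> R by rewrite ler1n.
have k2 : k%:R + 1 <= b%:R :> R by rewrite natr1 ler_nat.
have tk : t * k%:R + t <= pi by rewrite -tb -[X in _ + X]mulr1 -mulrDr ler_pM2l.
have tk' : t <= t * k%:R by rewrite ler_peMr// ltW.
have [h|h] := lerP (t * k%:R) (pi / 2).
  by apply: mono => //; exact: ltW.
have -> : sin (t * k%:R) = sin (pi - t * k%:R).
  by rewrite addrC sinDpi sinN opprK.
by apply: mono; lra.
Qed.

Lemma le_chord (a : 'F_b) : a != 0 -> chord <= normc (1 - chi a).
Proof.
move=> a0; have ab : (0 < a < b)%N.
  rewrite lt0n; apply/andP; split.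
    by apply: contra a0 => /eqP e; apply/eqP/val_inj.
  by have := ltn_ord a; rewrite {2}Fp_cast.
have := sin_ge_chord ab; set t := pi / b%:R * _ => ht.
have -> : normc (1 - chi a) = 2 * sin t.
  rewrite /chi omegaX /= sub0r sqrrN.
  have -> : 2 * pi / b%:R *+ a = t *+ 2 by rewrite -mulr_natr -[RHS]mulr_natr /t; ring.
  have e : (1 - cos (t *+ 2)) ^+ 2 + sin (t *+ 2) ^+ 2 = (2 * sin t) ^+ 2.
    rewrite cos_mulr2n sin_mulr2n.
    have -> : ((cos t * sin t) *+ 2) ^+ 2 = 4 * cos t ^+ 2 * sin t ^+ 2 by ring.
    rewrite cos2sin2; ring.
  rewrite e sqrtr_sqr ger0_norm// mulr_ge0//.
  by apply: le_trans ht; have := chord_gt0; rewrite /chord; lra.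
by rewrite /chord ler_pM2l.
Qed.

Lemma chi_neq1 (a : 'F_b) : a != 0 -> chi a != 1.
Proof.
move=> /le_chord; apply: contraTN => /eqP ->; rewrite subrr normc0 -ltNge; exact: chord_gt0.
Qed.

(** A translation of the group by an element on which the character is not 1
    multiplies the sum by that value, so the sum is zero. *)
Lemma sum_chi (V : finZmodType) (f : V -> 'F_b) : {morph f : u v / u + v} ->
  \sum_v chi (f v) = (if [forall v, f v == 0] then #|V|%:R else 0).
Proof.
move=> fD; case: ifPn => [/forallP h|].
  rewrite (eq_bigr (fun=> 1)) ?sumr_const// => v _.
  by rewrite (eqP (h v)) chi0.
rewrite negb_forall => /existsP[w /chi_neq1 fw].
set T := \sum_v _; have : chi (f w) * T = T.
  rewrite /T mulr_sumr [RHS](reindex_inj (addrI w)); apply: eq_bigr => v _.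
  by rewrite fD chiD.
move/eqP; rewrite -subr_eq0 -[X in _ - X]mul1r -mulrBl mulf_eq0 subr_eq0 (negbTE fw).
by move/eqP.
Qed.

Lemma sum_chi_mul (k : 'F_b) : k != 0 -> \sum_a chi (k * a) = 0.
Proof.
move=> k0; rewrite (sum_chi (mulrDr k)); case: forallP => // /(_ 1).
by rewrite mulr1 (negbTE k0).
Qed.

End RootsOfUnity.

(** * Walsh coefficients of the kernels on the b-adic grid *)

(** Vectors of n digits.  The recursive type makes a vector of n + 1 digits a
    pair, so that recursion on the number of digits is recursion on blocks of the
    grid. *)
Fixpoint dig (b n : nat) : finType :=
  if n is n'.+1 then (('F_b * dig b n')%type : finType) else (unit : finType).

Lemma sum_unit (V : nmodType) (F : unit -> V) : \sum_i F i = F tt.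
Proof. by rewrite (bigD1 tt) //= big1 ?addr0 // => -[]. Qed.

Section Digits.
Variable b : nat.

Fixpoint dot n : dig b n -> dig b n -> 'F_b :=
  if n is n'.+1 return dig b n -> dig b n -> 'F_b
  then fun k i => k.1 * i.1 + dot k.2 i.2 else fun _ _ => 0.

Fixpoint nzd n : dig b n -> nat :=
  if n is n'.+1 return dig b n -> nat
  then fun k => ((k.1 != 0%R) + nzd k.2)%N else fun _ => 0%N.

(** Dick's weight mu_t: the sum of the positions of the t most significant
    nonzero digits, the first component being the least significant.  The
    recursion sums, over the positions, the number of nonzero digits from that
    position on, capped at t. *)
Fixpoint wt (t : nat) n : dig b n -> nat :=
  if n is n'.+1 return dig b n -> nat
  then fun k => (wt t k.2 + minn t ((k.1 != 0%R) + nzd k.2))%N else fun _ => 0%N.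

Lemma wt_sat n t (k : dig b n) : (nzd k <= t)%N -> wt t k = wt (nzd k) k.
Proof.
elim: n t k => [//|n IH] t [k1 k2] /= h.
rewrite (IH t) ?(leq_trans (leq_addl _ _) h)// (IH (_ + _)%N) ?leq_addl//.
by rewrite (minn_idPr h) minnn.
Qed.

End Digits.

Section Grid.
Variables (R : realType) (b : nat).
Hypothesis pb : prime b.
Local Notation U := (@unit_itv R).
Local Notation chi := (@chi R b).
Local Notation S := (chord R b).

Fixpoint pt n : dig b n -> R :=
  if n is n'.+1 return dig b n -> R
  then fun i => (i.1%:R + pt i.2) / b%:R else fun _ => 0.

(** Normalised so that summing against it over the grid is taking a mean. *)
Definition walsh n (k i : dig b n) : R[i] := (b%:R ^- n)%:C * chi (dot k i).

Let b0 : (0 < b)%N. Proof. exact: prime_gt0. Qed.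
Let bR : 0 < b%:R :> R. Proof. by rewrite ltr0n. Qed.
Let bn0 : b%:R != 0 :> R. Proof. by rewrite gt_eqF. Qed.
Let P := (Zp_trunc (pdiv b)).+2.
Let PE : P%:R = b%:R :> R. Proof. by rewrite /P Fp_cast. Qed.

Lemma pt_unit n (i : dig b n) : U (pt i).
Proof.
elim: n i => [i|n IH [i1 i2]] /=; first by rewrite unit_itvE lexx ltr01.
by rewrite -PE; apply: affine_unit_itv (ltn_ord i1) _ _; exact: IH.
Qed.

Section Step.
Variables (n : nat) (k : 'F_b) (k' : dig b n).
Let kk : dig b n.+1 := (k, k').
Local Notation m := (moment (@pt n.+1) (walsh kk)).
Local Notation W := (kersum (@pt n.+1) (walsh kk)).
Local Notation m' := (moment (@pt n) (walsh k')).
Local Notation W' := (kersum (@pt n) (walsh k')).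

Let d (z : 'I_P) (i : dig b n) : R[i] := ((b%:R^-1)%:C * chi (k * z)) * walsh k' i.
Let X (p : 'I_P * dig b n) : R := (p.1%:R + pt p.2) / P%:R.
Let D (p : 'I_P * dig b n) : R[i] := d p.1 p.2.

Let DE : walsh kk = D.
Proof.
apply/funext => -[z i]; rewrite /walsh /= /D /d /= /walsh chiD//.
rewrite exprS invfM rmorphM /=; ring.
Qed.

Let XE : @pt n.+1 = X.
Proof. by apply/funext => -[z i]; rewrite /X PE. Qed.

(** [rkersum_block] for Walsh weights: the copy with first digit z carries the
    weights of the remaining digits multiplied by [chi (k * z)]. *)
Lemma digit_block t : (forall s, (s < t)%N -> m' s = 0) ->
  m t = (b%:R ^- t.+1)%:C * (\sum_a chi (k * a)) * m' t /\
  forall (a : 'F_b) y, U y -> W t ((a%:R + y) / b%:R) = ((a%:R + y) / b%:R)%:C * m t -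
    (b%:R ^- t.+1)%:C * ((\sum_(z : 'F_b | (z < a)%N) chi (k * z)) * m' t
       + y%:C * chi (k * a) * m' t - chi (k * a) * W' t y).
Proof.
move=> h; have h' s (z : 'I_P) : (s < t)%N -> moment (@pt n) (d z) s = 0.
  by move=> st; rewrite /d momentZ h// mulr0.
have [||E1 E2] := @kersum_block R (dig b n) (@pt n) P _ _ d t h'.
- by [].
- exact: pt_unit.
have bt : (b%:R ^- t.+1)%:C = (b%:R ^- t)%:C * (b%:R^-1)%:C :> R[i].
  by rewrite -rmorphM /= exprS invfM mulrC.
split=> [|a y Uy]; rewrite DE XE.
  rewrite -/X -/D E1 PE bt -!mulrA; congr (_ * _).
  by rewrite mulr_suml mulr_sumr; apply: eq_bigr => z _; rewrite momentZ mulrA.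
rewrite -[X in (_ + _) / X]PE E2// PE; congr (_ - _); first by rewrite /X PE.
rewrite bt -[RHS]mulrA; congr (_ * _).
rewrite !mulrDr mulrN; congr (_ + _ - _).
- rewrite mulr_suml mulr_sumr; apply: eq_bigr => z _; rewrite momentZ; ring.
- rewrite momentZ; ring.
- rewrite kersumZ; ring.
Qed.

Lemma moment_digit_avg t (A : R[i]) :
  (forall y, U y -> \sum_(a : 'F_b) W t ((a%:R + y) / b%:R) = b%:R%:C * A) ->
  m t.+1 = A.
Proof.
move=> h; rewrite DE XE; apply: (@moment_block_avg R (dig b n) (@pt n) P _ d) => //.
move=> y Uy; rewrite PE -(h y Uy); apply: eq_bigr => a _; by rewrite DE XE /X PE.
Qed.

End Step.

Lemma unit_itv_digit y : U y -> exists (a : 'F_b) z, U z /\ y = (a%:R + z) / b%:R.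
Proof.
by move=> Uy; have [a [z [Uz ->]]] := @unit_itv_block R P y isT Uy; exists a, z; rewrite PE.
Qed.

Lemma partial_sum_chi (k a : 'F_b) : k != 0 ->
  \sum_(z : 'F_b | (z < a)%N) chi (k * z) = (1 - chi (k * a)) / (1 - chi k).
Proof.
move=> k0; have n0 : 1 - chi k != 0 by rewrite subr_eq0 eq_sym chi_neq1.
rewrite (eq_bigr (fun z : 'F_b => chi k ^+ z)); last by move=> z _; rewrite chiM.
rewrite chiM// -(big_ord_widen P (fun z => chi k ^+ z) (ltnW (ltn_ord a))).
by apply: (mulIf n0); rewrite divfK// -[LHS]opprK -mulrN opprB mulrC -subrX1 opprB.
Qed.

(** Bounds the top kernel sum in units of [wt_bound].  A nonzero digit turns the bound
    x into 1 + S x for the oscillation about the mean, and the next integration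
    halves it. *)
Fixpoint osc (v : nat) : R := if v is v'.+1 then (1 + S * osc v') / 2 else 1.

Lemma osc_ge0 v : 0 <= osc v.
Proof.
elim: v => //= v IH; have S0 := ltW (chord_gt0 R pb).
by rewrite divr_ge0// addr_ge0// mulr_ge0.
Qed.

Definition wt_bound t n (k : dig b n) : R := b%:R ^- wt t k * S ^- t.

(** With v nonzero digits, the moments of order below v vanish, the moment of
    order v and the kernel sums up to order v are governed by the weights [wt].
    For v = 0 the kernel sum of order 0 is the discrepancy of the grid, whence the
    last field. *)
Record walsh_bounds n (k : dig b n) : Prop := WalshBounds {
  wb0 : forall s, (s < nzd k)%N -> moment (@pt n) (walsh k) s = 0;
  wb1 : normc (moment (@pt n) (walsh k) (nzd k)) <= wt_bound (nzd k) k;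
  wb2 : forall t y, (t < nzd k)%N -> U y ->
    normc (kersum (@pt n) (walsh k) t y) <= (1 + 2 * osc t.+1) * wt_bound t.+1 k;
  wb3 : forall y, U y -> normc (kersum (@pt n) (walsh k) (nzd k) y) <= osc (nzd k) * wt_bound (nzd k) k;
  wb4 : nzd k = 0%N -> forall y, U y -> normc (kersum (@pt n) (walsh k) 0 y) <= b%:R ^- n
}.

Lemma walsh_bounds0 (k : dig b 0) : walsh_bounds k.
Proof.
have bd1 : wt_bound 0 k = 1 by rewrite /wt_bound /= !expr0 invr1 mulr1.
have w1 i : walsh k i = 1 by rewrite /walsh /= chi0 expr0 invr1 mulr1.
have kb y : U y -> normc (kersum (@pt 0) (walsh k) 0 y) <= 1.
  rewrite unit_itvE => /andP[y0 y1]; rewrite /kersum (sum_unit (V := R[i])) w1 mul1r normc_real /=.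
  rewrite ler_norml; case: (_ < _) => /=; lra.
split => //=; rewrite ?bd1 ?expr0 ?invr1 ?mulr1//.
by rewrite /moment (sum_unit (V := R[i])) w1 mul1r normc_real normr1.
Qed.

(** All copies of the smaller grid carry the same weights, so that the
    moments and kernel sums of order at most v are only rescaled. *)
Lemma walsh_bounds_zero n (k' : dig b n) : walsh_bounds k' ->
  walsh_bounds ((0, k') : dig b n.+1).
Proof.
case=> h0 h1 h2 h3 h4; set v := nzd k' in h0 h1 h2 h3 h4.
have nzE : nzd ((0, k') : dig b n.+1) = v by rewrite /= ?eqxx.
have wE t : (t <= v)%N -> wt t ((0, k') : dig b n.+1) = (wt t k' + t)%N.
  by move=> tv; rewrite /= ?eqxx ?add0n (minn_idPl tv).
have BE t : (t <= v)%N -> wt_bound t ((0, k') : dig b n.+1) = b%:R ^- t * wt_bound t k'.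
  by move=> tv; rewrite /wt_bound wE// exprD invfM; ring.
have sumb : \sum_a chi (0 * a) = b%:R%:C :> R[i].
  rewrite (eq_bigr (fun=> 1)); last by move=> a _; rewrite mul0r chi0.
  by rewrite sumr_const card_Fp// rmorph_nat.
have bS t : (b%:R ^- t.+1)%:C * b%:R%:C = (b%:R ^- t)%:C :> R[i].
  by rewrite -rmorphM /= exprS invfM mulrAC mulVf// mul1r.
have mE t : (t <= v)%N -> moment (@pt n.+1) (walsh ((0, k') : dig b n.+1)) t =
    (b%:R ^- t)%:C * moment (@pt n) (walsh k') t.
  move=> tv; have [|-> _] := @digit_block n 0 k' t.
    by move=> s st; apply: h0; exact: leq_trans tv.
  by rewrite sumb bS.
have WE t a y : (t <= v)%N -> U y ->
    kersum (@pt n.+1) (walsh ((0, k') : dig b n.+1)) t (((a : 'F_b)%:R + y) / b%:R) =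
    (b%:R ^- t.+1)%:C * kersum (@pt n) (walsh k') t y.
  move=> tv Uy; have [|_ ->//] := @digit_block n 0 k' t.
    by move=> s st; apply: h0; exact: leq_trans tv.
  rewrite mE// mul0r chi0 (eq_bigr (fun=> 1)); last by move=> z _; rewrite mul0r chi0.
  rewrite -(big_ord_widen P (fun z => 1) (ltnW (ltn_ord a))) sumr_const card_ord.
  rewrite -(rmorph_nat (real_complex R)) -bS !rmorphM /= !rmorphD /=; move: (b%:R ^- t.+1)%:C => B.
  have : b%:R%:C * (b%:R^-1)%:C = 1 :> R[i] by rewrite -rmorphM /= divff// rmorph1.
  move: b%:R%:C (b%:R^-1)%:C (a%:R)%:C y%:C (moment _ _ _) (kersum _ _ _ _) => c ci ac yc M K cci.
  rewrite mulr1 mul1r.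
  have -> : (ac + yc) * ci * (B * c * M) = (c * ci) * (ac + yc) * B * M by ring.
  rewrite cci; ring.
have nb t (z : R[i]) : normc ((b%:R ^- t)%:C * z) = b%:R ^- t * normc z.
  by rewrite normcM normc_real ger0_norm// invr_ge0 exprn_ge0// ler0n.
split; rewrite nzE.
- by move=> s sv; rewrite mE ?(ltnW sv)// h0// mulr0.
- by rewrite mE// nb BE// ler_wpM2l// invr_ge0 exprn_ge0// ler0n.
- move=> t y tv /unit_itv_digit[a [z [Uz ->]]]; rewrite WE ?(ltnW tv)// nb BE// mulrCA.
  by rewrite ler_wpM2l ?h2// invr_ge0 exprn_ge0// ler0n.
- move=> y /unit_itv_digit[a [z [Uz ->]]]; rewrite WE// nb BE//.
  rewrite exprS invfM -mulrA; apply: (@le_trans _ _ (b%:R ^- v * normc (kersum (@pt n) (walsh k') v z))).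
    rewrite ler_piMl// ?mulr_ge0// ?invr_ge0 ?exprn_ge0 ?ler0n ?normc_ge0//.
    by rewrite invf_le1// ler1n.
  by rewrite mulrCA ler_wpM2l ?h3// invr_ge0 exprn_ge0// ler0n.
- move=> v0 y /unit_itv_digit[a [z [Uz ->]]]; rewrite WE ?v0// nb expr1 exprS invfM.
  by rewrite ler_wpM2l ?h4// invr_ge0 ler0n.
Qed.

(** The values of the character of a nonzero digit sum to zero, which kills the
    moment of order v = nzd k' of the smaller grid.  On the copy a the kernel sum
    of order v is a constant A plus a term G proportional to [chi (k * a)].  The
    latter averages to zero over the copies, so that A is the moment of order
    v + 1 and G is the oscillation about it. *)
Lemma walsh_bounds_nonzero n (k : 'F_b) (k' : dig b n) : k != 0 -> walsh_bounds k' ->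
  walsh_bounds ((k, k') : dig b n.+1).
Proof.
move=> k0 [h0 h1 h2 h3 _]; set v := nzd k' in h0 h1 h2 h3.
set kk : dig b n.+1 := (k, k').
have S0 := chord_gt0 R pb.
have nzE : nzd kk = v.+1 by rewrite /= k0.
have wE t : (t <= v.+1)%N -> wt t kk = (wt t k' + t)%N.
  by move=> tv; rewrite /= k0 add1n (minn_idPl tv).
have BE t : (t <= v.+1)%N -> wt_bound t kk = b%:R ^- t * wt_bound t k'.
  by move=> tv; rewrite /wt_bound wE// exprD invfM; ring.
have BvE : wt_bound v.+1 kk = b%:R ^- v.+1 * (wt_bound v k' / S).
  rewrite BE// /wt_bound (@wt_sat b n v.+1) ?leqnSn// -/v (exprS S) (invfM S); ring.
have mE t : (t <= v)%N -> moment (@pt n.+1) (walsh kk) t = 0.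
  move=> tv; have [|-> _] := @digit_block n k k' t.
    by move=> s st; apply: h0; exact: leq_trans tv.
  by rewrite sum_chi_mul// mulr0 mul0r.
have nb t (z : R[i]) : normc ((b%:R ^- t)%:C * z) = b%:R ^- t * normc z.
  by rewrite normcM normc_real ger0_norm// invr_ge0 exprn_ge0// ler0n.
have WE t a y : (t < v)%N -> U y ->
    kersum (@pt n.+1) (walsh kk) t (((a : 'F_b)%:R + y) / b%:R) =
    (b%:R ^- t.+1)%:C * (chi (k * a) * kersum (@pt n) (walsh k') t y).
  move=> tv Uy; have [|_ ->//] := @digit_block n k k' t.
    by move=> s st; apply: h0; exact: ltn_trans tv.
  rewrite mE ?(ltnW tv)// h0//; ring.
pose M := moment (@pt n) (walsh k') v.
pose q := (1 - chi k)^-1.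
pose A := - ((b%:R ^- v.+1)%:C * (M * q)).
pose G a y := (b%:R ^- v.+1)%:C * (chi (k * a) * (M * (q - y%:C) + kersum (@pt n) (walsh k') v y)).
have WvE a y : U y ->
    kersum (@pt n.+1) (walsh kk) v (((a : 'F_b)%:R + y) / b%:R) = A + G a y.
  move=> Uy; have [_ ->//] := @digit_block n k k' v h0.
  rewrite mE// partial_sum_chi// /A /G /q -/M; ring.
have n1 : 1 - chi k != 0 by rewrite subr_eq0 eq_sym chi_neq1.
have mvE : moment (@pt n.+1) (walsh kk) v.+1 = A.
  apply: moment_digit_avg => y Uy.
  rewrite (eq_bigr (fun a => A + G a y)); last by move=> a _; rewrite WvE.
  rewrite big_split /= sumr_const card_Fp// (rmorph_nat (real_complex R)) mulr_natl.
  by rewrite /G -mulr_sumr -mulr_suml sum_chi_mul// mul0r mulr0 addr0.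
have M0 : normc M <= wt_bound v k' by [].
have qS : normc q <= S^-1.
  rewrite /q normcV lef_pV2 ?le_chord// posrE ?chord_gt0//.
  by apply: lt_le_trans (le_chord R pb k0).
have nA : normc A <= wt_bound v.+1 kk.
  rewrite /A normc_N nb BvE ler_wpM2l ?invr_ge0 ?exprn_ge0 ?ler0n// normcM.
  by rewrite ler_pM ?normc_ge0.
(* q - y lies on the segment from q to q * chi k, whose ends have modulus |q| *)
have qy y : U y -> normc (q - y%:C) <= normc q.
  rewrite unit_itvE => /andP[y0 y1].
  have -> : q - y%:C = q * ((1 - y)%:C + y%:C * chi k).
    by rewrite /q rmorphB /= rmorph1; field.
  rewrite normcM ler_piMr ?normc_ge0//; apply: le_trans (normcD _ _) _.
  by rewrite normcM !normc_real normc_chi// mulr1 (ger0_norm y0) ger0_norm ?subr_ge0 ?(ltW y1)// subrK.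
have nG a y : U y -> normc (G a y) <= (1 + S * osc v) * wt_bound v.+1 kk.
  move=> Uy; rewrite /G nb normcM normc_chi// mul1r BvE mulrCA.
  rewrite ler_wpM2l ?invr_ge0 ?exprn_ge0 ?ler0n//.
  apply: le_trans (normcD _ _) _; rewrite normcM.
  have -> : (1 + S * osc v) * (wt_bound v k' / S) = wt_bound v k' * S^-1 + osc v * wt_bound v k'.
    by field; rewrite gt_eqF.
  rewrite lerD ?h3// ler_pM ?normc_ge0//; exact: le_trans (qy y Uy) qS.
have oscE : 1 + 2 * osc v.+1 = 2 + S * osc v by rewrite /=; field.
split; rewrite nzE.
- by move=> s; rewrite ltnS; exact: mE.
- by rewrite mvE.
- move=> t y; rewrite ltnS leq_eqVlt => /predU1P[->|tv] /unit_itv_digit[a [z [Uz ->]]].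
    rewrite WvE// oscE; apply: le_trans (normcD _ _) _.
    apply: le_trans (lerD nA (nG a z Uz)) _.
    by move: (wt_bound _ _) (osc v) => B o; rewrite (_ : B + (1 + S * o) * B = (2 + S * o) * B)//; ring.
  rewrite WE// nb normcM normc_chi// mul1r (BE _ (leqW tv)) mulrCA.
  by rewrite ler_wpM2l ?h2// invr_ge0 exprn_ge0// ler0n.
- move=> y Uy /=; have -> : (1 + S * osc v) / 2 * wt_bound v.+1 kk = (1 + S * osc v) * wt_bound v.+1 kk / 2.
    by ring.
  apply: le_kersumS => // Y /unit_itv_digit[a [z [Uz ->]]].
  by rewrite WvE// mvE addrC addKr nG.
- by [].
Qed.

Lemma walsh_boundsP n (k : dig b n) : walsh_bounds k.
Proof.
elim: n k => [|n IH] k; first exact: walsh_bounds0.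
case: k => k k'; have [->|k0] := eqVneq k 0; first exact: walsh_bounds_zero.
exact: walsh_bounds_nonzero.
Qed.

End Grid.

(** * Comparison with the constant of the theorem *)

Section Constant.
Variables (R : realType) (b alpha : nat).
Hypotheses (pb : prime b) (a2 : (2 <= alpha)%N).
Local Notation S := (chord R b).
Local Notation C := (Cconst R b alpha).

Let S0 : 0 < S. Proof. exact: chord_gt0. Qed.
Let b2 : 2 <= b%:R :> R. Proof. by rewrite ler_nat prime_gt1. Qed.

Let g : R := 1 + b%:R^-1 + (b%:R * (b%:R + 1))^-1.
Let K : R := 3 + 2 / b%:R + (2 * b%:R + 1) / (b%:R - 1).
Let mx : R := Num.max (2 / S ^+ alpha) (\big[Num.max/0]_(1 <= tau < alpha) (S ^+ tau)^-1).
Let CE : C = g ^+ (alpha - 2) * K * mx. Proof. by []. Qed.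

Let K5 : 5 <= K.
Proof.
have h1 : 0 <= 2 / b%:R :> R by rewrite divr_ge0 ?ler0n.
have h2 : 2 <= (2 * b%:R + 1) / (b%:R - 1) :> R.
  by rewrite ler_pdivlMr ?subr_gt0; move: b2; lra.
rewrite /K; lra.
Qed.

Let g_ge : 1 + b%:R^-1 <= g.
Proof. by rewrite /g lerDl invr_ge0 mulr_ge0 ?addr_ge0 ?ler0n. Qed.

Let g1 : 1 <= g.
Proof. by apply: le_trans g_ge; rewrite lerDl invr_ge0 ler0n. Qed.

Lemma chord_le_three_halves : (3 < b)%N -> S <= 3 / 2.
Proof.
move=> b3; have p0 := pi_gt0 R.
have b4 : 4 <= b%:R :> R by rewrite ler_nat.
have bp : 0 < b%:R :> R by apply: lt_le_trans b4.
have le4 : pi / b%:R <= pi / 4 :> R by rewrite ler_pM2l// lef_pV2 ?posrE.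
have q0 : 0 < pi / b%:R :> R by rewrite divr_gt0.
have le2 : pi / 4 <= pi / 2 :> R by rewrite ler_pM2l// lef_pV2 ?posrE// ler_nat.
have s4 : sin (pi / 4) ^+ 2 = 1 / 2 :> R.
  have := cos_mulr2n (pi / 4 : R); have -> : pi / 4 *+ 2 = pi / 2 :> R by field.
  rewrite cos_pihalf cos2sin2 => h.
  have : 2 * (1 - sin (pi / 4) ^+ 2) - 1 = 0 :> R by rewrite [RHS]h; ring.
  lra.
have sle : sin (pi / b%:R) <= sin (pi / 4) :> R.
  have [->//|ne] := eqVneq (pi / b%:R : R) (pi / 4).
  apply/ltW; have -> : (sin (pi / b%:R) < sin (pi / 4) :> R) = (pi / b%:R < pi / 4 :> R).
    by apply: ltr_sin; rewrite in_itv /=; apply/andP; split; lra.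
  by rewrite lt_neqAle ne le4.
have s0 : 0 <= sin (pi / b%:R) :> R by move: S0; rewrite /chord; lra.
rewrite /chord; suff : sin (pi / 4) <= 3 / 4 :> R by lra.
rewrite -ler_sqr ?nnegrE; [rewrite s4; lra | lra | lra].
Qed.

(** Used for b <= 3, where the power of alpha - 2 in the constant outgrows this
    bound. *)
Lemma osc_le_lin v : osc R b v <= 1 + v%:R / 2.
Proof.
elim: v => [|v IH] /=; first by rewrite mul0r addr0.
have o0 := osc_ge0 R pb v; have S2 := chord_le2 R b.
have : S * osc R b v <= 2 * osc R b v by rewrite ler_wpM2r.
rewrite -[v.+1%:R]natr1; lra.
Qed.

(** For b >= 4 the chord is at most 3 / 2 < 2, so that the recursion is bounded. *)
Lemma osc_le2 v : (3 < b)%N -> osc R b v <= 2.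
Proof.
move=> b3; elim: v => [|v IH] /=; first by lra.
have o0 := osc_ge0 R pb v; have S2 := chord_le_three_halves b3.
have : S * osc R b v <= 3 / 2 * osc R b v by rewrite ler_wpM2r.
lra.
Qed.

Let h := g ^+ (alpha - 2) * K.

Let g_pow : (b <= 3)%N -> 1 + (alpha - 2)%:R / 3 <= g ^+ (alpha - 2).
Proof.
move=> b3; have b3' : b%:R <= 3 :> R by rewrite ler_nat.
have g43 : 1 + 1 / 3 <= g.
  apply: le_trans g_ge; rewrite lerD2l div1r lef_pV2 ?posrE//; move: b2; lra.
elim: (alpha - 2)%N => [|k IH]; first by rewrite expr0 mul0r addr0.
rewrite exprS; apply: (@le_trans _ _ ((1 + 1 / 3) * (1 + k%:R / 3))).
  have := ler0n R k; rewrite -[k.+1%:R]natr1; lra.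
by rewrite ler_pM ?addr_ge0 ?divr_ge0 ?ler0n.
Qed.

Let h_ge v : (v < alpha)%N -> 1 + 2 * osc R b v <= h.
Proof.
move=> va; rewrite /h; have [b3|b3] := ltnP 3 b.
  have := osc_le2 v b3; have := exprn_ege1 (alpha - 2) g1; move: K5; nra.
have v1 : v%:R + 1 <= alpha%:R :> R by rewrite natr1 ler_nat.
have a2' : 2 <= alpha%:R :> R by rewrite ler_nat.
have := osc_le_lin v; have := g_pow b3; rewrite natrB//; move: K5 v1 a2'; nra.
Qed.

Let h_ge2 : 1 + 2 * osc R b alpha <= 2 * h.
Proof.
rewrite /h; have [b3|b3] := ltnP 3 b.
  have := osc_le2 alpha b3; have := exprn_ege1 (alpha - 2) g1; move: K5; nra.
have a2' : 2 <= alpha%:R :> R by rewrite ler_nat.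
have := osc_le_lin alpha; have := g_pow b3; rewrite natrB//; move: K5 a2'; nra.
Qed.

Let h0 : 0 <= h.
Proof. by rewrite mulr_ge0 ?exprn_ge0//; move: g1 K5; lra. Qed.

Lemma osc_le_Cconst_top : (1 + 2 * osc R b alpha) * S ^- alpha <= C.
Proof.
rewrite CE -/h; apply: (@le_trans _ _ (h * (2 / S ^+ alpha))).
  have -> : h * (2 / S ^+ alpha) = 2 * h * S ^- alpha by ring.
  by rewrite ler_wpM2r ?h_ge2// invr_ge0 exprn_ge0// ltW.
by rewrite ler_wpM2l// /mx le_max lexx.
Qed.

Let mx_ge v : (0 < v < alpha)%N -> S ^- v <= mx.
Proof.
move=> va; rewrite /mx le_max; apply/orP; right.
have : v \in index_iota 1 alpha by rewrite mem_index_iota.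
elim: (index_iota 1 alpha) => // t l IH; rewrite inE big_cons le_max => /predU1P[->|/IH ->].
  by rewrite lexx.
by rewrite orbT.
Qed.

Lemma osc_le_Cconst v : (0 < v < alpha)%N -> (1 + 2 * osc R b v) * S ^- v <= C.
Proof.
move=> va; rewrite CE -/h; have /andP[_ va'] := va.
have o0 : 0 <= 1 + 2 * osc R b v by rewrite addr_ge0 ?mulr_ge0 ?osc_ge0.
have s0 : 0 <= S ^- v by rewrite invr_ge0 exprn_ge0 ?ltW.
by rewrite ler_pM ?h_ge ?mx_ge.
Qed.

Lemma Cconst_ge2 : 2 <= C.
Proof.
have := osc_le_Cconst (v := 1); rewrite a2 => /(_ isT); apply: le_trans.
have S2 := chord_le2 R b; rewrite expr1 ler_pdivlMr//= ; lra.
Qed.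

End Constant.

Section UnivariateBound.
Variables (R : realType) (b alpha : nat).
Hypotheses (pb : prime b) (a2 : (2 <= alpha)%N).
Local Notation U := (@unit_itv R).
Local Notation C := (Cconst R b alpha).

(** Each further order halves the kernel sum, and a moment is at most the kernel
    sum of the order before. *)
Lemma kersum_tail (I : finType) (x : I -> R) (c : I -> R[i]) v E j y :
  (forall z, U z -> normc (kersum x c v z) <= E) -> U y ->
  \sum_(0 <= i < j) normc (moment x c (v + i).+1) + normc (kersum x c (v + j) y) <= 2 * E.
Proof.
move=> h.
have hk i z : U z -> normc (kersum x c (v + i) z) <= E / 2 ^+ i.
  elim: i z => [|i IH] z Uz; first by rewrite addn0 expr0 divr1 h.
  by rewrite addnS exprSr invfM mulrA; apply: le_kersumS_half.
have E0 : 0 <= E.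
  apply: le_trans (h 0 _); first exact: normc_ge0.
  by rewrite unit_itvE lexx ltr01.
move=> Uy; have hs : \sum_(0 <= i < j) normc (moment x c (v + i).+1) <= 2 * E - 2 * (E / 2 ^+ j).
  elim: j => [|j IH]; first by rewrite big_nil expr0 divr1 subrr.
  rewrite big_nat_recr //=; have := le_moment (hk j).
  rewrite exprSr invfM mulrA; lra.
by have := hk j y Uy; have : 0 <= E / 2 ^+ j by [rewrite divr_ge0// exprn_ge0]; lra.
Qed.

(** The zero vector gets the size of the discrepancy of the grid. *)
Definition wgt n (k : dig b n) : R :=
  if nzd k == 0%N then b%:R ^- n else b%:R ^- wt alpha k.

Lemma wgt_gt0 n (k : dig b n) : 0 < wgt k.
Proof. by rewrite /wgt; case: ifP => _; rewrite invr_gt0 exprn_gt0// ltr0n prime_gt0. Qed.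

(** With v nonzero digits, orders below v contribute nothing, order v
    contributes one [wt_bound] and the tail beyond it at most 2 * osc v of them.
    If v >= alpha only the kernel sum of the top order is left. *)
Lemma walsh_coef_le n (k : dig b n) y : U y ->
  \sum_(1 <= t < alpha) normc (moment (@pt R b n) (walsh R k) t)
    + normc (kersum (@pt R b n) (walsh R k) alpha.-1 y) <= C * wgt k.
Proof.
move=> Uy; have [w0 w1 w2 w3 w4] := walsh_boundsP R pb k.
set m := moment _ _ in w0 w1 *; set W := kersum _ _ in w2 w3 w4 *.
have a0 : (0 < alpha)%N by exact: ltnW.
have S0 := chord_gt0 R pb.
have bpos t : 0 <= b%:R ^- t :> R by rewrite invr_ge0 exprn_ge0.
rewrite /wgt; case: eqP => [v0|/eqP v0].
  have := @kersum_tail _ (@pt R b n) (walsh R k) 0 (b%:R ^- n) alpha.-1 y (w4 v0) Uy.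
  rewrite -/m -/W !add0n => /le_trans h.
  have -> : \sum_(1 <= t < alpha) normc (m t) = \sum_(0 <= i < alpha.-1) normc (m (0 + i).+1).
    by rewrite -[in LHS](prednK a0) big_add1.
  by apply: h; rewrite ler_wpM2r// Cconst_ge2.
have v0' : (0 < nzd k)%N by rewrite lt0n.
have [va|va] := ltnP (nzd k) alpha.
  rewrite (@wt_sat b n alpha) ?(ltnW va)//.
  have -> : \sum_(1 <= t < alpha) normc (m t) =
      normc (m (nzd k)) + \sum_(0 <= i < alpha.-1 - nzd k) normc (m (nzd k + i).+1).
    rewrite (@big_cat_nat _ _ _ (nzd k)) ?(ltnW va)//= [X in X + _]big_nat_cond big1.
      rewrite add0r big_ltn//; congr (_ + _).
      rewrite -{1}[(nzd k).+1]add0n big_addn; rewrite (_ : (alpha - _ = alpha.-1 - nzd k)%N); last by lia.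
      by apply: eq_bigr => i _; rewrite addnS addnC.
    by move=> t /andP[/andP[_ tv] _]; rewrite w0// normc0.
  have := @kersum_tail _ (@pt R b n) (walsh R k) (nzd k) _ (alpha.-1 - nzd k) y w3 Uy.
  rewrite -/m -/W subnKC; last by lia.
  move=> ht; apply: (@le_trans _ _ ((1 + 2 * osc R b (nzd k)) * wt_bound R (nzd k) k)).
    rewrite -addrA [in leRHS]mulrDl mul1r lerD// -mulrA//.
  by rewrite /wt_bound mulrCA [leRHS]mulrC ler_wpM2l// osc_le_Cconst// v0'.
rewrite big_nat_cond big1 ?add0r; last first.
  by move=> t /andP[/andP[_ ta] _]; rewrite w0 ?normc0// (leq_trans ta).
have := w2 alpha.-1 y; rewrite prednK// => /(_ va Uy) /le_trans; apply.
by rewrite /wt_bound mulrCA [leRHS]mulrC ler_wpM2l// osc_le_Cconst_top.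
Qed.

End UnivariateBound.

(** * Walsh inversion and the dual net *)

Section DigitVectors.
Variable b : nat.
Hypothesis pb : prime b.

Fixpoint digs n (a : nat -> 'F_b) : dig b n :=
  if n is n'.+1 return dig b n then (a 0%N, digs n' (a \o S)) else tt.

Fixpoint dadd n : dig b n -> dig b n -> dig b n :=
  if n is n'.+1 return dig b n -> dig b n -> dig b n
  then fun i j => (i.1 + j.1, dadd i.2 j.2) else fun _ _ => tt.

Lemma dot_digsD n (k : dig b n) (u v : nat -> 'F_b) :
  dot k (digs n (fun i => u i + v i)) = dot k (digs n u) + dot k (digs n v).
Proof.
elim: n k u v => [|n IH] k u v /=; first by rewrite addr0.
have -> : (fun i => u i + v i) \o S = fun i => (u \o S) i + (v \o S) i by [].
by rewrite IH mulrDr addrACA.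
Qed.

Lemma card_dig n : #|dig b n| = (b ^ n)%N.
Proof.
elim: n => [|n IH] /=; first by rewrite card_unit.
by rewrite card_prod IH card_Fp// expnS.
Qed.

Lemma digs_eq n (u v : nat -> 'F_b) : digs n u = digs n v -> forall i, (i < n)%N -> u i = v i.
Proof.
elim: n u v => [//|n IH] u v /= [e1 e2] [_|i] //.
by move/(IH _ _ e2).
Qed.

Lemma dot_nondeg n (k : dig b n) : nzd k != 0%N -> exists i : dig b n, dot k i != 0.
Proof.
elim: n k => [//|n IH] [k k'] /=; have [->|k0 _] := eqVneq k 0.
  by rewrite /= add0n => /IH[i hi]; exists (0, i); rewrite /= mul0r add0r.
exists (1, digs n (fun=> 0)); rewrite /= mulr1.
suff -> : dot k' (digs n (fun=> 0)) = 0 by rewrite addr0.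
by have := dot_digsD k' (fun=> 0) (fun=> 0); rewrite addr0 => /eqP; rewrite -subr_eq0 opprD addNKr oppr_eq0 => /eqP.
Qed.

Lemma nzd0_dot n (k i : dig b n) : nzd k = 0%N -> dot k i = 0.
Proof.
elim: n k i => [//|n IH] [k k'] [i i'] /=; have [->|k0] := eqVneq k 0 => //= h.
by rewrite mul0r add0r IH.
Qed.

Variable R : realType.

Lemma pt_digs n (a : nat -> 'F_b) :
  pt R (digs n a) = \sum_(1 <= i < n.+1) (nat_of_ord (a i.-1))%:R * b%:R ^- i.
Proof.
have b0 : b%:R != 0 :> R by rewrite pnatr_eq0 -lt0n prime_gt0.
elim: n a => [|n IH] a /=; first by rewrite big_geq.
rewrite IH big_ltn// mulrDl expr1; congr (_ + _).
rewrite [RHS]big_add1 /= mulr_suml; apply: eq_big_nat => i /andP[i0 _].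
by rewrite /= prednK// exprSr invfM mulrA.
Qed.

Local Notation chi := (@chi R b).

Lemma sum_chi_dot n (i j : dig b n) :
  \sum_k chi (dot k i) * chi (- dot k j) = (i == j)%:R * (b ^ n)%:R.
Proof.
elim: n i j => [|n IH] i j.
  by rewrite (sum_unit (V := R[i])) /= oppr0 chi0 mulr1; case: i; case: j; rewrite /= ?mul1r ?mulr1.
case: i j => [i i'] [j j'].
transitivity (\sum_k \sum_k' (chi (k * i) * chi (- (k * j))) * (chi (dot k' i') * chi (- dot k' j'))).
  rewrite pair_big /=; apply: eq_bigr => -[k k'] _ /=.
  by rewrite opprD !chiD//; ring.
transitivity ((\sum_k chi (k * i) * chi (- (k * j))) * ((i' == j')%:R * (b ^ n)%:R)).
  by rewrite mulr_suml; apply: eq_bigr => k _; rewrite -mulr_sumr IH.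
have -> : \sum_k chi (k * i) * chi (- (k * j)) = (i == j)%:R * b%:R.
  have [->|ij] := eqVneq i j.
    rewrite (eq_bigr (fun=> 1)) => [|k _]; last by rewrite -chiD// subrr chi0.
    by rewrite sumr_const card_Fp// mul1r.
  rewrite mul0r -[RHS](@sum_chi_mul R b pb (i - j)) ?subr_eq0//.
  by apply: eq_bigr => k _; rewrite -chiD// -mulrBr mulrC.
rewrite xpair_eqE expnS natrM; case: (i == j); case: (i' == j') => /=; ring.
Qed.

Definition wcoef n (phi : R -> R) (k : dig b n) : R[i] :=
  \sum_i walsh R k i * (phi (pt R i))%:C.

Lemma walsh_inversion n (phi : R -> R) (j : dig b n) :
  (phi (pt R j))%:C = \sum_k wcoef phi k * chi (- dot k j).
Proof.
transitivity (\sum_i (phi (pt R i))%:C * (b%:R ^- n)%:C * ((i == j)%:R * (b ^ n)%:R)).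
  rewrite (bigD1 j)//= eqxx mul1r big1 ?addr0; last by move=> i /negbTE ->; rewrite mul0r mulr0.
  rewrite -mulrA -(rmorph_nat (real_complex R)) -rmorphM /= natrX mulVf ?mulr1//.
  by rewrite expf_neq0// pnatr_eq0 -lt0n prime_gt0.
under eq_bigr => i _ do rewrite -sum_chi_dot mulr_sumr.
rewrite exchange_big; apply: eq_bigr => k _ /=; rewrite /wcoef mulr_suml.
by apply: eq_bigr => i _; rewrite /walsh; ring.
Qed.

Lemma wcoef_ker n t y (k : dig b n) :
  wcoef (fun x => ker t x y) k = kersum (@pt R b n) (walsh R k) t y.
Proof. by []. Qed.

Lemma wcoef_bern n t (k : dig b n) :
  wcoef (bern t) k = moment (@pt R b n) (walsh R k) t.
Proof. by []. Qed.

Lemma wcoef1 n (k : dig b n) : wcoef (fun=> 1) k = (nzd k == 0%N)%:R.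
Proof.
have -> : wcoef (fun=> 1) k = moment (@pt R b n) (walsh R k) 0 by [].
have [v0|v0] := eqVneq (nzd k) 0%N; last first.
  by have [w0 _ _ _ _] := walsh_boundsP R pb k; rewrite w0 ?lt0n.
rewrite /moment (eq_bigr (fun=> (b%:R ^- n)%:C)); last first.
  by move=> i _; rewrite /walsh nzd0_dot// chi0 !mulr1.
rewrite sumr_const card_dig// -(rmorphMn (real_complex R)) -[_ *+ _ in LHS]mulr_natr natrX mulVf//.
by rewrite expf_neq0// pnatr_eq0 -lt0n prime_gt0.
Qed.

End DigitVectors.

Section DualNet.
Variables (b n : nat) (p : {poly 'F_b}).
Hypotheses (pb : prime b) (irr : irreducible_poly p) (sp : size p = n.+1).

Let p0 : p != 0. Proof. by rewrite -size_poly_eq0 sp. Qed.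

Definition ldig (f : {poly 'F_b}) (i : nat) : 'F_b := laurent_frac f p i.+1%:Z.

Lemma ldigE f i : ldig f i = ((f * 'X^(i.+1)) %/ p)`_0. Proof. by []. Qed.

Lemma ldigD f g i : ldig (f + g) i = ldig f i + ldig g i.
Proof. by rewrite !ldigE mulrDl divpD coefD. Qed.

Lemma ldigN f i : ldig (- f) i = - ldig f i.
Proof. by apply/eqP; rewrite -addr_eq0 -ldigD addNr ldigE mul0r div0p coef0. Qed.

Lemma ldig_mulp f i : ldig (f * p) i = 0.
Proof. by rewrite ldigE mulrAC mulpK// coefMXn. Qed.

Lemma ldig_mod f i : ldig (f %% p) i = ldig f i.
Proof. by rewrite [in RHS](divp_eq f p) ldigD ldig_mulp add0r. Qed.

(** The exponent of the Walsh function k at the point with digits those of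
    f / p, as a linear form in f. *)
Definition dualform (k : dig b n) (f : {poly 'F_b}) : 'F_b := dot k (digs n (ldig f)).

Lemma dualformD k f g : dualform k (f + g) = dualform k f + dualform k g.
Proof.
rewrite /dualform -dot_digsD; congr (dot k (digs n _)).
by apply/funext => i; rewrite ldigD.
Qed.

Lemma dualform0 k : dualform k 0 = 0.
Proof. by have := dualformD k 0 0; rewrite addr0 => /eqP; rewrite -subr_eq0 opprD addNKr oppr_eq0 => /eqP. Qed.

Lemma dualform_mod k f : dualform k (f %% p) = dualform k f.
Proof.
rewrite /dualform; congr (dot k (digs n _)).
by apply/funext => i; rewrite ldig_mod.
Qed.

(** If the first n digits of f / p vanish, multiplication of f by 'X^i does not
    produce a polynomial part for i <= n, so the degree of f * 'X^n is still below
    n. *)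
Lemma ldig_eq0 (f : {poly 'F_b}) : (size f <= n)%N -> (forall i, (i < n)%N -> ldig f i = 0) -> f = 0.
Proof.
move=> sf h; apply/eqP; apply: contraT => f0.
have key i : (i <= n)%N -> (size (f * 'X^i)%R <= n)%N.
  elim: i => [|i IH] i_n; first by rewrite expr0 mulr1.
  have := h i i_n; rewrite ldigE => h0.
  have s1 : (size (f * 'X^(i.+1))%R <= n.+1)%N.
    rewrite exprSr mulrA; apply: leq_trans (size_polyMleq _ _) _.
    by rewrite size_polyX addn2 /= ltnS; exact: IH (ltnW i_n).
  have q0 : (f * 'X^(i.+1)) %/ p = 0.
    apply/eqP; rewrite -size_poly_eq0; move: (h0).
    have : (size ((f * 'X^(i.+1)) %/ p)%R <= 1)%N by rewrite size_divp// sp /= leq_subLR addn1.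
    move=> /size1_polyC -> ; rewrite coefC /= => ->.
    by rewrite polyC0 size_poly0.
  by move/eqP: q0; rewrite divp_eq0 (negbTE p0) sp /=; case/orP => [/eqP->|]; rewrite ?size_poly0.
have := key n (leqnn _); rewrite size_mulXn// -[X in (_ <= X)%N]addn0 leq_add2l leqn0 size_poly_eq0.
by rewrite (negbTE f0).
Qed.

(** An injective map between sets of the same size. *)
Lemma dualform_surj (i : dig b n) : exists f : {poly_n 'F_b}, digs n (ldig f) = i.
Proof.
have inj : injective (fun f : {poly_n 'F_b} => digs n (ldig f)).
  move=> f g /digs_eq h; apply/val_inj/eqP; rewrite -subr_eq0; apply/eqP/ldig_eq0.
    exact: size_npoly (f - g).
  by move=> j jn; rewrite ldigD ldigN h// subrr.
have := @inj_card_onto _ _ _ inj.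
rewrite card_dig// card_npoly card_Fp// => /(_ (leqnn _) i).
by case/codomP => f ->; exists f.
Qed.

(** As p is irreducible, multiplication by h is invertible modulo p, so every
    digit vector is that of some h * f / p. *)
Lemma dualform_nondeg (k : dig b n) (h : {poly 'F_b}) : nzd k != 0%N -> h != 0 -> (size h <= n)%N ->
  exists f : {poly_n 'F_b}, dualform k (h * f) != 0.
Proof.
move=> /dot_nondeg[i hi] h0 sh.
have [g' gi] := dualform_surj i; move: (polyn g') gi => {g'} g gi.
have cop : coprimep h p.
  rewrite coprimep_def; have gp : gcdp h p %| p := dvdp_gcdr h p.
  have [_ irr'] := irr; case: (boolP (_ == _)) => [//|g1].
  have e := eqp_size (irr' _ g1 gp); have := dvdp_leq h0 (dvdp_gcdl h p).
  by rewrite e sp ltnNge sh.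
have /Bezout_eq1_coprimepP[[u v] /= uv] := cop.
have sfn : (size ((u * g) %% p)%R <= n)%N by rewrite -ltnS -sp ltn_modp.
exists (npolyp n ((u * g) %% p)); rewrite npolypK//.
rewrite -dualform_mod modp_mul dualform_mod.
have -> : h * (u * g) = g + (- (v * g)) * p.
  rewrite -[X in _ = X + _]mul1r -uv; ring.
rewrite dualformD; have -> : dualform k (- (v * g) * p) = 0.
  rewrite -dualform_mod modp_mull dualform0//.
by rewrite addr0 /dualform gi.
Qed.

Variables (m s : nat).
Hypothesis mn : (m <= n)%N.

Implicit Types (q : 'I_s -> {poly 'F_b}) (k : 'I_s -> dig b n).

Definition netform q k (h : {poly 'F_b}) : 'F_b := \sum_j dualform (k j) (h * q j).

(** The Walsh function k is constantly 1 on the nodes of the rule. *)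
Definition in_dual q k : bool := [forall h : {poly_m 'F_b}, netform q k h == 0].

Lemma netformD q k g h : netform q k (g + h) = netform q k g + netform q k h.
Proof. by rewrite /netform -big_split; apply: eq_bigr => j _; rewrite mulrDl dualformD. Qed.

Variable R : realType.
Local Notation chi := (@chi R b).

Lemma sum_chi_netform q k :
  \sum_(h : {poly_m 'F_b}) chi (- netform q k h) = (in_dual q k)%:R * (b ^ m)%:R.
Proof.
rewrite (@sum_chi R b pb _ (fun h : {poly_m 'F_b} => - netform q k h)); last first.
  by move=> u v /=; rewrite netformD opprD.
rewrite card_npoly card_Fp// /in_dual.
have -> : [forall v : {poly_m 'F_b}, - netform q k v == 0] = [forall h : {poly_m 'F_b}, netform q k h == 0].
  by apply: eq_forallb => h; rewrite oppr_eq0.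
by case: ifP; rewrite ?mul1r ?mul0r.
Qed.

Definition setq q (j0 : 'I_s) (g : {poly 'F_b}) : 'I_s -> {poly 'F_b} :=
  fun j => if j == j0 then g else q j.

(** Summed over g and over the b^m polynomials h, the character of the net gives
    the left-hand side.  Summed over g first, only h = 0 remains. *)
Lemma count_dual q k j0 : nzd (k j0) != 0%N ->
  (b ^ m * \sum_(g : {poly_n 'F_b}) in_dual (setq q j0 g) k = b ^ n)%N.
Proof.
move=> k0; suff : ((b ^ m * \sum_(g : {poly_n 'F_b}) in_dual (setq q j0 g) k)%:R = (b ^ n)%:R :> R[i]).
  by move/eqP; rewrite eqr_nat => /eqP.
rewrite natrM natr_sum mulr_sumr.
transitivity (\sum_(g : {poly_n 'F_b}) \sum_(h : {poly_m 'F_b}) chi (- netform (setq q j0 g) k h)).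
  by apply: eq_bigr => g _; rewrite sum_chi_netform mulrC.
rewrite exchange_big /=.
pose rest (h : {poly 'F_b}) := \sum_(j | j != j0) dualform (k j) (h * q j).
have E (h : {poly 'F_b}) g : netform (setq q j0 g) k h = dualform (k j0) (h * g) + rest h.
  rewrite /netform (bigD1 j0)//= /setq eqxx; congr (_ + _).
  by apply: eq_bigr => j /negbTE ->.
transitivity (\sum_(h : {poly_m 'F_b}) (h == 0)%:R * (b ^ n)%:R : R[i]); last first.
  by rewrite (bigD1 0)//= eqxx mul1r big1 ?addr0// => h /negbTE ->; rewrite mul0r.
apply: eq_bigr => h _.
transitivity (chi (- rest h) * \sum_(g : {poly_n 'F_b}) chi (- dualform (k j0) (polyn h * polyn g))).
  by rewrite mulr_sumr; apply: eq_bigr => g _; rewrite E opprD chiD// mulrC.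
rewrite (@sum_chi R b pb _ (fun g : {poly_n 'F_b} => - dualform (k j0) (polyn h * polyn g))); last first.
  by move=> u v /=; rewrite mulrDr dualformD opprD.
have [->|h0] := eqVneq h 0.
  have -> : rest (polyn (0 : {poly_m 'F_b})) = 0 by rewrite /rest big1// => j _; rewrite mul0r dualform0.
  rewrite oppr0 chi0 !mul1r; case: ifP => [_|/forallP[]]; first by rewrite card_npoly card_Fp.
  by move=> g; rewrite mul0r dualform0 oppr0.
have h0' : (h : {poly 'F_b}) != 0 by apply: contra h0 => /eqP e; apply/eqP/val_inj.
have [f hf] := dualform_nondeg k0 h0' (leq_trans (size_npoly h) mn).
case: ifP => [/forallP/(_ f)|_]; last by rewrite mulr0 mul0r.
by rewrite oppr_eq0 (negbTE hf).
Qed.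

End DualNet.

Section LatticeSums.
Variables (R : realType) (b m n s : nat) (p : {poly 'F_b}).
Hypothesis pb : prime b.

Let b0 : (0 < b)%N. Proof. exact: prime_gt0. Qed.
Let b1 : (1 < b)%N. Proof. exact: prime_gt1. Qed.

Lemma coef_poly_of_nat h i : (poly_of_nat b h)`_i = ((h %/ b ^ i) %% b)%N%:R.
Proof.
rewrite coef_poly; case: ltnP => // hi.
rewrite divn_small ?mod0n//; apply: leq_ltn_trans hi _; exact: ltn_expl.
Qed.

Lemma natF_inj (x y : nat) : (x < b)%N -> (y < b)%N -> x%:R = y%:R :> 'F_b -> x = y.
Proof.
move=> xb yb /(congr1 (fun u : 'F_b => nat_of_ord u)).
by rewrite !val_Fp_nat// !modn_small.
Qed.

Lemma poly_of_nat_inj : injective (poly_of_nat b).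
Proof.
move=> x y e.
have {e} h i : ((x %/ b ^ i) %% b = (y %/ b ^ i) %% b)%N.
  apply: natF_inj; rewrite ?ltn_pmod//.
  by rewrite -!coef_poly_of_nat e.
move: x y h; elim/ltn_ind => x IH y h.
have h0 := h 0%N; rewrite !expn0 !divn1 in h0.
have hS i : (((x %/ b) %/ b ^ i) %% b = ((y %/ b) %/ b ^ i) %% b)%N.
  by rewrite -!divnMA -expnS h.
rewrite (divn_eq x b) (divn_eq y b) h0; congr (_ * _ + _)%N.
have [x0|x0] := posnP x; last by apply: IH => //; exact: ltn_Pdiv.
rewrite x0 div0n; have {}hS i : ((y %/ b %/ b ^ i) %% b = 0)%N by rewrite -hS x0 !div0n mod0n.
move: (y %/ b)%N hS => {h h0 x0 IH x y}; elim/ltn_ind => y IH hS.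
have := hS 0%N; rewrite expn0 divn1 => h0.
have [//|y0] := posnP y.
have yb : (0 = y %/ b)%N by apply: IH => [|i]; rewrite ?ltn_Pdiv// -divnMA -expnS hS.
by rewrite (divn_eq y b) h0 -yb.
Qed.

Lemma size_poly_of_nat h : (h < b ^ m)%N -> (size (poly_of_nat b h) <= m)%N.
Proof.
move=> hm; apply/leq_sizeP => i mi; rewrite coef_poly_of_nat divn_small ?mod0n//.
by apply: leq_trans hm _; rewrite leq_pexp2l.
Qed.

(** The integers below b^m correspond to the polynomials of degree below m. *)
Lemma sum_poly_of_nat (V : nmodType) (F : {poly 'F_b} -> V) :
  \sum_(h <- iota 0 (b ^ m)) F (poly_of_nat b h) = \sum_(g : {poly_m 'F_b}) F g.
Proof.
have -> : \sum_(h <- iota 0 (b ^ m)) F (poly_of_nat b h) = \sum_(h < b ^ m) F (poly_of_nat b h).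
  by rewrite -[in RHS](big_mkord xpredT (fun h => F (poly_of_nat b h))) /index_iota subn0.
pose phi (h : 'I_(b ^ m)) : {poly_m 'F_b} := npolyp m (poly_of_nat b h).
have phiE h : polyn (phi h) = poly_of_nat b h by rewrite /phi npolypK// size_poly_of_nat.
have phi_inj : injective phi.
  by move=> x y /(congr1 (@polyn _ _)); rewrite !phiE => /poly_of_nat_inj/val_inj.
have phi_bij : bijective phi.
  by apply: inj_card_bij => //; rewrite card_npoly card_Fp// card_ord.
rewrite [RHS](reindex phi); last exact: onW_bij.
by apply: eq_bigr => h _; rewrite phiE.
Qed.

Variable q : 'I_s -> {poly 'F_b}.

Lemma tnth_lattice_point h j :
  tnth (lattice_point R n p q h) j = pt R (digs n (ldig p (poly_of_nat b h * q j))).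
Proof.
rewrite tnth_mktuple /nu pt_digs//; apply: eq_big_nat => i /andP[i0 _].
by rewrite /ldig prednK.
Qed.

(** Expand every factor by [walsh_inversion] and sum over the nodes. *)
Lemma lattice_prod_le (phi : 'I_s -> R -> R) :
  `|qmc (lattice R m n p q) (fun x => \prod_j phi j (tnth x j))| <=
  \sum_(k : {ffun 'I_s -> dig b n}) (in_dual p m q k)%:R * \prod_j normc (wcoef (phi j) (k j)).
Proof.
have bm0 : (b ^ m)%:R != 0 :> R by rewrite pnatr_eq0 -lt0n expn_gt0 b0.
rewrite -normc_real.
suff -> : (qmc (lattice R m n p q) (fun x => \prod_j phi j (tnth x j)))%:C =
    \sum_(k : {ffun 'I_s -> dig b n}) (in_dual p m q k)%:R * \prod_j wcoef (phi j) (k j).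
  apply: le_trans (normc_sum _ _ _) _; apply: ler_sum => k _.
  rewrite normcM normc_prod ler_wpM2r ?prodr_ge0// => [*|]; first exact: normc_ge0.
  by rewrite -(rmorph_nat (real_complex R)) normc_real ger0_norm.
rewrite /qmc size_map size_iota big_map.
rewrite (eq_bigr (fun h => (fun g => \prod_j phi j (pt R (digs n (ldig p (g * q j))))) (poly_of_nat b h))); last first.
  by move=> h _ /=; apply: eq_bigr => j _; rewrite tnth_lattice_point.
rewrite (sum_poly_of_nat (fun g => \prod_j phi j (pt R (digs n (ldig p (g * q j)))))).
rewrite rmorphM /= rmorph_sum /=.
transitivity (((b ^ m)%:R^-1)%:C * \sum_(g : {poly_m 'F_b}) \sum_(k : {ffun 'I_s -> dig b n})
    (\prod_j wcoef (phi j) (k j)) * chi R (- netform p q k (polyn g))).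
  congr (_ * _); apply: eq_bigr => g _; rewrite rmorph_prod /=.
  transitivity (\prod_j \sum_(k : dig b n) wcoef (phi j) k * chi R (- dualform p k (polyn g * q j))).
    by apply: eq_bigr => j _; rewrite (walsh_inversion pb).
  rewrite bigA_distr_bigA /=; apply: eq_bigr => k _; rewrite big_split /=; congr (_ * _).
  rewrite /netform -sumrN (big_morph (@chi R b) (id1 := 1) (op1 := *%R)) ?chi0//.
  exact: chiD.
rewrite exchange_big /= mulr_sumr; apply: eq_bigr => k _.
rewrite -mulr_sumr (sum_chi_netform p pb m R q k) mulrCA [RHS]mulrC; congr (_ * _).
have -> : ((b ^ m)%:R : R[i]) = (b ^ m)%:R%:C by rewrite (rmorph_nat (real_complex R)).
by rewrite mulrCA -rmorphM /= mulVf// mulr1.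
Qed.

End LatticeSums.

Local Close Scope complex_scope.

(** * The sum of the weights *)

Section WeightSum.
Variables (R : realType) (b alpha : nat).
Hypotheses (pb : prime b) (a2 : (2 <= alpha)%N).
Variable z : R.
Hypotheses (z1 : 1 < z) (zb : z <= b%:R) (zab : b%:R < z ^+ alpha).

(* With z = b^lambda, the sums of the weights over the digit vectors with a
   given number of nonzero digits obey linear recursions in the number n of
   digits.  [Uf] and [Linf] are their fixed points, and bound them for all n. *)
Let Uf j : R := \prod_(1 <= i < j.+1) ((b%:R - 1) / (z ^+ i - 1)).
Let Linf : R := (z ^+ alpha - 1) / (z ^+ alpha - b%:R) * Uf alpha.

Let z0 : 0 < z. Proof. exact: lt_trans z1. Qed.
Let b1 : 1 < b%:R :> R. Proof. by rewrite ltr1n prime_gt1. Qed.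
Let zX j : (0 < j)%N -> 0 < z ^+ j - 1.
Proof. by move=> j0; rewrite subr_gt0 exprn_egt1// -lt0n. Qed.
Let zXV j : 0 < z ^- j. Proof. by rewrite invr_gt0 exprn_gt0. Qed.

Let UfS j : Uf j.+1 = (b%:R - 1) / (z ^+ j.+1 - 1) * Uf j.
Proof. by rewrite /Uf big_nat_recr //= mulrC. Qed.

Let Uf_fix j : Uf j.+1 = z ^- j.+1 * (Uf j.+1 + (b%:R - 1) * Uf j).
Proof.
have h := zX (ltn0Sn j); have zz : z ^+ j.+1 != 0 by rewrite expf_neq0// gt_eqF.
apply: (mulfI zz); rewrite mulVKf// UfS; field; rewrite gt_eqF//.
Qed.

Let Linf_fix : Linf = z ^- alpha * (b%:R * Linf + (b%:R - 1) * Uf alpha.-1).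
Proof.
have a0 : (0 < alpha)%N by exact: ltnW.
have h := zX a0; have zz : z ^+ alpha != 0 by rewrite expf_neq0// gt_eqF.
have hU : (b%:R - 1) * Uf alpha.-1 = (z ^+ alpha - 1) * Uf alpha.
  by rewrite -(prednK a0) UfS prednK//; field; rewrite gt_eqF.
apply: (mulfI zz); rewrite mulVKf// hU /Linf; field.
by rewrite subr_eq0 gt_eqF.
Qed.

Lemma sum_digS n (G : dig b n.+1 -> R) (H : dig b n -> R) :
  (forall (k : 'F_b) k', k != 0 -> G (k, k') = H k') ->
  \sum_k G k = \sum_k' G (0, k') + (b%:R - 1) * \sum_k' H k'.
Proof.
move=> h; transitivity (\sum_(k : 'F_b) \sum_(k' : dig b n) G (k, k')).
  by rewrite pair_big; apply: eq_bigr => -[k k'] _.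
rewrite (bigD1 0)//=; congr (_ + _).
rewrite (eq_bigr (fun=> \sum_k' H k')); last by move=> k k0; apply: eq_bigr => k' _; exact: h.
rewrite sumr_const -[LHS]mulr_natl; congr (_ * _).
have : #|[pred k : 'F_b | k != 0]|.+1 = b.
  by rewrite -[RHS](card_Fp pb) -(cardC (pred1 (0 : 'F_b))) card1.
by move=> /(congr1 (fun m : nat => m%:R : R)); rewrite -natr1 => <-; rewrite addrK.
Qed.

Let E n j : R := \sum_(k : dig b n) (nzd k == j)%:R * z ^- wt alpha k.
Let L n : R := \sum_(k : dig b n) (alpha <= nzd k)%N%:R * z ^- wt alpha k.
Let Z n : R := \sum_(k : dig b n) (nzd k == 0%N)%:R * z ^- n.

Let E00 : E 0 0 = 1.
Proof. by rewrite /E (sum_unit (V := R)) /= expr0 invr1 mulr1. Qed.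

Let EnS n j : (j.+1 < alpha)%N -> E n.+1 j.+1 = z ^- j.+1 * (E n j.+1 + (b%:R - 1) * E n j).
Proof.
move=> ja; rewrite /E (@sum_digS n _ (fun k' => (nzd k' == j)%:R * z ^- (wt alpha k' + j.+1))).
  rewrite mulrDr mulr_sumr; congr (_ + _).
    apply: eq_bigr => k' _ /=; case: eqP => [->|_]; last by rewrite !mul0r mulr0.
    rewrite (minn_idPr (ltnW ja)) exprD invfM; ring.
  rewrite mulrCA; congr (_ * _); rewrite mulr_sumr; apply: eq_bigr => k' _.
  rewrite exprD invfM; ring.
move=> k k' k0 /=; rewrite k0 add1n eqSS; case: eqP => [->|_]; last by rewrite !mul0r.
by rewrite (minn_idPr (ltnW ja)).
Qed.

Let En0 n : E n 0 = 1.
Proof.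
elim: n => [|n IH]; first exact: E00.
rewrite /E (@sum_digS n _ (fun=> 0)); last by move=> k k' k0 /=; rewrite k0 mul0r.
rewrite sumr_const mul0rn mulr0 addr0 -[RHS]IH; apply: eq_bigr => k' _ /=.
by case: eqP => [->|_]; rewrite ?mul0r// minn0 addn0.
Qed.

Let ZE n : Z n = z ^- n.
Proof.
elim: n => [|n IH]; first by rewrite /Z (sum_unit (V := R)) /= mul1r.
rewrite /Z (@sum_digS n _ (fun=> 0)); last by move=> k k' k0 /=; rewrite k0 mul0r.
rewrite sumr_const mul0rn mulr0 addr0 exprS invfM -[in RHS]IH /Z mulr_sumr.
by apply: eq_bigr => k' _ /=; rewrite mulrCA.
Qed.

Let LnS n : L n.+1 = z ^- alpha * (b%:R * L n + (b%:R - 1) * E n alpha.-1).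
Proof.
have a0 : (0 < alpha)%N by exact: ltnW.
rewrite /L (@sum_digS n _ (fun k' => (alpha.-1 <= nzd k')%N%:R * z ^- (wt alpha k' + alpha))).
  transitivity (z ^- alpha * L n + (b%:R - 1) * (z ^- alpha * (L n + E n alpha.-1))); last by rewrite -/(L n); ring.
  congr (_ + _ * _).
    rewrite /L mulr_sumr; apply: eq_bigr => k' _ /=.
    case: leqP => h; last by rewrite !mul0r mulr0.
    rewrite exprD invfM; ring.
  rewrite /L /E -big_split mulr_sumr /=; apply: eq_bigr => k' _ /=.
  rewrite -mulrDl exprD invfM -natrD.
  have -> : ((alpha <= nzd k') + (nzd k' == alpha.-1) = (alpha.-1 <= nzd k') :> nat)%N.
    by move: (nzd k') => v; rewrite -{1}(prednK a0) /=; case: ltngtP.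
  ring.
move=> k k' k0 /=; rewrite k0 add1n -{1}(prednK a0) ltnS; case: leqP => h; last by rewrite !mul0r.
by rewrite (minn_idPl _)// -(prednK a0).
Qed.

Let b10 : 0 <= b%:R - 1 :> R. Proof. by rewrite subr_ge0 ltW. Qed.

Let Uf_ge0 j : 0 <= Uf j.
Proof.
rewrite /Uf big_nat_cond; apply: prodr_ge0 => i /andP[/andP[i1 _] _].
by rewrite divr_ge0// ltW// zX.
Qed.

Let Elast n : E 0 n.+1 = 0.
Proof. by rewrite /E (sum_unit (V := R)) /= mul0r. Qed.

Let E_le n j : (j < alpha)%N -> E n j <= Uf j.
Proof.
elim: n j => [|n IH] [|j] ja.
- by rewrite E00 /Uf big_geq.
- by rewrite Elast.
- by rewrite En0 /Uf big_geq.
rewrite EnS// Uf_fix ler_pM2l// lerD ?IH// ler_wpM2l// IH// ltnW//.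
Qed.

(* The zero vector has weight z^-n; together with the vectors with one nonzero
   digit it still stays below the fixed point. *)
Let ZE_le n : Z n + E n 1 <= Uf 1.
Proof.
have U1 : Uf 1 = (b%:R - 1) / (z - 1) by rewrite /Uf big_nat1 expr1.
elim: n => [|n IH].
  by rewrite ZE Elast expr0 invr1 addr0 U1 ler_pdivlMr ?subr_gt0// mul1r lerD2r.
have U0 : Uf 0 = 1 by rewrite /Uf big_geq.
rewrite ZE in IH; rewrite ZE EnS// En0 [leRHS]Uf_fix U0.
have -> : z ^- n.+1 = z ^- 1 * z ^- n by rewrite exprS invfM expr1.
by rewrite -mulrDr ler_pM2l// addrA lerD.
Qed.

Let Linf_ge0 : 0 <= Linf.
Proof.
rewrite mulr_ge0// divr_ge0// ?subr_ge0 ltW// exprn_egt1// -lt0n; exact: ltnW.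
Qed.

Let L_le n : L n <= Linf.
Proof.
have a0 : (0 < alpha)%N by exact: ltnW.
elim: n => [|n IH].
  by rewrite /L (sum_unit (V := R)) /= leqNgt a0 mul0r.
rewrite LnS Linf_fix ler_pM2l// lerD// ler_wpM2l ?ler0n//.
by rewrite E_le// prednK.
Qed.

Lemma sum_weights_le n :
  \sum_(k : dig b n) (if nzd k == 0%N then z ^- n else z ^- wt alpha k) <=
  \sum_(1 <= tau < alpha) Uf tau + Linf.
Proof.
apply: (@le_trans _ _ (Z n + \sum_(1 <= j < alpha) E n j + L n)).
  rewrite /Z /L /E exchange_big /= -!big_split /=; apply: ler_sum => k _.
  have pos : 0 <= z ^- wt alpha k by rewrite ltW.
  case: eqP => [v0|/eqP v0].
    by rewrite mul1r -addrA lerDl addr_ge0 ?sumr_ge0// => *; rewrite ?mulr_ge0.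
  rewrite mul0r add0r; have [va|va] := leqP alpha (nzd k).
    by rewrite mul1r lerDr sumr_ge0// => *; rewrite mulr_ge0.
  rewrite mul0r addr0 (bigD1_seq (nzd k)) ?iota_uniq ?mem_index_iota ?lt0n ?v0//=.
  by rewrite eqxx mul1r lerDl sumr_ge0// => *; rewrite mulr_ge0.
rewrite lerD// (big_ltn a2) [in leRHS](big_ltn a2) addrA lerD//.
rewrite big_nat_cond [leRHS]big_nat_cond; apply: ler_sum => j /andP[/andP[_ ja] _].
exact: E_le.
Qed.

End WeightSum.

Section WeightPower.
Variables (R : realType) (b alpha : nat).
Hypotheses (pb : prime b) (a2 : (2 <= alpha)%N).
Variable lambda : R.
Hypothesis hl : alpha%:R^-1 < lambda < 1.

Let b0 : 0 < b%:R :> R. Proof. by rewrite ltr0n prime_gt0. Qed.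
Let b1 : 1 < b%:R :> R. Proof. by rewrite ltr1n prime_gt1. Qed.
Let z := b%:R `^ lambda.
Let l0 : 0 < lambda.
Proof. by case/andP: hl => h _; apply: le_lt_trans h; rewrite invr_ge0 ler0n. Qed.

Lemma powR_exprV k : (b%:R ^- k) `^ lambda = (b%:R `^ lambda) ^- k.
Proof. by rewrite -powR_invn ?ler0n// powRAC powR_invn ?powR_ge0. Qed.

Lemma powR_lt_base (y : R) : 0 < y -> 1 < b%:R `^ y.
Proof.
move=> y0; rewrite -[X in X < _]expR0.
by rewrite /powR gt_eqF// ltr_expR mulr_gt0// ln_gt0.
Qed.

Lemma sum_wgt_powR n : \sum_(k : dig b n) wgt R alpha k `^ lambda <= Aconst b alpha lambda.
Proof.
have z1 : 1 < z by exact: powR_lt_base.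
have zb : z <= b%:R.
  rewrite -[X in _ <= X](powRr1 (ltW b0)); apply: ler_powR; first exact: ltW.
  by case/andP: hl => _ /ltW.
have BE i : b%:R `^ (lambda * i%:R) = z ^+ i by rewrite powRrM powR_mulrn// powR_ge0.
have zab : b%:R < z ^+ alpha.
  rewrite -BE; have a0 : 0 < alpha%:R :> R by rewrite ltr0n; exact: ltnW.
  have e : lambda * alpha%:R = 1 + (lambda * alpha%:R - 1) by ring.
  rewrite e powRD ?(gt_eqF b0) ?implybT// powRr1 ?ler0n// ltr_pMr//.
  apply: powR_lt_base; rewrite subr_gt0 mulrC -ltr_pdivrMl ?mulr1//.
  by case/andP: hl.
have := sum_weights_le pb a2 z1 zb zab n.
rewrite (eq_bigr (fun k : dig b n => wgt R alpha k `^ lambda)); last first.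
  by move=> k _; rewrite /wgt; case: ifP => _; rewrite powR_exprV.
move=> /le_trans; apply; rewrite /Aconst BE lerD//.
  apply: ler_sum => t _; rewrite le_eqVlt; apply/orP; left; apply/eqP.
  by apply: eq_bigr => i _; rewrite BE.
rewrite le_eqVlt; apply/orP; left; apply/eqP; congr (_ * _).
by apply: eq_bigr => i _; rewrite BE.
Qed.

Lemma Aconst_ge1 : 1 <= Aconst b alpha lambda.
Proof.
have := sum_wgt_powR 0; rewrite (sum_unit (V := R)) /wgt /= expr0 invr1.
by rewrite powR1.
Qed.

End WeightPower.

(** * The error of a single rule *)

Lemma is_mixed_derivs_smooth (R : realType) s alpha (f : s.-tuple R -> R) D :
  @is_mixed_derivs R s alpha f D -> smooth_family D.
Proof. by case=> _ iD fD; split=> // h h' j e1 e2 x cx t t01; exact: fD. Qed.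

Section KernelBounds.
Variables (R : realType) (b alpha n : nat).
Hypotheses (pb : prime b) (a2 : (2 <= alpha)%N).
Local Notation C := (Cconst R b alpha).
Local Notation mom k t := (normc (moment (@pt R b n) (walsh R k) t)).

Let a0 : (0 < alpha)%N. Proof. exact: ltnW. Qed.

(** The top order is given whatever the other orders leave of the bound of
    [walsh_coef_le], so that the sum over the positive orders is exactly
    C * wgt k. *)
Definition kbound (a : nat) (k : dig b n) : R :=
  if a == 0%N then (nzd k == 0%N)%:R
  else if (a < alpha)%N then mom k a
  else C * wgt R alpha k - \sum_(1 <= t < alpha) mom k t.

Lemma kbound_top_ge (k : dig b n) y : unit_itv y ->
  normc (kersum (@pt R b n) (walsh R k) alpha.-1 y) <= kbound alpha k.
Proof.
move=> Uy; rewrite /kbound gtn_eqF// ltnn lerBrDl.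
exact: walsh_coef_le.
Qed.

Lemma kbound_ge0 a (k : dig b n) : (a <= alpha)%N -> 0 <= kbound a k.
Proof.
rewrite leq_eqVlt => /predU1P[->|al].
  apply: le_trans (kbound_top_ge k (y := 0) _); first exact: normc_ge0.
  by rewrite unit_itvE lexx ltr01.
by rewrite /kbound al; case: ifP => _ //; exact: normc_ge0.
Qed.

Lemma normc_wcoef_kfun a (k : dig b n) y : (a <= alpha)%N -> unit_itv y ->
  normc (wcoef (fun x => kfun alpha a x y) k) <= kbound a k.
Proof.
move=> aa Uy; move: aa; rewrite leq_eqVlt => /predU1P[->|al].
  by apply: le_trans (kbound_top_ge k Uy); rewrite /kfun ltnn wcoef_ker.
rewrite /kfun al /kbound al; case: eqP => [->|_]; last by rewrite wcoef_bern.
by rewrite wcoef1// -(rmorph_nat (real_complex R)) normc_real ger0_norm.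
Qed.

Lemma sum_kbound (k : dig b n) :
  \sum_(a : 'I_alpha.+1 | a != ord0) kbound a k = C * wgt R alpha k.
Proof.
rewrite big_mkcond big_ord_recl /= add0r.
transitivity (\sum_(1 <= t < alpha.+1) kbound t k); first by rewrite big_add1 big_mkord.
rewrite big_nat_recr//= {2}/kbound gtn_eqF// ltnn.
rewrite (eq_big_nat _ _ (F2 := fun t => mom k t)) => [|t /andP[t0 ta]].
  by rewrite addrC subrK.
by rewrite /kbound gtn_eqF// ta.
Qed.
End KernelBounds.

Section SingleRule.
Variables (R : realType) (b alpha m n s : nat) (p : {poly 'F_b}).
Hypotheses (pb : prime b) (a2 : (2 <= alpha)%N).
Variables (q : \bar R) (gamma : {set 'I_s} -> R).
Hypotheses (q1 : (1 <= q)%E) (gamma0 : forall u, 0 < gamma u).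
Variable g : 'I_s -> {poly 'F_b}.
Local Notation C := (Cconst R b alpha).
Local Notation P := (lattice R m n p g).
Local Notation freq := {ffun 'I_s -> dig b n}.

(** The inner sum runs over the frequencies in the dual net that vanish outside
    u. *)
Definition figure_of_merit : R :=
  \sum_(u : {set 'I_s} | u != finset.set0) gamma u *
    \sum_(k : freq) (in_dual p m g k)%:R *
      \prod_j (if j \in u then C * wgt R alpha (k j) else (nzd (k j) == 0%N)%:R).

Let a0 : (0 < alpha)%N. Proof. exact: ltnW. Qed.

Definition supp (h : diff_order s alpha) : {set 'I_s} := [set j | h j != ord0]%SET.

Definition top (h : diff_order s alpha) : {set 'I_s} := [set j | h j == ord_max]%SET.

Lemma top_subset h : top h \subset supp h.
Proof.
apply/fintype.subsetP => j; rewrite !inE => /eqP ->.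
by rewrite -val_eqE /= -lt0n.
Qed.

Lemma order_of_supp h : order_of (supp h) (top h) h.
Proof.
apply/forallP => j; rewrite !inE; have [-> //|_] := eqVneq (h j) ord_max.
by have [-> //|h0] := eqVneq (h j) ord0; rewrite lt0n.
Qed.

Lemma mem_lattice_cube x : x \in P -> cube x.
Proof.
move=> /mapP[h _ ->] j; rewrite tnth_lattice_point//.
by have := pt_unit R pb (digs n (ldig p (poly_of_nat b h * g j))); rewrite unit_itvE.
Qed.

Let size_P : size P = (b ^ m)%N. Proof. by rewrite size_map size_iota. Qed.

Let bm0 : (b ^ m)%:R != 0 :> R.
Proof. by rewrite pnatr_eq0 -lt0n expn_gt0 prime_gt0. Qed.

(** The value of the rule on the product of kernels attached to the order h,
    the second arguments being frozen. *)
Definition qmc_kernel (h : diff_order s alpha) (y : s.-tuple R) : R :=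
  qmc P (fun x => \prod_j kfun alpha (h j) (tnth x j) (tnth y j)).

Lemma bdd_qmc_kernel h : bdd_meas (@cube R s) (qmc_kernel h).
Proof.
apply: bdd_measM; first exact: bdd_meas_cst.
by apply: bdd_meas_sum => x _; exact: bdd_prod_kfun.
Qed.

Lemma qmc_kernel0 y : qmc_kernel [ffun=> ord0] y = 1.
Proof.
rewrite /qmc_kernel /qmc size_P (eq_bigr (fun=> 1)) => [|x _].
  by rewrite big_const_seq count_predT iter_addr addr0 size_P mulVf.
by rewrite big1// => j _; rewrite ffunE /kfun a0.
Qed.

(** Only kernels of the top order depend on the second argument. *)
Lemma qmc_kernel_merge h (x : #|top h|.-tuple R) y y' :
  qmc_kernel h (merge_pair (x, y)) = qmc_kernel h (merge_pair (x, y')).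
Proof.
rewrite /qmc_kernel /qmc; congr (_ * _); apply: eq_bigr => z _; apply: eq_bigr => j _.
have [jt|jt] := boolP (j \in top h); first by rewrite !tnth_mktuple jt.
rewrite /kfun ltn_neqAle -ltnS ltn_ord andbT.
by move: jt; rewrite inE -val_eqE /= => ->.
Qed.

Definition dual_sum (h : diff_order s alpha) : R :=
  \sum_(k : freq) (in_dual p m g k)%:R * \prod_j kbound R alpha (h j) (k j).

Lemma le_qmc_kernel h y : cube y -> `|qmc_kernel h y| <= dual_sum h.
Proof.
move=> cy; have H := @lattice_prod_le R b m n s p pb g (fun j x => kfun alpha (h j) x (tnth y j)).
apply: le_trans H _.
apply: ler_sum => k _; apply: ler_wpM2l => //; apply: ler_prod => j _.
rewrite normc_ge0/=; apply: normc_wcoef_kfun => //; first by rewrite -ltnS.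
by rewrite unit_itvE.
Qed.

(** Apply the rule to [sobolev_representation]; the term of order 0 is the
    integral. *)
Lemma qmc_error f D : is_mixed_derivs f D ->
  qmc P f - integral_cube f =
  \sum_(h : diff_order s alpha | h != [ffun=> ord0])
    \int[leb R s]_(y in @cube R s) (D h y * qmc_kernel h y).
Proof.
move=> fD; have sD := is_mixed_derivs_smooth fD; have [D0 iD _] := fD.
have i_term h x : (leb R s).-integrable (@cube R s)
    (EFin \o (fun y => D h y * \prod_j kfun alpha (h j) (tnth x j) (tnth y j))).
  under eq_fun do rewrite mulrC.
  by apply: bdd_meas_integrableM => //; [exact: measurable_cube|exact: bdd_prod_kfun].
have -> : qmc P f = \sum_(h : diff_order s alpha)
    \int[leb R s]_(y in @cube R s) (D h y * qmc_kernel h y).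
  transitivity ((size P)%:R^-1 * \sum_(x <- P) \sum_(h : diff_order s alpha)
      \int[leb R s]_(y in @cube R s) (D h y * \prod_j kfun alpha (h j) (tnth x j) (tnth y j))).
    rewrite /qmc; congr (_ * _); apply: eq_big_seq => x /mem_lattice_cube cx.
    by rewrite -D0// (sobolev_representation a0 sD cx).
  rewrite exchange_big mulr_sumr; apply: eq_bigr => h _ /=.
  rewrite -Rintegral_sum => [|| x]; last 2 first.
  - exact: measurable_cube.
  - exact: i_term.
  rewrite -RintegralZl; last 2 first.
  - exact: measurable_cube.
  - apply: integrable_sumR => [|x]; [exact: measurable_cube|exact: i_term].
  apply: eq_Rintegral => y _; rewrite /qmc_kernel /qmc -mulr_sumr; ring.
rewrite (bigD1 [ffun=> ord0])//= addrAC.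
have -> : \int[leb R s]_(y in @cube R s) (D [ffun=> ord0] y * qmc_kernel [ffun=> ord0] y) =
    integral_cube f.
  by apply: eq_Rintegral => y /set_mem cy; rewrite qmc_kernel0 mulr1 D0.
by rewrite subrr add0r.
Qed.

(** Group the orders by their support u.  The sum over the orders with support
    u of a product over the coordinates is a product of sums, by [sum_kbound]. *)
Lemma figure_of_meritE :
  \sum_(h : diff_order s alpha | h != [ffun=> ord0]) dual_sum h * gamma (supp h) =
  figure_of_merit.
Proof.
rewrite (partition_big supp (fun u => u != finset.set0)) /=; last first.
  move=> h h0; apply: contra h0 => /eqP h0; apply/eqP/ffunP => j; rewrite ffunE.
  have : j \notin supp h by rewrite h0 finset.in_set0.
  by rewrite inE negbK => /eqP.
apply: eq_bigr => u u0.
transitivity (\sum_(h | supp h == u) gamma u * dual_sum h).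
  apply: eq_big => [h|h /andP[_ /eqP <-]]; last by rewrite mulrC.
  apply: andb_idl => /eqP hu; apply: contra u0 => /eqP h0.
  by rewrite -hu h0; apply/eqP/setP => j; rewrite !inE ffunE eqxx.
rewrite -mulr_sumr; congr (_ * _); rewrite /dual_sum exchange_big.
apply: eq_bigr => k _ /=; rewrite -mulr_sumr; congr (_ * _).
pose Q (j : 'I_s) (a : 'I_alpha.+1) := (a != ord0) == (j \in u).
transitivity (\prod_j \sum_(a | Q j a) kbound R alpha a (k j)).
  rewrite (bigA_distr_big_dep Q (fun j (a : 'I_alpha.+1) => kbound R alpha a (k j))).
  apply: eq_bigl => h; apply/eqP/familyP => h_u.
    by move=> j; rewrite unfold_in /Q -h_u inE.
  by apply/setP => j; rewrite inE; have := h_u j; rewrite unfold_in /Q => /eqP.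
apply: eq_bigr => j _; rewrite /Q; case: (j \in u).
  by rewrite -(sum_kbound R a2); apply: eq_bigl => a; rewrite eqb_id.
rewrite (big_pred1 ord0) => [|a]; first by [].
by rewrite eqbF_neg negbK.
Qed.

Theorem single_rule_error f : sob_ball alpha q gamma f ->
  `|qmc P f - integral_cube f| <= figure_of_merit.
Proof.
move=> [D fD normD]; have [_ iD _] := fD.
rewrite (qmc_error fD) -figure_of_meritE.
apply: le_trans (ler_norm_sum _ _ _) _; apply: ler_sum => h _.
rewrite -lee_fin; apply: le_trans (le_integral_abs_mean (v := top h) (iD h)
  (bdd_qmc_kernel h) (le_qmc_kernel h) (@qmc_kernel_merge h)) _.
rewrite EFinM lee_wpmul2l//; last first.
  exact: (le_integral_abs_mean_gamma q1 gamma0 iD normD (top_subset h) (order_of_supp h)).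
rewrite lee_fin sumr_ge0// => k _; rewrite mulr_ge0// prodr_ge0// => j _.
by apply: kbound_ge0 => //; rewrite -ltnS.
Qed.

End SingleRule.

(** * The mean of the figure of merit over random generating vectors *)

Section Resampling.
Variables (b n s : nat).
Hypothesis pb : prime b.
Local Notation vec := {ffun 'I_s -> {poly_n 'F_b}}.
Implicit Types (w : vec) (g : {poly_n 'F_b}).

Definition setw w (j0 : 'I_s) g : vec := [ffun j => if j == j0 then g else w j].

Lemma setwK w j0 g : setw (setw w j0 g) j0 (w j0) = w.
Proof. by apply/ffunP => j; rewrite !ffunE; case: eqP => [->|]. Qed.

Lemma setw_Gvec w j0 g :
  (setw w j0 g \in Gvec b n s) && (w j0 \in Gset b n) =
  (w \in Gvec b n s) && (g \in Gset b n).
Proof.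
apply/andP/andP => -[]; rewrite finset.in_set => /forallP h1 h2.
  split; last by have := h1 j0; rewrite ffunE eqxx.
  rewrite finset.in_set; apply/forallP => j; have := h1 j; rewrite ffunE.
  by case: eqP => [->|].
split=> //; rewrite finset.in_set; apply/forallP => j; rewrite ffunE.
by case: eqP.
Qed.

(** Exchanging g with the coordinate j0 of w is an involution of the set of
    pairs over which the sum is taken. *)
Lemma sum_Gvec_resample j0 (F : vec -> nat) :
  (\sum_(w in Gvec b n s) \sum_(g in Gset b n) F (setw w j0 g) =
   #|Gset b n| * \sum_(w in Gvec b n s) F w)%N.
Proof.
pose swap (z : vec * {poly_n 'F_b}) := (setw z.1 j0 z.2, z.1 j0).
have swapK : involutive swap.
  move=> [w g]; rewrite /swap /= setwK; congr pair.
  by rewrite ffunE eqxx.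
rewrite pair_big /= (reindex_inj (inv_inj swapK)) /=.
transitivity (\sum_(z : vec * {poly_n 'F_b} | (z.1 \in Gvec b n s) && (z.2 \in Gset b n)) F z.1)%N.
  apply: eq_big => [[w g]|[w g] _] /=; first exact: setw_Gvec.
  by rewrite setwK.
rewrite -(pair_big (mem (Gvec b n s)) (mem (Gset b n)) (fun w _ => F w)) /= big_distrr /=.
by apply: eq_bigr => w _; rewrite sum_nat_const.
Qed.

Lemma card_Gset : #|Gset b n| = (b ^ n - 1)%N.
Proof.
have -> : Gset b n = (~: [set 0])%SET by apply/setP => g; rewrite finset.in_set finset.in_setC finset.in_set1.
by rewrite cardsC1 card_npoly card_Fp// subn1.
Qed.

Variables (m : nat) (p : {poly 'F_b}).
Hypotheses (irr : irreducible_poly p) (sp : size p = n.+1) (mn : (m <= n)%N).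

(** By resampling the coordinate j0 it suffices to count the admissible values of
    this coordinate, the others being fixed.  At most b^(n-m) of b^n - 1 values
    are admissible, by [count_dual]. *)
Lemma count_dual_Gvec (R : realType) (k : 'I_s -> dig b n) j0 : nzd (k j0) != 0%N ->
  ((b ^ m - 1) * \sum_(w in Gvec b n s) in_dual p m (fun j => w j : {poly 'F_b}) k
   <= #|Gvec b n s|)%N.
Proof.
move=> k0; set S := (\sum_(w in _) _)%N.
pose F w : nat := in_dual p m (fun j => w j : {poly 'F_b}) k.
have H : (b ^ m * (#|Gset b n| * S) <= #|Gvec b n s| * b ^ n)%N.
  rewrite -(sum_Gvec_resample j0 F) big_distrr /= -sum_nat_const.
  apply: leq_sum => w _.
  rewrite -(count_dual pb irr sp mn R (fun j => w j : {poly 'F_b}) k0) leq_mul2l; apply/orP; right.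
  rewrite [leqLHS]big_mkcond /=; apply: leq_sum => g _; case: ifP => // _.
  rewrite /F (_ : (fun j => _) = setq (fun j => w j : {poly 'F_b}) j0 g)//.
  by apply/funext => j; rewrite /setq ffunE; case: ifP.
have bn0 : (0 < b ^ n)%N by rewrite expn_gt0 prime_gt0.
have bmn : (b ^ m <= b ^ n)%N by rewrite leq_pexp2l// prime_gt0.
rewrite -(leq_pmul2r bn0); apply: leq_trans H.
rewrite card_Gset mulnAC mulnA; apply: leq_mul => //.
by rewrite mulnBr mulnBl mul1n muln1; apply: leq_sub2l.
Qed.

End Resampling.

Section PowerSums.
Variables (R : realType) (lambda : R).
Hypothesis l01 : 0 < lambda <= 1.

Let l0 : 0 < lambda. Proof. by case/andP: l01. Qed.

(** For 0 <= t <= 1 one has t <= t^lambda; apply this to the fractions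
    x / (x + y) and y / (x + y). *)
Lemma powRD_le (x y : R) : 0 <= x -> 0 <= y -> (x + y) `^ lambda <= x `^ lambda + y `^ lambda.
Proof.
move=> x0 y0; have [->|xy0] := eqVneq (x + y) 0.
  by rewrite powR0 ?gt_eqF// addr_ge0// powR_ge0.
have {xy0} xy0 : 0 < x + y by rewrite lt0r xy0 addr_ge0.
have frac z : 0 <= z <= x + y -> z / (x + y) * (x + y) `^ lambda <= z `^ lambda.
  move=> /andP[z0 zxy]; have [->|zn0] := eqVneq z 0; first by rewrite !mul0r powR_ge0.
  have q0 : 0 < z / (x + y) by rewrite divr_gt0// lt0r zn0.
  have -> : z `^ lambda = (z / (x + y)) `^ lambda * (x + y) `^ lambda.
    by rewrite -powRM ?ltW// divfK// gt_eqF.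
  apply: ler_wpM2r; first exact: powR_ge0.
  apply: ger1_powR; last by case/andP: l01.
  by rewrite q0 ler_pdivrMr// mul1r.
have <- : x / (x + y) * (x + y) `^ lambda + y / (x + y) * (x + y) `^ lambda = (x + y) `^ lambda.
  by rewrite -mulrDl -mulrDl divff ?gt_eqF// mul1r.
by apply: lerD; apply: frac; rewrite ?x0 ?y0 /= ?lerDl ?lerDr.
Qed.

Lemma powR_sum_le (I : Type) (r : seq I) (P : pred I) (F : I -> R) :
  (forall i, P i -> 0 <= F i) ->
  (\sum_(i <- r | P i) F i) `^ lambda <= \sum_(i <- r | P i) F i `^ lambda.
Proof.
move=> F0; elim: r => [|i r IH]; first by rewrite !big_nil powR0// gt_eqF.
rewrite !big_cons; case: ifP => // Pi.
apply: le_trans (powRD_le (F0 i Pi) _) _; last by rewrite lerD2l.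
exact: sumr_ge0.
Qed.

Lemma powR_prod (I : Type) (r : seq I) (P : pred I) (F : I -> R) :
  (forall i, P i -> 0 <= F i) ->
  (\prod_(i <- r | P i) F i) `^ lambda = \prod_(i <- r | P i) F i `^ lambda.
Proof.
move=> F0; elim: r => [|i r IH]; first by rewrite !big_nil powR1.
rewrite !big_cons; case: ifP => // Pi.
by rewrite powRM ?F0// ?prodr_ge0// IH.
Qed.

Lemma powR_bool (B : bool) : (B%:R : R) `^ lambda = B%:R.
Proof. by case: B; rewrite ?powR1// powR0// gt_eqF. Qed.
End PowerSums.

Section Expectation.
Variables (R : realType) (b alpha m n s : nat) (p : {poly 'F_b}).
Hypotheses (pb : prime b) (a2 : (2 <= alpha)%N) (irr : irreducible_poly p) (sp : size p = n.+1).
Hypotheses (m0 : (0 < m)%N) (n0 : (0 < n)%N) (mn : (m <= n)%N).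
Variable gamma : {set 'I_s} -> R.
Hypothesis gamma0 : forall u, 0 < gamma u.
Variable lambda : R.
Hypothesis hl : alpha%:R^-1 < lambda < 1.
Local Notation C := (Cconst R b alpha).
Local Notation A := (Aconst b alpha lambda).
Local Notation freq := {ffun 'I_s -> dig b n}.
Local Notation wt := (wgt R alpha).
Local Notation gvec w := (fun j => w j : {poly 'F_b}).

Let l0 : 0 < lambda.
Proof. by case/andP: hl => h _; apply: le_lt_trans h; rewrite invr_ge0 ler0n. Qed.

Let l01 : 0 < lambda <= 1.
Proof. by rewrite l0 /=; case/andP: hl => _ /ltW. Qed.

Let C0 : 0 < C.
Proof. by apply: lt_le_trans (Cconst_ge2 R pb a2). Qed.

Definition cfac (u : {set 'I_s}) (j : 'I_s) (k : dig b n) : R :=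
  if j \in u then C `^ lambda * wt k `^ lambda else (nzd k == 0%N)%:R.

Lemma cfac_ge0 u j k : 0 <= cfac u j k.
Proof. by rewrite /cfac; case: ifP => _ //; rewrite mulr_ge0 ?powR_ge0. Qed.

Lemma figure_of_merit_powR g :
  figure_of_merit alpha m n p gamma g `^ lambda <=
  \sum_(u : {set 'I_s} | u != finset.set0) gamma u `^ lambda *
    \sum_(k : freq) (in_dual p m g k)%:R * \prod_j cfac u j (k j).
Proof.
have f0 (u : {set 'I_s}) (k : freq) j :
    0 <= (if j \in u then C * wt (k j) else (nzd (k j) == 0%N)%:R).
  by case: ifP => _ //; rewrite mulr_ge0 ?ltW// wgt_gt0.
have t0 (u : {set 'I_s}) (k : freq) : 0 <= (in_dual p m g k)%:R *
    \prod_j (if j \in u then C * wt (k j) else (nzd (k j) == 0%N)%:R).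
  by rewrite mulr_ge0// prodr_ge0.
pose X (u : {set 'I_s}) := gamma u * \sum_(k : freq) (in_dual p m g k)%:R *
  \prod_j (if j \in u then C * wt (k j) else (nzd (k j) == 0%N)%:R).
have X0 (u : {set 'I_s}) : u != finset.set0 -> 0 <= X u.
  by move=> _; apply: mulr_ge0; [exact: ltW|exact: sumr_ge0].
apply: le_trans (powR_sum_le l01 (index_enum {set 'I_s}) X0) _.
apply: ler_sum => u _; rewrite powRM ?sumr_ge0 ?(ltW (gamma0 u))//.
apply: ler_wpM2l; first exact: powR_ge0.
apply: le_trans (powR_sum_le l01 (index_enum freq) (P := xpredT) (fun k _ => t0 u k)) _.
apply: ler_sum => k _.
rewrite powRM ?prodr_ge0// powR_bool// powR_prod//.
rewrite le_eqVlt; apply/orP; left; apply/eqP; congr (_ * _).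
apply: eq_bigr => j _; rewrite /cfac; case: ifP => _; last exact: powR_bool.
by rewrite powRM// ltW// wgt_gt0.
Qed.

Lemma sum_nzd0 : \sum_(k : dig b n) ((nzd k == 0%N)%:R : R) = 1.
Proof.
elim: n => [|n' IH]; first by rewrite (sum_unit (V := R)).
rewrite (@sum_digS R b pb n' _ (fun=> 0)) => [|k k' k0]; last by rewrite /= k0.
rewrite [X in _ * X]big1// mulr0 addr0 -[RHS]IH.
by apply: eq_bigr.
Qed.

Lemma sum_prod_cfac u :
  \sum_(k : freq) \prod_j cfac u j (k j) <= C `^ (lambda * #|u|%:R) * A ^+ #|u|.
Proof.
rewrite -bigA_distr_bigA /= powRrM powR_mulrn ?powR_ge0// -exprMn.
rewrite (bigID (mem u)) /= [X in _ * X]big1 => [|j ju]; last first.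
  by under eq_bigr do rewrite /cfac (negbTE ju); exact: sum_nzd0.
rewrite mulr1 -prodr_const; apply: ler_prod => j ju.
rewrite sumr_ge0 => [|k _]; last exact: cfac_ge0.
under eq_bigr do rewrite /cfac ju.
by rewrite -mulr_sumr ler_wpM2l ?powR_ge0// sum_wgt_powR.
Qed.

(** Frequency vectors without nonzero digits, which no choice of the generating
    vector avoids. *)
Lemma sum_prod_cfac_zero u : u != finset.set0 ->
  \sum_(k : freq) [forall j, nzd (k j) == 0%N]%:R * \prod_j cfac u j (k j) <=
  b%:R `^ (- (lambda * n%:R)) * (C `^ (lambda * #|u|%:R) * A ^+ #|u|).
Proof.
move=> u0; set B := b%:R `^ (- (lambda * n%:R)).
have B01 : 0 <= B <= 1.
  rewrite powR_ge0 /B powRN invf_le1 ?powR_gt0 ?ltr0n ?prime_gt0//.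
  by apply/ltW/powR_lt_base => //; rewrite mulr_gt0// ltr0n.
have wB (k : dig b n) : nzd k = 0%N -> wt k `^ lambda = B.
  by rewrite /wgt => ->; rewrite eqxx powR_exprV /B powRN powRrM powR_mulrn// powR_ge0.
apply: (@le_trans _ _ (\prod_j (if j \in u then C `^ lambda * B else 1))).
  rewrite le_eqVlt; apply/orP; left; apply/eqP.
  transitivity (\sum_(k : freq) \prod_j ((nzd (k j) == 0%N)%:R * cfac u j (k j))).
    apply: eq_bigr => k _; rewrite big_split /=; congr (_ * _).
    case: forallP => [h|h]; first by rewrite big1// => j _; rewrite h.
    have /existsP[j kj] : [exists j, nzd (k j) != 0%N].
      by rewrite -negb_forall; apply/forallP.
    by rewrite (bigD1 j)//= (negbTE kj) mul0r.
  rewrite -(bigA_distr_bigA (fun j (k : dig b n) => (nzd k == 0%N)%:R * cfac u j k)) /=.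
  apply: eq_bigr => j _; rewrite -[RHS]mulr1 -[X in _ = _ * X]sum_nzd0 mulr_sumr.
  apply: eq_bigr => k _; rewrite mulrC /cfac; case: eqP => [k0|]; last by rewrite !mulr0.
  by rewrite !mulr1; case: ifP; rewrite ?(wB k k0).
rewrite -big_mkcond /= prodr_const exprMn powRrM powR_mulrn ?powR_ge0// mulrCA.
apply: ler_wpM2l; first by rewrite exprn_ge0// powR_ge0.
have u1 : (0 < #|u|)%N by rewrite card_gt0.
rewrite -(prednK u1) exprS; apply: ler_pM.
- by case/andP: B01.
- by rewrite exprn_ge0//; case/andP: B01.
- by [].
- apply: (@le_trans _ _ 1); first by case/andP: B01 => ? ?; exact: exprn_ile1.
  by apply: exprn_ege1; exact: Aconst_ge1.
Qed.

Lemma sum_in_dual_le (k : freq) :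
  \sum_(w in Gvec b n s) (in_dual p m (gvec w) k)%:R <=
  #|Gvec b n s|%:R * ([forall j, nzd (k j) == 0%N]%:R + ((b ^ m)%:R - 1)^-1) :> R.
Proof.
have bm1 : (1 < b ^ m)%N by rewrite -(exp1n m) ltn_exp2r// prime_gt1.
have bm0 : 0 < (b ^ m)%:R - 1 :> R by rewrite subr_gt0 ltr1n.
rewrite -natr_sum; case: forallP => [h|h].
  apply: (@le_trans _ _ #|Gvec b n s|%:R).
    by rewrite ler_nat -sum1_card; apply: leq_sum => w _; exact: leq_b1.
  by rewrite mulrDr mulr1 lerDl mulr_ge0// invr_ge0 ltW.
have /existsP[j kj] : [exists j, nzd (k j) != 0%N].
  by rewrite -negb_forall; apply/forallP.
rewrite add0r ler_pdivlMr// mulrC -(natrB _ (ltnW bm1)) -natrM ler_nat.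
exact: (count_dual_Gvec pb irr sp mn R (k := k) kj).
Qed.

(** Each of the two contributions, of the frequencies with and without a nonzero
    digit, is at most one half of the right-hand side. *)
Lemma mean_figure_of_merit :
  \sum_(w in Gvec b n s) figure_of_merit alpha m n p gamma (gvec w) `^ lambda <=
  #|Gvec b n s|%:R * (2 / (b%:R `^ Num.min m%:R (lambda * n%:R) - 1) *
    \sum_(u : {set 'I_s} | u != finset.set0)
       gamma u `^ lambda * C `^ (lambda * #|u|%:R) * A ^+ #|u|).
Proof.
set N : R := #|Gvec b n s|%:R; set M := b%:R `^ _ - 1.
have N0 : 0 <= N by exact: ler0n.
have b1 : 1 <= b%:R :> R by rewrite ler1n prime_gt0.
have M0 : 0 < M.
  rewrite subr_gt0; apply: powR_lt_base => //; rewrite lt_min ltr0n m0 mulr_gt0//.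
  by rewrite ltr0n.
have h1 : ((b ^ m)%:R - 1)^-1 <= M^-1.
  have bm1 : 1 < (b ^ m)%:R :> R by rewrite ltr1n -(exp1n m) ltn_exp2r// prime_gt1.
  rewrite lef_pV2 ?posrE// ?subr_gt0//.
  rewrite lerD2r natrX -powR_mulrn ?ler0n//.
  by apply: ler_powR => //; rewrite ge_min lexx.
have h2 : b%:R `^ (- (lambda * n%:R)) <= M^-1.
  have bl : 0 < b%:R `^ (lambda * n%:R) :> R by apply: powR_gt0; rewrite ltr0n prime_gt0.
  rewrite powRN lef_pV2 ?posrE//.
  rewrite lerBlDr; apply: (@le_trans _ _ (b%:R `^ (lambda * n%:R))).
    by apply: ler_powR => //; rewrite ge_min lexx orbT.
  by rewrite lerDl.
apply: (@le_trans _ _ (\sum_(w in Gvec b n s) \sum_(u : {set 'I_s} | u != finset.set0)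
    gamma u `^ lambda * \sum_(k : freq) (in_dual p m (gvec w) k)%:R * \prod_j cfac u j (k j))).
  by apply: ler_sum => w _; exact: figure_of_merit_powR.
rewrite exchange_big /= mulr_sumr mulr_sumr; apply: ler_sum => u u0.
rewrite -mulr_sumr exchange_big /=.
set K := C `^ (lambda * #|u|%:R) * A ^+ #|u|.
rewrite -[gamma u `^ lambda * _ * _]mulrA -/K.
rewrite [leRHS](_ : _ = gamma u `^ lambda * (N * (M^-1 * K + M^-1 * K))); last by ring.
apply: ler_wpM2l; first exact: powR_ge0.
apply: (@le_trans _ _ (N * (\sum_(k : freq) [forall j, nzd (k j) == 0%N]%:R * \prod_j cfac u j (k j)
    + ((b ^ m)%:R - 1)^-1 * \sum_(k : freq) \prod_j cfac u j (k j)))).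
  rewrite [X in _ + X]mulr_sumr -big_split mulr_sumr; apply: ler_sum => k _ /=.
  rewrite -mulr_suml -mulrDl mulrA; apply: ler_wpM2r; last exact: sum_in_dual_le.
  by apply: prodr_ge0 => j _; exact: cfac_ge0.
have K0 : 0 <= K.
  by rewrite mulr_ge0 ?powR_ge0// exprn_ge0// (le_trans ler01)// Aconst_ge1.
apply: ler_wpM2l => //; apply: lerD.
  apply: le_trans (sum_prod_cfac_zero u0) _; exact: ler_wpM2r.
apply: ler_pM => //; last exact: sum_prod_cfac.
- have bm1 : 1 <= (b ^ m)%:R :> R by rewrite ler1n expn_gt0 prime_gt0.
  by rewrite invr_ge0 subr_ge0.
- by apply: sumr_ge0 => k _; apply: prodr_ge0 => j _; exact: cfac_ge0.
Qed.
End Expectation.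

(** * Medians and independent draws *)

Section Median.
Variable R : realType.

Lemma count_ge_tail (P : pred R) (l : seq R) i : (i <= size l)%N ->
  (forall j, (i <= j < size l)%N -> P (nth 0 l j)) -> (size l - i <= count P l)%N.
Proof.
move=> il h; rewrite -{2}(cat_take_drop i l) count_cat.
have : all P (drop i l).
  apply/(all_nthP 0) => j; rewrite size_drop nth_drop => jl.
  by apply: h; rewrite leq_addr/= -ltn_subRL.
by rewrite all_count => /eqP ->; rewrite size_drop leq_addl.
Qed.

Lemma count_ge_head (P : pred R) (l : seq R) i : (i <= size l)%N ->
  (forall j, (j < i)%N -> P (nth 0 l j)) -> (i <= count P l)%N.
Proof.
move=> il h; rewrite -(cat_take_drop i l) count_cat.
have : all P (take i l).
  apply/(all_nthP 0) => j; rewrite size_takel// => ji.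
  by rewrite nth_take// h.
by rewrite all_count => /eqP ->; rewrite size_takel// leq_addr.
Qed.

(** If the median is outside of an interval, so are all the entries at least as
    far out on the same side, which are more than half of them. *)
Lemma median_itv (l : seq R) (x y : R) : odd (size l) ->
  (count (fun z => ~~ (x <= z <= y)%R) l < (size l).+1./2)%N -> x <= median l <= y.
Proof.
move=> ol; set P := fun z => _; set t := sort <=%R l.
have st : size t = size l by rewrite size_sort.
rewrite -(count_sort <=%R P l) -/t /median -/t -st => cP.
have ot : odd (size t) by rewrite st.
have half : (size t).+1./2 = (size t)./2.+1.
  by rewrite -[in LHS](odd_double_half (size t)) ot add1n -doubleS doubleK.
have dt : (size t = (size t)./2.*2.+1)%N by rewrite -[in LHS](odd_double_half (size t)) ot.
have ht : ((size t)./2 < size t)%N by rewrite [ltnRHS]dt ltnS -addnn leq_addr.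
have sorted_t : sorted <=%R t by apply: sort_sorted; exact: le_total.
have mono i j : (i <= j)%N -> (j < size t)%N -> nth 0 t i <= nth 0 t j.
  move=> ij jt; apply: (sorted_leq_nth le_trans lexx 0 sorted_t) => //.
  exact: leq_ltn_trans jt.
set k := (size t)./2 in half dt ht cP *.
apply/andP; split; rewrite leNgt; apply/negP => bad.
  have : (k.+1 <= count P t)%N.
    apply: count_ge_head => // j jk; rewrite /P negb_and -ltNge.
    by rewrite (le_lt_trans (mono _ _ _ ht) bad).
  by rewrite leqNgt -half cP.
have : (size t - k <= count P t)%N.
  apply: count_ge_tail; first exact: ltnW.
  move=> j /andP[kj jt]; rewrite /P negb_and -!ltNge.
  by rewrite (lt_le_trans bad (mono _ _ kj jt)) orbT.
by rewrite [X in (X - _)%N]dt -addnn -addSn addnK leqNgt -half cP.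
Qed.
End Median.

Section UnionBound.
Variables (R : realType) (T : finType) (A B : {set T}) (r k : nat) (eta : R).
Hypotheses (A0 : (0 < #|A|)%N) (BA : B \subset A) (BAeta : #|B|%:R <= eta * #|A|%:R).
Variable E : {ffun 'I_r -> T} -> Prop.
Hypothesis E_of_few : forall w : {ffun 'I_r -> T}, (forall l, w l \in A) ->
  (#|[set l | w l \in B]%SET| < k)%N -> E w.

Let N : R := #|A|%:R.
Let N0 : 0 < N. Proof. by rewrite ltr0n. Qed.
Let d (t : T) : R := (t \in A)%:R / N.

Let d_ge0 t : 0 <= d t. Proof. by rewrite divr_ge0// ltW. Qed.

Let sum_d : \sum_t d t = 1.
Proof.
rewrite -mulr_suml -natr_sum -big_mkcond /= sum1_card.
by rewrite divff// gt_eqF.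
Qed.

Let prod_d (w : {ffun 'I_r -> T}) :
  \prod_l d (w l) = if [forall l, w l \in A] then \prod_(l < r) N^-1 else 0.
Proof.
case: forallP => [h|h]; first by apply: eq_bigr => l _; rewrite /d h mul1r.
have /existsP[l wl] : [exists l, w l \notin A] by rewrite -negb_forall; apply/forallP.
by rewrite (bigD1 l)//= /d (negbTE wl) !mul0r.
Qed.

Let subset_of_card (Z : {set 'I_r}) : (k <= #|Z|)%N ->
  exists2 S : {set 'I_r}, S \subset Z & #|S| == k.
Proof.
move=> kZ; exists [set x in take k (enum Z)]%SET.
  by apply/fintype.subsetP => x; rewrite finset.in_set => /mem_take; rewrite mem_enum.
by rewrite cardsE (card_uniqP _) ?take_uniq ?enum_uniq// size_takel -?cardE.
Qed.

(** If the event fails, the bad draws contain a set S of k indices; for given S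
    this has probability at most eta^k, and there are 'C(r, k) sets S. *)
Lemma iid_uniform_pr_ge : 1 - 'C(r, k)%:R * eta ^+ k <= iid_uniform_pr R A E.
Proof.
have total : \sum_(w : {ffun 'I_r -> T}) \prod_l d (w l) = 1.
  by rewrite -(bigA_distr_bigA (fun=> d)) big1// => l _; rewrite sum_d.
have -> : iid_uniform_pr R A E = \sum_(w : {ffun 'I_r -> T} | `[< E w >]) \prod_l d (w l).
  rewrite /iid_uniform_pr big_mkcondl; apply: eq_bigr => w _; by rewrite prod_d.
rewrite lerBlDr -[leLHS]total [leLHS](bigID (fun w => `[< E w >])) /= lerD2l.
pose F (S : {set 'I_r}) (l : 'I_r) (t : T) := (if l \in S then (t \in B)%:R else 1) * d t.
apply: (@le_trans _ _ (\sum_(w : {ffun 'I_r -> T}) \sum_(S : {set 'I_r} | #|S| == k)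
    \prod_l F S l (w l))).
  rewrite big_mkcond /=; apply: ler_sum => w _.
  have F0 (S : {set 'I_r}) : 0 <= \prod_l F S l (w l).
    by apply: prodr_ge0 => l _; rewrite mulr_ge0//; case: ifP.
  case: asboolP => /= [_|nE]; first by apply: sumr_ge0.
  have [wA|wA] := boolP [forall l, w l \in A]; last first.
    by rewrite prod_d (negbTE wA); apply: sumr_ge0.
  have /subset_of_card[S SZ Sk] : (k <= #|[set l | w l \in B]%SET|)%N.
    by rewrite leqNgt; apply/negP => /E_of_few h; apply: nE; apply: h => l; exact: (forallP wA).
  rewrite (bigD1 S)//= [leLHS](_ : _ = \prod_l F S l (w l)) ?lerDl ?sumr_ge0//.
  apply: eq_bigr => l _; rewrite /F; case: ifP => lS; last by rewrite mul1r.
  by have := fintype.subsetP SZ l lS; rewrite finset.in_set => ->; rewrite mul1r.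
rewrite exchange_big /=.
have -> : 'C(r, k)%:R * eta ^+ k = \sum_(S : {set 'I_r} | #|S| == k) eta ^+ k.
  rewrite sumr_const -[in LHS](card_ord r) -card_draws mulr_natl.
  by congr (_ *+ _); apply: eq_card => S; rewrite finset.in_set.
apply: ler_sum => S /eqP Sk.
rewrite -(bigA_distr_bigA (F S)) (bigID (mem S)) /= [X in _ * X]big1 => [|l lS]; last first.
  by rewrite -[RHS]sum_d; apply: eq_bigr => t _; rewrite /F (negbTE lS) mul1r.
rewrite mulr1 -Sk -prodr_const; apply: ler_prod => l lS; apply/andP; split.
  by apply: sumr_ge0 => t _; rewrite mulr_ge0//; case: ifP.
have -> : \sum_t F S l t = #|B|%:R / N.
  rewrite -sum1_card natr_sum mulr_suml [RHS]big_mkcond /=; apply: eq_bigr => t _.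
  rewrite /F lS /d; case: ifP => tB; last by rewrite !mul0r.
  by rewrite (fintype.subsetP BA t tB) !mul1r.
by rewrite ler_pdivrMr.
Qed.
End UnionBound.

(** * The worst-case error of the median rule *)

Section Markov.
Variables (R : realType) (b alpha m n s : nat) (p : {poly 'F_b}).
Hypotheses (pb : prime b) (a2 : (2 <= alpha)%N) (s1 : (1 <= s)%N).
Hypotheses (irr : irreducible_poly p) (sp : size p = n.+1).
Hypotheses (m0 : (0 < m)%N) (n0 : (0 < n)%N) (mn : (m <= n)%N).
Variables (gamma : {set 'I_s} -> R) (eta : R).
Hypotheses (gamma0 : forall u, 0 < gamma u) (eta0 : 0 < eta).
Local Notation C := (Cconst R b alpha).
Local Notation vec := {ffun 'I_s -> {poly_n 'F_b}}.

Definition merit (w : vec) : R :=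
  figure_of_merit alpha m n p gamma (fun j => w j : {poly 'F_b}).

Definition best_bound : \bar R :=
  ereal_inf [set (error_bound b m n alpha gamma eta lambda)%:E
            | lambda in [set l : R | (alpha%:R^-1 < l < 1)%R]].

Definition bad_vec : {set vec} :=
  [set w in Gvec b n s | ~~ `[< ((merit w)%:E <= best_bound)%E >]]%SET.

Lemma card_Gvec_gt0 : (0 < #|Gvec b n s|)%N.
Proof.
apply/card_gt0P; exists [ffun=> npolyp n 1]; rewrite finset.in_set.
apply/forallP => j; rewrite ffunE finset.in_set; apply/eqP => /(congr1 (@polyn _ _)).
by rewrite npolypK ?size_poly1// => /eqP; rewrite oner_eq0.
Qed.

(** Markov's inequality for the power lambda of the figure of merit. *)
Lemma merit_gt_bound lambda : alpha%:R^-1 < lambda < 1 ->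
  #|[set w in Gvec b n s | error_bound b m n alpha gamma eta lambda < merit w]%SET|%:R
  <= eta * #|Gvec b n s|%:R.
Proof.
move=> hl; have l0 : 0 < lambda.
  by case/andP: hl => h _; apply: le_lt_trans h; rewrite invr_ge0 ler0n.
set Z := [set w in _ | _]%SET; set N : R := #|Gvec b n s|%:R.
have mean := mean_figure_of_merit pb a2 irr sp m0 n0 mn gamma0 hl.
set c := (X in _ <= _ * X) in mean.
have bE : error_bound b m n alpha gamma eta lambda = (c / eta) `^ lambda^-1.
  by rewrite /error_bound /c; congr (_ `^ _); rewrite invfM; ring.
have M0 : 0 < b%:R `^ Num.min m%:R (lambda * n%:R) - 1 :> R.
  rewrite subr_gt0; apply: powR_lt_base => //; rewrite lt_min ltr0n m0 mulr_gt0//.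
  by rewrite ltr0n.
have c0 : 0 < c.
  rewrite /c mulr_gt0 ?divr_gt0//.
  have t0 (u : {set 'I_s}) : 0 < gamma u `^ lambda * C `^ (lambda * #|u|%:R) * Aconst b alpha lambda ^+ #|u|.
    rewrite !mulr_gt0 ?powR_gt0 ?exprn_gt0//.
      by apply: lt_le_trans (Cconst_ge2 R pb a2).
    by apply: lt_le_trans (Aconst_ge1 pb a2 hl).
  have u1 : [set Ordinal s1]%SET != finset.set0 :> {set 'I_s}.
    by apply/set0Pn; exists (Ordinal s1); rewrite finset.in_set1.
  rewrite (bigD1 ([set Ordinal s1]%SET : {set 'I_s}))//= ltr_wpDr// sumr_ge0// => u _; exact: ltW.
suff : #|Z|%:R * (c / eta) <= N * c.
  rewrite mulrA ler_pdivrMr// => h; rewrite -(ler_pM2r c0).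
  by apply: le_trans h _; rewrite mulrC mulrA.
apply: le_trans mean; rewrite -sum1_card natr_sum mulr_suml.
rewrite big_mkcond [leRHS]big_mkcond /=; apply: ler_sum => w _.
rewrite finset.in_set; case: (w \in Gvec b n s) => //=; case: ifP => [|_]; last exact: powR_ge0.
rewrite bE mul1r => h; have ce : 0 <= c / eta by rewrite divr_ge0 ?ltW.
rewrite -[leLHS](powRr1 ce) -(mulVf (lt0r_neq0 l0)) powRrM.
have x0 := powR_ge0 (c / eta) lambda^-1.
by apply: ge0_ler_powR; rewrite ?nnegrE ?(ltW l0)//; [exact: le_trans (ltW h)|exact: ltW].
Qed.

(** The infimum over lambda costs nothing: of the finitely many bad vectors take
    one with least figure of merit.  It exceeds the bound for some lambda, and then
    all bad vectors exceed the bound for this lambda. *)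
Lemma card_bad_vec : #|bad_vec|%:R <= eta * #|Gvec b n s|%:R.
Proof.
have [->|[w0 w0B]] := set_0Vmem bad_vec.
  by rewrite cards0 mulr_ge0// ltW.
have [w] := @arg_minP _ _ _ w0 (mem bad_vec) merit w0B => wB' wmin.
have wB : w \in bad_vec := wB'.
have : (best_bound < (merit w)%:E)%E.
  by move: wB; rewrite finset.in_set => /andP[_ /asboolPn]; move=> /negP; rewrite -ltNge.
move=> /ereal_inf_lt[_ [lambda hl <-]]; rewrite lte_fin => h.
apply: le_trans (merit_gt_bound hl); rewrite ler_nat; apply: subset_leq_card.
apply/fintype.subsetP => v vB; rewrite finset.in_set.
move: (vB); rewrite finset.in_set => /andP[-> _] /=.
by apply: lt_le_trans h _; exact: wmin.
Qed.
End Markov.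

Theorem theorem3p7 (R : realType) (b s m n : nat) (p : {poly 'F_b}) (r : nat) :
  prime b -> (1 <= s)%N -> (0 < m)%N -> (0 < n)%N -> (m <= n)%N ->
  irreducible_poly p -> size p = n.+1 ->
  (0 < r)%N -> odd r ->
  forall (alpha : nat) (q : \bar R) (gamma : {set 'I_s} -> R) (eta : R),
  (2 <= alpha)%N -> (1 <= q)%E ->
  (forall u, 0 < gamma u) -> gamma finset.set0 = 1 ->
  0 < eta < 1 ->
  1 - 'C(r, r.+1./2)%:R * eta ^+ r.+1./2 <=
  iid_uniform_pr R (Gvec b n s) (fun qs : {ffun 'I_r -> _} =>
    (e_wor alpha q gamma
       (median_rule (R := R) m n p (fun l j => qs l j : {poly 'F_b}))
     <= ereal_inf [set (error_bound b m n alpha gamma eta lambda)%:E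
                  | lambda in [set l : R | (alpha%:R^-1 < l < 1)%R]])%E).
Proof.
move=> pb s1 m0 n0 mn irr sp r0 or alpha q gamma eta a2 q1 gamma0 _ /andP[eta0 _].
have bad_le := card_bad_vec pb a2 s1 irr sp m0 n0 mn gamma0 eta0.
apply: (iid_uniform_pr_ge _ _ bad_le).
- exact: card_Gvec_gt0.
- by apply/fintype.subsetP => w; rewrite finset.in_set => /andP[].
move=> w wG few; apply: ge_ereal_sup => _ [f f_ball <-].
rewrite -/(best_bound b alpha m n gamma eta); set V := best_bound _ _ _ _ _ _ in few *.
pose err l := `|qmc (lattice R m n p (fun j => w l j : {poly 'F_b})) f - integral_cube f|.
have good l : w l \notin bad_vec alpha m n p gamma eta -> ((err l)%:E <= V)%E.
  rewrite finset.in_set wG /= negbK => /asboolP; apply: le_trans.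
  by rewrite lee_fin; rewrite /err /merit; exact: (single_rule_error m n p pb a2 q1 gamma0 _ f_ball).
have [l lg] : exists l, w l \notin bad_vec alpha m n p gamma eta.
  apply/existsP; rewrite -negb_forall; apply/negP => /forallP h; move: few.
  rewrite (_ : [set l | _]%SET = [set: 'I_r]%SET) ?cardsT ?card_ord; first by lia.
  by apply/setP => l; rewrite finset.in_set h finset.in_setT.
case VE : V (good l lg) => [v| |] // _; last by rewrite leey.
rewrite lee_fin ler_distl /median_rule; apply: median_itv; first by rewrite size_map size_enum_ord.
rewrite size_map size_enum_ord count_map; apply: leq_ltn_trans few.
rewrite -sum1_count big_enum_cond /= -sum1_card big_mkcond [leqRHS]big_mkcond /=.
apply: leq_sum => i _; rewrite [i \in [set l | _]%SET]finset.in_set.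
have [iB|iB] := boolP (w i \in _); first by case: ifP.
by have := good i iB; rewrite VE lee_fin /err ler_distl => ->.
Qed.
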